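(* Let $d\geq2$. Then there is $\alpha_0=\alpha_0(d)>0$ with the following property: let $a>0$ and let $\omega\colon(0,a)\to(0,\infty)$ be injective of the form $$\omega(t)=t\left(\log\frac1t\right)^{\alpha_0}.$$ Then the set of functions $\rho\in C([0,1]^d)$ for which the pushforward equation $$f_\sharp(\rho\mathcal{L})=\mathcal{L}|_{f([0,1]^d)}$$ admits an injective bi-$\omega$ solution $f\colon[0,1]^d\to\mathbb{R}^d$ is a $\sigma$-porous subset of the space $C([0,1]^d)$ of continuous functions with the supremum norm. Likewise, the set of functions $\rho\in L^\infty([0,1]^d)$ for which this equation admits an injective bi-$\omega$ solution $f\colon[0,1]^d\to\mathbb{R}^d$ is a $\sigma$-porous subset of $L^\infty([0,1]^d)$ with the $L^\infty$-norm.
   Context: $\mathcal{L}$ is the $d$-dimensional Lebesgue measure, $\rho\mathcal{L}$ is the (possibly signed) measure $S\mapsto\int_S\rho\,\mathrm{d}\mathcal{L}$ on $[0,1]^d$, $f_\sharp\nu(S):=\nu(f^{-1}(S))$ is the pushforward, and for $\rho$ taking negative values $f_\sharp\rho\mathcal{L}:=f_\sharp\rho^+\mathcal{L}-f_\sharp\rho^-\mathcal{L}$. $\mathcal{L}|_E$ is the restriction of $\mathcal{L}$ to $E$. Function spaces consist of real-valued functions. Given a strictly increasing function $\omega\colon(0,a)\to(0,\infty)$ with $\lim_{t\to0}\omega(t)=0$, a mapping $f\colon A\subseteq\mathbb{R}^d\to\mathbb{R}^k$ is called an $\omega$-mapping ($\omega$-continuous) if there is $K>0$ such that $\|f(y)-f(x)\|_2\leq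 K\omega(\|y-x\|_2)$ for all $x,y\in A$ with $0<\|y-x\|_2<a$. An injective mapping $f\colon A\to\mathbb{R}^k$ is a bi-$\omega$-mapping if both $f$ and $f^{-1}\colon f(A)\to A$ are $\omega$-continuous. In a metric space $(X,d)$, a set $P\subseteq X$ is porous if for every $x\in X$ there are $\varepsilon_0>0$ and $\alpha\in(0,1)$ such that for every $\varepsilon\in(0,\varepsilon_0)$ there exists $y\in X$ with $d(y,x)\leq\varepsilon$ and $B(y,\alpha\varepsilon)\cap P=\emptyset$. A set is $\sigma$-porous if it is a countable union of porous subsets of $X$. *)

(* Defs.v *)
From HB Require Import structures.
From mathcomp Require Import all_boot all_order all_algebra.
From mathcomp Require Import all_classical all_reals all_analysis.
From mathcomp Require Import measurable_realfun.

Set Implicit Arguments.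
Unset Strict Implicit.
Unset Printing Implicit Defensive.

Import Order.TTheory GRing.Theory Num.Theory.
Import numFieldNormedType.Exports.

Local Open Scope classical_set_scope.
Local Open Scope ring_scope.

Definition rV_display : measure_display. Proof. exact. Qed.

(* The Borel sigma-algebra of R^n, generated by the coordinates exactly as the
   library does for n.-tuple R; 'rV[R]_n is used because it also carries the
   topology of R^n. *)
Section rV_measurable.
Variables (R : realType) (n : nat).

Let coords : 'I_n -> 'rV[R]_n -> measurableTypeR R := fun i x => x ord0 i.

Let rV_set0 : g_sigma_preimage coords set0.
Proof. exact: sigma_algebra0. Qed.

Let rV_setC A : g_sigma_preimage coords A -> g_sigma_preimage coords (~` A).
Proof. exact: sigma_algebraC. Qed.

Let rV_bigcup (F : _^nat) : (forall i, g_sigma_preimage coords (F i)) ->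
  g_sigma_preimage coords (\bigcup_i (F i)).
Proof. exact: sigma_algebra_bigcup. Qed.

HB.instance Definition _ := @isMeasurable.Build rV_display
  'rV[R]_n (g_sigma_preimage coords) rV_set0 rV_setC rV_bigcup.

Lemma measurable_coord (i : 'I_n) :
  measurable_fun [set: 'rV[R]_n] (fun x => x ord0 i : measurableTypeR R).
Proof.
move=> _ Y mY; rewrite setTI; apply: sub_sigma_algebra => /=.
rewrite -bigcup_seq/=; exists i => /=; first by rewrite mem_index_enum.
by exists Y => //; rewrite setTI.
Qed.

Lemma measurable_fun_rVP d (T : measurableType d) (f : T -> 'rV[R]_n) :
  measurable_fun [set: T] f <->
  forall i, measurable_fun [set: T] (fun x => f x ord0 i : measurableTypeR R).
Proof.
split=> [mf i|mf]; first exact: measurableT_comp (measurable_coord i) mf.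
apply: (measurability
  (\big[setU/set0]_(i < n) preimage_set_system setT (coords i) measurable)) => //.
move=> _ [B + <-]; rewrite -bigcup_seq => -[i _ [A mA <-]].
by rewrite [X in setT `&` (f @^-1` X)]setTI; exact: mf.
Qed.

Lemma measurable_rV_box (A : 'I_n -> set (measurableTypeR R)) :
  (forall i, measurable (A i)) ->
  measurable [set x : 'rV[R]_n | forall i, A i (x ord0 i)].
Proof.
move=> mA.
rewrite (_ : mkset _ =
    \big[setI/setT]_(i < n) ((fun x : 'rV[R]_n => x ord0 i) @^-1` A i)).
  apply: bigsetI_measurable => i _; rewrite -[X in measurable X]setTI.
  exact: measurable_coord.
rewrite -bigcap_seq; apply/seteqP; split=> x /= Ax i; first by move=> _; exact: Ax.
by apply: Ax; rewrite /= mem_index_enum.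
Qed.

End rV_measurable.

Section lebesgue_rV.
Variable R : realType.

Definition rV_cons n (p : measurableTypeR R * 'rV[R]_n) : 'rV[R]_n.+1 :=
  \row_j (if unlift ord0 j is Some k then p.2 ord0 k else p.1).

Definition rV_uncons n (x : 'rV[R]_n.+1) : measurableTypeR R * 'rV[R]_n :=
  (x ord0 ord0, \row_j x ord0 (lift ord0 j)).

Lemma rV_consK n : cancel (@rV_cons n) (@rV_uncons n).
Proof.
move=> [t x]; rewrite /rV_cons /rV_uncons mxE unlift_none; congr pair.
by apply/rowP => j; rewrite !mxE liftK.
Qed.

Lemma measurable_rV_cons n : measurable_fun [set: _] (@rV_cons n).
Proof.
apply/measurable_fun_rVP => i; rewrite /rV_cons.
under eq_fun do rewrite mxE.
case: unliftP => [j _|_]; last exact: measurable_fst.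
exact: (measurableT_comp (measurable_coord j) measurable_snd).
Qed.

Lemma measurable_rV_uncons n : measurable_fun [set: _] (@rV_uncons n).
Proof.
apply/measurable_fun_pairP; split; first exact: measurable_coord.
apply/measurable_fun_rVP => i /=.
rewrite (_ : (fun _ => _) = (fun x : 'rV[R]_n.+1 => x ord0 (lift ord0 i))).
  exact: measurable_coord.
by apply/funext => x; rewrite mxE.
Qed.

Section successor.
Variables (n : nat) (mu : {sigma_finite_measure set 'rV[R]_n -> \bar R}).

Definition lebesgue_rVS : set 'rV[R]_n.+1 -> \bar R :=
  pushforward (lebesgue_measure \x mu)%E (@rV_cons n).

Let measurable_preimage_cons A : measurable A -> measurable (@rV_cons n @^-1` A).
Proof.
by move=> mA; rewrite -[X in measurable X]setTI; exact: measurable_rV_cons.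
Qed.

Let lebesgue_rVS0 : lebesgue_rVS set0 = 0%E.
Proof. by rewrite /lebesgue_rVS /pushforward preimage_set0 measure0. Qed.

Let lebesgue_rVS_ge0 A : (0 <= lebesgue_rVS A)%E.
Proof. by rewrite /lebesgue_rVS /pushforward; exact: measure_ge0. Qed.

Let lebesgue_rVS_sigma_additive : semi_sigma_additive lebesgue_rVS.
Proof.
move=> F mF tF mUF; rewrite /lebesgue_rVS /pushforward preimage_bigcup.
apply: measure_semi_sigma_additive.
- by move=> i; exact: measurable_preimage_cons.
- apply/trivIsetP => /= i j _ _ ij; rewrite -preimage_setI.
  by move/trivIsetP : tF => /(_ _ _ _ _ ij) ->//; rewrite preimage_set0.
- by rewrite -preimage_bigcup; exact: measurable_preimage_cons.
Qed.

HB.instance Definition _ := isMeasure.Build _ _ _ lebesgue_rVS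
  lebesgue_rVS0 lebesgue_rVS_ge0 lebesgue_rVS_sigma_additive.

Let lebesgue_rVS_sigma_finite : sigma_finite setT lebesgue_rVS.
Proof.
have /sigma_finiteP[F [TF ndF Foo]] :=
  sigma_finiteT (@lebesgue_measure R : {sigma_finite_measure set _ -> \bar R}).
have /sigma_finiteP[G [TG ndG Goo]] := sigma_finiteT mu.
exists (fun i => @rV_uncons n @^-1` (F i `*` G i)).
  rewrite -preimage_bigcup -(preimage_setT (@rV_uncons n)) -setXTT TF TG.
  congr (_ @^-1` _); apply/seteqP; split=> -[t x] /=.
    move=> [[i _ Fit] [j _ Gjx]]; exists (maxn i j) => //; split.
      by move: t Fit; exact/subsetPset/ndF/leq_maxl.
    by move: x Gjx; exact/subsetPset/ndG/leq_maxr.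
  by move=> [i _ [Fit Gix]]; split; exists i.
move=> i; have [mF Fioo] := Foo i; have [mG Gioo] := Goo i; split.
  rewrite -[X in measurable X]setTI; apply: measurable_rV_uncons => //.
  exact: measurableX.
rewrite /lebesgue_rVS /pushforward -comp_preimage.
rewrite (_ : _ \o _ = id); last by apply/funext; exact: rV_consK.
by rewrite product_measure1E// lte_mul_pinfty// ge0_fin_numE.
Qed.

HB.instance Definition _ :=
  Measure_isSigmaFinite.Build _ _ _ lebesgue_rVS lebesgue_rVS_sigma_finite.

End successor.

Fixpoint lebesgue_rV n : {sigma_finite_measure set 'rV[R]_n -> \bar R} :=
  match n with
  | 0 => dirac (0 : 'rV[R]_0)
  | m.+1 => lebesgue_rVS (lebesgue_rV m)
  end.

End lebesgue_rV.

(* Determines lebesgue_rV n, hence identifies it as Lebesgue measure. *)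
Lemma lebesgue_rV_box (R : realType) n (A : 'I_n -> set (measurableTypeR R)) :
  (forall i, measurable (A i)) ->
  (lebesgue_rV R n [set x | forall i, A i (x ord0 i)] =
   \prod_(i < n) lebesgue_measure (A i))%E.
Proof.
elim: n A => [|n IHn] A mA.
  by rewrite big_ord0 /= diracE mem_set// => -[].
rewrite big_ord_recl -IHn; last by move=> i; exact: mA.
rewrite -product_measure1E; [|exact: mA|]; last first.
  exact: (@measurable_rV_box R n (fun i => A (lift ord0 i))).
rewrite /= /lebesgue_rVS /pushforward.
congr ((lebesgue_measure \x lebesgue_rV R n)%E _).
apply/seteqP; split=> -[t x] /=; rewrite /rV_cons/=.
  move=> Ax; split=> [|i]; first by have := Ax ord0; rewrite mxE unlift_none.
  by have := Ax (lift ord0 i); rewrite mxE liftK.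
by move=> [At Ax] i; rewrite mxE; case: unliftP => [j|] ->.
Qed.

Section cube.
Variables (R : realType) (d : nat).

Definition cube : set 'rV[R]_d := [set x | forall i, 0 <= x ord0 i <= 1].

Lemma measurable_cube : measurable cube.
Proof.
rewrite (_ : cube = [set x | forall i, `[0, 1]%classic (x ord0 i)]).
  exact: (@measurable_rV_box R d (fun=> `[0, 1]%classic)).
by apply/seteqP; split=> x /= Ax i; have := Ax i; rewrite /= in_itv.
Qed.

Lemma cube_compact : compact cube.
Proof.
rewrite (_ : cube = [set x | forall i, `[0, 1]%classic (x ord0 i)]).
  by apply: (@rV_compact R d (fun=> `[0, 1]%classic)) => _; exact: segment_compact.
by apply/seteqP; split=> x /= Ax i; have := Ax i; rewrite /= in_itv.
Qed.

Lemma cube0 : cube 0.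
Proof. by move=> i; rewrite mxE lexx ler01. Qed.

End cube.
Arguments cube : clear implicits.

(* C([0,1]^d) with the supremum distance. *)
Section Ccube.
Variables (R : realType) (d : nat).

Definition Ccube : Type := continuousType (cube R d) R.

HB.instance Definition _ := Choice.on Ccube.

Implicit Types f g h : Ccube.

Definition fun_of_Ccube f : cube R d -> R := (f : continuousType (cube R d) R).

Definition Ccube_dist f g : R :=
  sup (range (fun x => `|fun_of_Ccube f x - fun_of_Ccube g x|)).

Let Ccube_bounded f : exists M, forall x, `|fun_of_Ccube f x| <= M.
Proof.
have cf : {within cube R d, continuous ('valL_0 (fun_of_Ccube f))}.
  by apply/subspace_valL_continuousP'; exact: cts_fun.
have [M [_ bM]] := compact_bounded (continuous_compact cf (@cube_compact R d)).
exists (M + 1) => x; apply: (bM (M + 1)); first by rewrite ltrDl.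
exists (val x); first exact: set_valP.
have := @valLK _ _ (0 : R) _ (fun_of_Ccube f).
by move/(congr1 (fun u => u x)); rewrite /sigL.
Qed.

Let has_ubound_dist f g :
  has_ubound (range (fun x => `|fun_of_Ccube f x - fun_of_Ccube g x|)).
Proof.
have [M fM] := Ccube_bounded f; have [N gN] := Ccube_bounded g.
exists (M + N) => _ [x _ <-]; rewrite (le_trans (ler_normB _ _))//.
exact: lerD.
Qed.

Let le_dist f g x : `|fun_of_Ccube f x - fun_of_Ccube g x| <= Ccube_dist f g.
Proof. by apply: ub_le_sup; [exact: has_ubound_dist|exists x]. Qed.

Let dist_le f g M :
  (forall x, `|fun_of_Ccube f x - fun_of_Ccube g x| <= M) ->
  Ccube_dist f g <= M.
Proof.
move=> fgM; apply: ge_sup; last by move=> _ [x _ <-].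
pose x0 : cube R d := SigSub (mem_set (@cube0 R d)).
by eexists; exists x0.
Qed.

Let Ccube_distxx f : Ccube_dist f f = 0.
Proof.
pose x0 : cube R d := SigSub (mem_set (@cube0 R d)).
apply/eqP; rewrite eq_le dist_le => [|x]; last by rewrite subrr normr0.
by rewrite (le_trans _ (le_dist f f x0)).
Qed.

Let Ccube_dist_eq0 f g : Ccube_dist f g = 0 -> f = g.
Proof.
move=> fg0; apply/continuousEP => x; apply/eqP.
by rewrite -subr_eq0 -normr_le0 -fg0; exact: le_dist.
Qed.

Let Ccube_distC f g : Ccube_dist f g = Ccube_dist g f.
Proof. by congr sup; apply: eq_imagel => x _; rewrite distrC. Qed.

Let Ccube_dist_triangle g f h :
  Ccube_dist f h <= Ccube_dist f g + Ccube_dist g h.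
Proof.
apply: dist_le => x; rewrite (le_trans (ler_distD (fun_of_Ccube g x) _ _))//.
by rewrite lerD.
Qed.

HB.instance Definition _ := isMetric.Build R Ccube
  Ccube_distxx Ccube_dist_eq0 Ccube_distC Ccube_dist_triangle.

End Ccube.

(* L^oo([0,1]^d) with the distance of the L^oo-norm.  An element is a class of
   functions on R^d modulo equality almost everywhere in [0,1]^d. *)
Section Linfty_cube.
Variables (R : realType) (d : nat).

Definition lebesgue_cube : set 'rV[R]_d -> \bar R :=
  mrestr (lebesgue_rV R d) (@measurable_cube R d).

HB.instance Definition _ := Measure.on lebesgue_cube.

Definition Linfty_cube : Type := LspaceType lebesgue_cube (leey 1).

HB.instance Definition _ := gen_eqMixin Linfty_cube.
HB.instance Definition _ := gen_choiceMixin Linfty_cube.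

Implicit Types f g h : Linfty_cube.

Definition fun_of_Linfty f : 'rV[R]_d -> R :=
  (f : LspaceType lebesgue_cube (leey 1)).

Definition Linfty_dist f g : R :=
  fine (Lnorm lebesgue_cube +oo%E (EFin \o (fun_of_Linfty f \- fun_of_Linfty g)%R)).

Let measurable_Linfty f : measurable_fun [set: 'rV[R]_d] (fun_of_Linfty f).
Proof. exact: (measurable_funPT (repr (LebesgueSpace.sort f))). Qed.

Let Linfty_fin_norm f : (Lnorm lebesgue_cube +oo%E (EFin \o fun_of_Linfty f) < +oo)%E.
Proof. exact: Lebesgue_finite. Qed.

Let LnormB f g :
  (Lnorm lebesgue_cube +oo%E (EFin \o (fun_of_Linfty f \- fun_of_Linfty g)%R) <=
   Lnorm lebesgue_cube +oo%E (EFin \o fun_of_Linfty f) +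
   Lnorm lebesgue_cube +oo%E (EFin \o fun_of_Linfty g))%E.
Proof.
have -> : Lnorm lebesgue_cube +oo%E (EFin \o fun_of_Linfty g) =
    Lnorm lebesgue_cube +oo%E (EFin \o (\- fun_of_Linfty g)%R).
  by rewrite -[RHS]oppe_Lnorm; apply: eq_Lnorm => x /=; rewrite opprK.
apply: (@eminkowski _ _ _ lebesgue_cube (fun_of_Linfty f) (\- fun_of_Linfty g)%R).
- exact: measurable_Linfty.
- by apply: measurableT_comp => //; exact: measurable_Linfty.
- exact: leey.
Qed.

Let Linfty_distE f g : ((Linfty_dist f g)%:E =
  Lnorm lebesgue_cube +oo%E (EFin \o (fun_of_Linfty f \- fun_of_Linfty g)%R))%E.
Proof.
rewrite fineK// ge0_fin_numE ?Lnorm_ge0//.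
by rewrite (le_lt_trans (LnormB _ _))// lte_add_pinfty.
Qed.

Let Linfty_distxx f : Linfty_dist f f = 0.
Proof.
apply: EFin_inj; rewrite Linfty_distE (_ : _ \o _ = cst 0%E) ?Lnorm0//.
by apply/funext => x /=; rewrite subrr.
Qed.

Let Linfty_dist_eq0 f g : Linfty_dist f g = 0 -> f = g.
Proof.
move=> fgd; have := Linfty_distE f g; rewrite fgd => /esym fgN.
have fg0 := Lnorm_eq0_eq0 _ _ fgN.
have mfg : measurable_fun [set: 'rV[R]_d]
    (EFin \o (fun_of_Linfty f \- fun_of_Linfty g)).
  by apply/measurable_EFinP/measurable_funB; exact: measurable_Linfty.
have fg : fun_of_Linfty f = fun_of_Linfty g %[ae lebesgue_cube].
  move/(_ mfg (ltry _)) : fg0.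
  apply: filterS => x /= /(_ I) [] /eqP + _.
  by rewrite subr_eq0 => /eqP.
have {fg} : LebesgueSpace.sort f = LebesgueSpace.sort g.
  rewrite -[LHS]reprK -[RHS]reprK; exact/eqP/ae_eqP.
move: f g {fgd fgN fg0 mfg} => [f [[fP]]] [g [[gP]]] /= fg.
case: _ / fg gP => gP.
by congr LebesgueSpace.Pack; rewrite (Prop_irrelevance fP gP).
Qed.

Let Linfty_distC f g : Linfty_dist f g = Linfty_dist g f.
Proof.
rewrite /Linfty_dist -oppe_Lnorm; congr fine; apply: eq_Lnorm => x /=.
by rewrite opprB.
Qed.

Let Linfty_dist_triangle g f h :
  Linfty_dist f h <= Linfty_dist f g + Linfty_dist g h.
Proof.
rewrite -lee_fin EFinD !Linfty_distE.
have -> : Lnorm lebesgue_cube +oo%E (EFin \o (fun_of_Linfty f \- fun_of_Linfty h)) =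
    Lnorm lebesgue_cube +oo%E (EFin \o
      ((fun_of_Linfty f \- fun_of_Linfty g) \+
       (fun_of_Linfty g \- fun_of_Linfty h))).
  by apply: eq_Lnorm => x /=; rewrite addrA subrK.
apply: eminkowski.
- by apply: measurable_funB; exact: measurable_Linfty.
- by apply: measurable_funB; exact: measurable_Linfty.
- exact: leey.
Qed.

HB.instance Definition _ := isMetric.Build R Linfty_cube
  Linfty_distxx Linfty_dist_eq0 Linfty_distC Linfty_dist_triangle.

End Linfty_cube.

Section porosity.
Variables (R : realType) (X : metricType R).

Definition porous (P : set X) := forall x : X,
  exists e0 alpha : R, [/\ 0 < e0, 0 < alpha < 1 &
    forall e, 0 < e < e0 ->
      exists2 y : X, mdist y x <= e & ball y (alpha * e) `&` P = set0].

Definition sigma_porous (P : set X) :=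
  exists2 F : (set X)^nat, forall n, porous (F n) & P = \bigcup_n F n.

End porosity.

Section omega_mapping.
Variable R : realType.

(* The norm that matrices carry in the library is the maximum norm. *)
Definition enorm n (x : 'rV[R]_n) : R := Num.sqrt (\sum_i x ord0 i ^+ 2).

(* Only the values of w on ]0, a[ matter, and only those of f on A. *)
Definition omega_mapping (a : R) (w : R -> R) k l
    (A : set 'rV[R]_k) (f : 'rV[R]_k -> 'rV[R]_l) :=
  exists2 K : R, 0 < K & forall x y, A x -> A y -> 0 < enorm (y - x) < a ->
    enorm (f y - f x) <= K * w (enorm (y - x)).

Definition bi_omega_mapping (a : R) (w : R -> R) k l
    (A : set 'rV[R]_k) (f : 'rV[R]_k -> 'rV[R]_l) :=
  [/\ set_inj A f, omega_mapping a w A f &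
    exists2 g : 'rV[R]_l -> 'rV[R]_k,
      {in A, cancel f g} & omega_mapping a w (f @` A) g].

End omega_mapping.

Section pushforward_equation.
Variables (R : realType) (d : nat).
Local Open Scope ereal_scope.

(* The measure rho.Lebesgue on [0,1]^d, extended by zero to R^d, so that the
   values of f outside [0,1]^d play no role in its pushforward by f. *)
Definition density (rho : 'rV[R]_d -> R) (S : set 'rV[R]_d) : \bar R :=
  \int[lebesgue_rV R d]_(x in cube R d `&` S) (rho x)%:E.

Definition signed_pushforward (rho : 'rV[R]_d -> R) (f : 'rV[R]_d -> 'rV[R]_d)
    (S : set 'rV[R]_d) : \bar R :=
  pushforward (density (rho^\+)%R) f S - pushforward (density (rho^\-)%R) f S.

Definition pushforward_equation (rho : 'rV[R]_d -> R)
    (f : 'rV[R]_d -> 'rV[R]_d) :=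
  forall S, measurable S ->
    signed_pushforward rho f S = lebesgue_rV R d (S `&` f @` cube R d).

Definition bi_omega_solvable (a : R) (w : R -> R) (rho : 'rV[R]_d -> R) :=
  exists2 f : 'rV[R]_d -> 'rV[R]_d,
    bi_omega_mapping a w (cube R d) f & pushforward_equation rho f.

End pushforward_equation.

(* Main.v *)
Require Import Defs.
From HB Require Import structures.
From mathcomp Require Import all_boot all_order all_algebra all_fingroup.
From mathcomp Require Import all_classical all_reals all_analysis.
From mathcomp Require Import measurable_realfun ess_sup_inf.
From mathcomp Require Import zify ring lra.

Set Implicit Arguments.
Unset Strict Implicit.
Unset Printing Implicit Defensive.

Import Order.TTheory GRing.Theory Num.Theory.
Import numFieldNormedType.Exports.

(* A scheme of Burago-Kleiner and McMullen type.  If [f0] solves the equation for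
   [rho0], multiply [rho0] by [1 + tau * sigma (f0 x)], where [sigma] is a
   continuous multiscale checkerboard on a cube inside the image of [f0].  If [f]
   solves the equation for some [rho] close to this product, then [g = f \o f0^-1]
   has Jacobian [1 + tau * sigma] up to a small error.  The modulus of continuity
   bounds the stretching of [g] between the points of the lattices of all scales,
   so at one of finitely many scales the maximal stretching hardly grows when
   passing to the next scale.  There, on the cell where it is attained, [g] is
   almost a translation from one field of the checkerboard to the adjacent one;
   the images of the two fields have almost equal volume although their Jacobians
   are [1 + tau] and [1 - tau].  Volumes of nearby images are compared by
   Poincare-Miranda, which is derived from Kuhn's form of Sperner's lemma.  The
   [rho] solvable with constant [n] and bounded below by [1 / n] thus avoid a ball
   near every point, and the remaining solvable [rho] are nonnegative but not
   bounded away from [0], which is a porous condition. *)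

(** * Kuhn's cubical Sperner lemma *)

(** What decides about the exponent is a circular demand. The stretching of [g] down to the smallest
    scale [t] has to be bounded by [lam], and it is of order [(log (1/t))^(2 alpha)]: one factor
    comes from [f], one from the inverse of [f0]. Finding a slow scale takes a number of scales
    polynomial in [lam], with ratios polynomial in [lam], so [log (1/t)] is in turn bounded by a
    power of [lam]. The circle closes for large [lam] once [alpha] is a small fraction of the
    inverse of that power. No derivative of [g] is at hand. The Jacobian enters only through volumes
    of images, and closeness of maps is known only at distances not below the smallest scale; hence
    the topological comparison of images. The checkerboard must exclude every [f] at once, so it is
    built from [f0], [tau] and the constant of the modulus alone; this is why each porous set fixes
    the constant. The lower bound for the density turns an error that is small in the norm into one
    that is small relative to [rho0], which is what controls the ratio [rho / rho0], the Jacobian of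
    [g]. *)

Section sperner_count.
Variables (n : nat) (L : 'I_n.+1 -> nat).
Hypothesis L_le : forall k, L k <= n.

Definition covers_without (k : 'I_n.+1) :=
  [forall j : 'I_n, exists l, (l != k) && (L l == j)].

Definition rainbow_labels := [forall j : 'I_n.+1, exists k, L k == j].

Lemma covers_without_inj k : covers_without k ->
  {in predC1 k &, injective L} /\ forall l, l != k -> L l < n.
Proof.
move=> /forallP cov.
pose D := [set l : 'I_n.+1 | l != k].
have cD : #|D| = n.
  have -> : D = [set~ k] by apply/setP => l; rewrite !inE.
  by rewrite cardsC1 card_ord.
pose f (l : 'I_n.+1) : 'I_n.+1 := inord (L l).
pose W := [set w : 'I_n.+1 | w < n].
have cW : #|W| = n.
  have -> : W = [set~ ord_max].
    by apply/setP => l; rewrite !inE -val_eqE /=; have := ltn_ord l; lia.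
  by rewrite cardsC1 card_ord.
have sub : W \subset f @: D.
  apply/fintype.subsetP => w; rewrite inE => wn.
  have /existsP[l /andP[lk /eqP Ll]] := cov (Ordinal wn).
  apply/imsetP; exists l; first by rewrite inE.
  by apply: val_inj; rewrite /f Ll /= inordK // ltnW.
have cf : #|f @: D| <= n by apply: leq_trans (leq_imset_card _ _) _; rewrite cD.
have eqWf : W = f @: D by apply/eqP; rewrite eqEcard sub cW.
have inj : {in D &, injective f}.
  by apply/imset_injP; rewrite -eqWf cW cD.
have fE l : val (f l) = L l by rewrite /= inordK // ltnS L_le.
split=> [l l' lk l'k Lll'|l lk].
  by apply: inj; rewrite ?inE // /f Lll'.
have : f l \in W by rewrite eqWf; apply: imset_f; rewrite inE.
by rewrite inE fE.
Qed.

(** A rainbow simplex has a single facet of this kind, opposite the vertex labelled [n]. If the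
    simplex is not rainbow and [k0] can be left out, the label of [k0] is below [n] and is repeated
    at exactly one other vertex [l0], which is the only other vertex that can be left out. *)
Lemma odd_covers : odd #|[set k | covers_without k]| = rainbow_labels.
Proof.
case: (boolP rainbow_labels) => [/forallP rb|nrb].
  have /existsP[k1 /eqP k1n] := rb ord_max.
  suff -> : [set k | covers_without k] = [set k1] by rewrite cards1.
  apply/setP => k; rewrite !inE; apply/idP/eqP => [ck|->].
    have [_ H] := covers_without_inj ck.
    apply/eqP; rewrite eq_sym; apply/negPn/negP => /H; rewrite k1n /=; lia.
  apply/forallP => j; have /existsP[l /eqP Ll] := rb (widen_ord (leqnSn n) j).
  apply/existsP; exists l; rewrite Ll /= eqxx andbT.
  by apply/negP => /eqP E; move: Ll; rewrite E k1n /=; have := ltn_ord j; lia.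
case: (pickP covers_without) => [k0 ck0|none]; last first.
  rewrite (_ : [set k | _] = finset.set0) ?cards0 //.
  by apply/setP => k; rewrite !inE none.
have Lk0 : L k0 < n.
  rewrite ltn_neqAle L_le andbT; apply/negP => /eqP E; case/negP: nrb.
  apply/forallP => j; apply/existsP.
  case: (ltnP j n) => [jn|nj].
    by move/forallP: ck0 => /(_ (Ordinal jn))/existsP[l /andP[_ /= ?]]; exists l.
  by exists k0; rewrite E; have := ltn_ord j; lia.
have /existsP[l0 /andP[l0k0 /eqP Ll0]] := forallP ck0 (Ordinal Lk0).
suff -> : [set k | covers_without k] = [set k0; l0].
  by rewrite cards2 eq_sym l0k0.
apply/setP => k; rewrite !inE; apply/idP/idP => [ck|].
  have [inj _] := covers_without_inj ck.
  case: (eqVneq k k0) => //= kk0; case: (eqVneq k l0) => //= kl0.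
  have E : l0 = k0 by apply: inj => //; rewrite inE eq_sym ?kl0 ?kk0.
  by rewrite E eqxx in l0k0.
case/orP => /eqP -> //; apply/forallP => j.
have /existsP[l /andP[lk0 Ll]] := forallP ck0 j.
apply/existsP; case: (eqVneq l l0) => [E|ll0]; last by exists l; rewrite ll0.
by exists k0; move: Ll; rewrite E Ll0 => ->; rewrite eq_sym l0k0.
Qed.

End sperner_count.

Lemma even_involution (T : finType) (A : {set T}) (f : T -> T) :
  {in A, forall x, [/\ f x \in A, f (f x) = x & f x != x]} -> ~~ odd #|A|.
Proof.
have [c] := ubnP #|A|; elim: c A => // c IH A Ac H.
case: (set_0Vmem A) => [->|[x xA]]; first by rewrite cards0.
have [fxA ffx fxx] := H _ xA.
have sub : [set x; f x] \subset A.
  by apply/fintype.subsetP => y; rewrite !inE => /orP[]/eqP->.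
rewrite -(cardsID [set x; f x] A) (finset.setIidPr sub) cards2 eq_sym fxx oddD /=.
apply: IH.
  move: Ac; rewrite -(cardsID [set x; f x] A) (finset.setIidPr sub) cards2 eq_sym fxx; lia.
move=> y; rewrite !inE negb_or => /andP[/andP[yx yfx] yA].
have [fyA ffy fyy] := H _ yA.
split => //.
rewrite negb_or fyA andbT.
apply/andP; split; apply/negP => /eqP E; [case/negP: yfx|case/negP: yx].
  by rewrite -ffy E.
by rewrite -ffy E ffx.
Qed.

Section kuhn.
Variable m' : nat.
Local Notation m := m'.+1.
Implicit Types (b : nat -> (nat -> nat) -> bool).

(* [(x, s)] is the simplex with vertices [x = v_0, ..., v_d = x + (1, ..., 1)] whose
   vertex [v_k] has coordinates [x_i + (s i < k)].  Points are functions on [nat],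
   equal to [0] beyond the dimension, so that the boundary face [x_d = 0] of the
   cube of dimension [d + 1] is literally the cube of dimension [d]. *)
Definition simplex d := ({ffun 'I_d -> 'I_m} * {perm 'I_d})%type.

Definition vertex d (p : simplex d) (k i : nat) : nat :=
  if insub i : option 'I_d is Some j then p.1 j + (p.2 j < k) else 0.

(* [b i v] stands for "the [i]-th component is positive at [v]"; the label is the
   first [i] for which this fails, and [d] if there is none. *)
Definition label b d (v : nat -> nat) := find (fun i => ~~ b i v) (iota 0 d).

Lemma label_le b d v : label b d v <= d.
Proof. by rewrite -[X in _ <= X](size_iota 0 d) find_size. Qed.

Lemma label_lt b d v : label b d v < d -> ~~ b (label b d v) v.
Proof.
move=> H; have := @nth_find _ 0 (fun i => ~~ b i v) (iota 0 d).
by rewrite has_find size_iota => /(_ H); rewrite nth_iota.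
Qed.

Lemma label_before b d v i : i < label b d v -> b i v.
Proof.
move=> H; have := @before_find _ 0 (fun i => ~~ b i v) (iota 0 d) i H.
rewrite nth_iota; last by apply: leq_trans H (label_le _ _ _).
by move=> /negbFE.
Qed.

Lemma label_leq b d v i : i < d -> ~~ b i v -> label b d v <= i.
Proof. by move=> id bi; rewrite leqNgt; apply: contra bi => /label_before. Qed.

Lemma labelS b d v : ~~ b d v -> label b d.+1 v = label b d v.
Proof.
move=> bd; rewrite /label -addn1 iotaD find_cat add0n /= bd size_iota addn0.
case: ifP => // /negbT; rewrite has_find size_iota -leqNgt => H.
by apply/eqP; rewrite eqn_leq H (label_le b d v).
Qed.

Definition rainbow b d (p : simplex d) :=
  rainbow_labels (fun k : 'I_d.+1 => label b d (vertex p k)).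

Definition facet d := (simplex d * 'I_d.+1)%type.

Definition door b d (q : facet d) :=
  covers_without (fun k : 'I_d.+1 => label b d (vertex q.1 k)) q.2.

Lemma odd_doors b d :
  odd #|[set q : facet d | door b q]| = odd #|[set p : simplex d | rainbow b p]|.
Proof.
rewrite -sum1dep_card -(pair_big_dep xpredT (fun p k => door b (p, k)) (fun _ _ => 1)) /=.
rewrite -sum1dep_card [in RHS]big_mkcond /=.
elim/big_rec2: _ => // p u v _ uv; rewrite !oddD {}uv; congr (_ (+) _).
rewrite sum1dep_card.
rewrite (odd_covers (L := fun k : 'I_d.+1 => label b d (vertex p k))) //.
  by rewrite /rainbow; case: rainbow_labels.
by move=> k; exact: label_le.
Qed.

Lemma vertex_ord d (p : simplex d) k (j : 'I_d) :
  vertex p k j = p.1 j + (p.2 j < k).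
Proof. by rewrite /vertex valK. Qed.

Lemma vertex_ge d (p : simplex d) k i : d <= i -> vertex p k i = 0.
Proof. by move=> di; rewrite /vertex insubF // ltnNge di. Qed.

Lemma vertex_eq d (p q : simplex d) k l :
  (forall j, p.1 j + (p.2 j < k) = q.1 j + (q.2 j < l)) -> vertex p k = vertex q l.
Proof.
move=> H; apply/funext => i; case: (ltnP i d) => id; last by rewrite !vertex_ge.
by rewrite -[i]/(val (Ordinal id)) !vertex_ord H.
Qed.

Definition rot_up d : {perm 'I_d.+1} := perm (@ordS_inj d.+1).
Definition rot_down d : {perm 'I_d.+1} := perm (@ord_pred_inj d.+1).

(** The neighbour across the facet opposite [v_k]. A simplex is a lattice path whose step number
    [s i] increases coordinate [i]. Leaving out an inner vertex, two consecutive steps are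
    exchanged; leaving out [v_0], the first step becomes the last one; leaving out the last vertex,
    the last step becomes the first. On the facets in [on_boundary] the new base point would leave
    the grid, and [inord] or the truncated predecessor gives a wrong value. *)
Definition flip d (q : facet d.+1) : facet d.+1 :=
  let: ((x, s), k) := q in
  if k == ord0 then
    ([ffun i => if s i == ord0 then inord (x i).+1 else x i], (s * rot_down d)%g, ord_max)
  else if k == ord_max then
    ([ffun i => if s i == ord_max then inord (x i).-1 else x i], (s * rot_up d)%g, ord0)
  else (x, (s * tperm (inord k.-1) (inord k))%g, k).

Definition on_boundary d (q : facet d.+1) :=
  let: ((x, s), k) := q in
  [exists i, (s i == ord0) && (k == ord0) && (x i == m' :> nat)
          || (s i == ord_max) && (k == ord_max) && (x i == 0 :> nat)].

Lemma rot_downE d (c : 'I_d.+1) : rot_down d c = (if c == 0 :> nat then d else c.-1) :> nat.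
Proof.
rewrite permE /=; case: eqP => [->|/eqP c0]; first by rewrite add0n /= modn_small.
have := ltn_ord c; have -> : (c + d.+1).-1 = c.-1 + d.+1 by lia.
by rewrite modnDr => cd; rewrite modn_small //; lia.
Qed.

Lemma rot_upE d (c : 'I_d.+1) : rot_up d c = (if c == d :> nat then 0 else c.+1) :> nat.
Proof.
rewrite permE /=; case: eqP => [->|/eqP c0]; first by rewrite modnn.
by rewrite modn_small //; have := ltn_ord c; lia.
Qed.

Lemma rot_downK d : (rot_down d * rot_up d = 1)%g.
Proof. by apply/permP => c; rewrite permM !permE ord_predK. Qed.

Lemma rot_upK d : (rot_up d * rot_down d = 1)%g.
Proof. by apply/permP => c; rewrite permM !permE ordSK. Qed.

Lemma flip_vertex d (q : facet d.+1) : ~~ on_boundary q ->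
  let g k l := if k == ord0 then l.-1 else if k == ord_max then l.+1 else l in
  forall l : 'I_d.+2, l != q.2 -> vertex q.1 l = vertex (flip q).1 (g q.2 (l : nat)).
Proof.
case: q => -[x s] k /= /existsPn nb l lk; apply: vertex_eq => j /=.
have := nb j; have l2 := ltn_ord l; have s1 := ltn_ord (s j); have xm := ltn_ord (x j).
case: (eqVneq k ord0) lk => [->|k0] lk /=.
  rewrite andbT /= ffunE -val_eqE /= permM rot_downE => H.
  have l0 : 0 < l by rewrite lt0n.
  case: eqP H => [E|/eqP E] /= H; last by lia.
  by rewrite inordK; lia.
have k0' : k != 0 :> nat by [].
case: (eqVneq k ord_max) lk => [->|k1] lk /=.
  rewrite !andbF /= !andbT /= ffunE -val_eqE /= permM rot_upE => H.
  have l1 : l < d.+1.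
    by rewrite ltn_neqAle -ltnS ltn_ord andbT -[d.+1]/(val (@ord_max d.+1)) val_eqE.
  case: eqP H => [E|/eqP E] /= H; last by lia.
  by rewrite inordK; lia.
move=> _; rewrite permM.
have kd : k < d.+1.
  by rewrite ltn_neqAle -ltnS ltn_ord andbT -[d.+1]/(val (@ord_max d.+1)) val_eqE.
have lk' : l != k :> nat by [].
case: tpermP => [E|E|//].
  by move: (congr1 val E); rewrite /= !inordK; lia.
by move: (congr1 val E); rewrite /= !inordK; lia.
Qed.

Lemma flip_door b d (q : facet d.+1) : ~~ on_boundary q -> door b q -> door b (flip q).
Proof.
move=> nb /forallP dq; apply/forallP => j.
have /existsP[l /andP[lk /eqP <-]] := dq j; apply/existsP.
have E := flip_vertex nb lk; move: nb E lk.
case: q {dq} => -[x s] k /= _ E lk; have l2 := ltn_ord l.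
move: E; case: (eqVneq k ord0) lk => [->|k0] lk /= E.
  have l0 : 0 < l by rewrite lt0n.
  have e : (inord l.-1 : 'I_d.+2) = l.-1 :> nat by rewrite inordK; lia.
  by exists (inord l.-1); rewrite E -val_eqE /= e eqxx andbT neq_ltn prednK // -ltnS l2.
move: E; case: (eqVneq k ord_max) lk => [->|k1] lk /= E.
  have l1 : l < d.+1.
    by rewrite ltn_neqAle -ltnS ltn_ord andbT -[d.+1]/(val (@ord_max d.+1)) val_eqE.
  have e : (inord l.+1 : 'I_d.+2) = l.+1 :> nat by rewrite inordK; lia.
  by exists (inord l.+1); rewrite E -val_eqE /= e eqxx andbT.
by exists l; rewrite lk E /=.
Qed.

Lemma flip_boundary d (q : facet d.+1) : ~~ on_boundary q -> ~~ on_boundary (flip q).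
Proof.
case: q => -[x s] k /= /existsPn nb.
case: (eqVneq k ord0) => [k0|k0] /=; last case: (eqVneq k ord_max) => [k1|k1] /=.
- apply/existsPn => i; have := nb i; rewrite ffunE permM k0 /= -!val_eqE /= rot_downE.
  have := ltn_ord (s i); have := ltn_ord (x i).
  case: eqP => [E|/eqP E] /=; last by lia.
  by move=> *; rewrite inordK; lia.
- apply/existsPn => i; have := nb i; rewrite ffunE permM k1 /= -!val_eqE /= rot_upE.
  have := ltn_ord (s i); have := ltn_ord (x i).
  case: (eqVneq (s i : nat) d) => [E|E] /=; last by lia.
  by move=> *; rewrite inordK; lia.
- by apply/existsPn => i; rewrite (negbTE k0) (negbTE k1) !andbF.
Qed.

Lemma flipK d (q : facet d.+1) : ~~ on_boundary q -> flip (flip q) = q.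
Proof.
case: q => -[x s] k /= /existsPn nb.
case: (eqVneq k ord0) => [k0|k0] /=; last case: (eqVneq k ord_max) => [k1|k1] /=.
- rewrite eqxx -mulgA rot_downK mulg1 k0.
  congr (_, _, _); apply/ffunP => i; rewrite !ffunE permM -!val_eqE /= rot_downE.
  have := nb i; rewrite k0 /= -!val_eqE /=.
  have := ltn_ord (s i); have := ltn_ord (x i).
  case: (eqVneq (s i : nat) 0) => [E|E] /=; last by case: (eqVneq (s i).-1 d) => //; lia.
  move=> xm sd nbi; rewrite ?eqxx /=.
  have e : (inord (x i).+1 : 'I_m) = (x i).+1 :> nat by rewrite inordK; lia.
  by rewrite e /= inord_val.
- rewrite -mulgA rot_upK mulg1 k1.
  congr (_, _, _); apply/ffunP => i; rewrite !ffunE permM -!val_eqE /= rot_upE.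
  have := nb i; rewrite k1 /= -!val_eqE /=.
  have := ltn_ord (s i); have := ltn_ord (x i).
  case: (eqVneq (s i : nat) d) => [E|E] //=.
  move=> xm sd nbi; rewrite ?eqxx /=.
  have e : (inord (x i).-1 : 'I_m) = (x i).-1 :> nat by rewrite inordK; lia.
  by rewrite e prednK ?inord_val //; lia.
- by rewrite (negbTE k0) (negbTE k1) -mulgA tperm2 mulg1.
Qed.

Lemma flip_neq d (q : facet d.+1) : flip q != q.
Proof.
case: q => -[x s] k /=.
case: (eqVneq k ord0) => [->|k0] /=; last case: (eqVneq k ord_max) => [->|k1] /=.
- by apply/eqP => -[].
- by apply/eqP => -[].
- apply/eqP => /(congr1 (fun q : facet d.+1 => (s^-1 * q.1.2)%g (inord k.-1))) /=.
  rewrite mulgA mulVg mul1g tpermL perm1 => /(congr1 val) /=.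
  have kd : k < d.+1.
    by rewrite ltn_neqAle -ltnS ltn_ord andbT -[d.+1]/(val (@ord_max d.+1)) val_eqE.
  have k0' : k != 0 :> nat by [].
  by rewrite !inordK; lia.
Qed.

Section induction_step.
Variable b : nat -> (nat -> nat) -> bool.
Hypothesis b0 : forall i v, v i = 0 -> ~~ b i v.
Hypothesis bm : forall i v, v i = m -> b i v.

(** Doors off the boundary come in pairs: on them [flip] is an involution without fixed points. *)
Lemma odd_boundary_doors d :
  odd #|[set q : facet d.+1 | door b q]| =
  odd #|[set q : facet d.+1 | door b q && on_boundary q]|.
Proof.
rewrite -(cardsID [set q | on_boundary q]) oddD.
rewrite [X in _ (+) X](_ : _ = false) ?addbF; last first.
  apply/negbTE/(@even_involution _ _ (@flip d)) => q.
  rewrite !inE => /andP[nb dq]; rewrite flip_door // flip_boundary // flipK //.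
  by rewrite flip_neq.
by congr (odd #|pred_of_set _|); apply/setP => q; rewrite !inE.
Qed.

(** A simplex of the face [x_d = 0] is completed by a last step in the new direction and becomes the
    facet opposite the last vertex. *)
Definition lift_simplex d (p : simplex d) : facet d.+1 :=
  ([ffun i => if unlift ord_max i is Some j then p.1 j else ord0],
   lift_perm ord_max ord_max p.2, ord_max).

Lemma lift_simplex_inj d : injective (@lift_simplex d).
Proof.
move=> [x s] [x' s'] [/ffunP xx ss]; congr (_, _).
  by apply/ffunP => i; have := xx (lift ord_max i); rewrite !ffunE liftK.
apply/permP => i; apply: (@lift_inj _ ord_max).
by rewrite -!(lift_perm_lift ord_max) /= ss.
Qed.

Lemma lift_simplex_vertex d (p : simplex d) k : k <= d ->
  vertex (lift_simplex p).1 k = vertex p k.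
Proof.
move=> kd; apply/funext => i; case: (ltnP i d) => [id|].
  have iE : i = val (lift ord_max (Ordinal id)) by rewrite /= /bump; lia.
  have -> : vertex p k i = vertex p k (val (Ordinal id)) by [].
  have -> : vertex (lift_simplex p).1 k i =
      vertex (lift_simplex p).1 k (val (lift ord_max (Ordinal id))) by rewrite -iE.
  rewrite !vertex_ord /= ffunE liftK lift_perm_lift /= /bump.
  by have := ltn_ord (p.2 (Ordinal id)); lia.
rewrite leq_eqVlt => /orP[/eqP <-|di]; last by rewrite !vertex_ge // ltnW.
rewrite [RHS]vertex_ge //.
have -> : vertex (lift_simplex p).1 k d = vertex (lift_simplex p).1 k (val (@ord_max d)) by [].
rewrite vertex_ord /= ffunE unlift_none /=.
by rewrite lift_perm_id /= ltnNge kd.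
Qed.

(** On the face [x_i = m] the label [i] does not occur, but a door needs it. On the face [x_i = 0]
    no label exceeds [i], but a door in dimension [d + 1] needs the label [d]. So only [x_d = 0]
    remains, where doors are the rainbow simplices of one dimension less. *)
Lemma boundary_doorP d (q : facet d.+1) :
  reflect (exists2 p, rainbow b p & q = lift_simplex p) (door b q && on_boundary q).
Proof.
apply: (iffP andP) => [[dq]|[p rp ->]]; last first.
  split; last first.
    apply/existsP; exists ord_max; rewrite /= ffunE unlift_none lift_perm_id !eqxx /=.
    by rewrite orbT.
  apply/forallP => j; have /existsP[k /eqP kj] := forallP rp j.
  apply/existsP; exists (widen_ord (leqnSn _) k).
  have kd : k <= d by rewrite -ltnS ltn_ord.
  rewrite -val_eqE /= neq_ltn ltn_ord /= lift_simplex_vertex // labelS ?kj //.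
  by apply: b0; rewrite vertex_ge.
case: q dq => -[x s] k dq /existsP[i].
have dP (j : 'I_d.+1) : exists l : 'I_d.+2, l != k /\ label b d.+1 (vertex (x, s) l) = j.
  by have /existsP[l /andP[lk /eqP ?]] := forallP dq j; exists l.
case/orP => /andP[/andP[/eqP si /eqP kE] /eqP xi].
  have [l [lk lE]] := dP i; move: lk; rewrite kE => lk.
  have l0 : 0 < l by rewrite lt0n.
  have : label b d.+1 (vertex (x, s) l) < d.+1 by rewrite lE.
  move/label_lt; rewrite lE => /negP[]; apply: bm.
  by rewrite vertex_ord /= xi si l0; lia.
have lk0 l : l <= d -> vertex (x, s) l i = 0.
  by move=> ld; rewrite vertex_ord /= xi si ltnNge /= ld.
have lmax (l : 'I_d.+2) : l != k -> l <= d.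
  move=> lk; have : l < d.+1; last by [].
  rewrite kE in lk; rewrite ltn_neqAle -ltnS ltn_ord andbT.
  exact: lk.
have iE : i = ord_max.
  apply: val_inj => /=; apply/eqP; rewrite eqn_leq -ltnS ltn_ord /=.
  have [l [lk lE]] := dP ord_max.
  by rewrite -[X in X <= _]lE label_leq // b0 // lk0 // lmax.
have smax : s ord_max = ord_max by rewrite -{1}iE.
pose t (j : 'I_d) : 'I_d := odflt j (unlift ord_max (s (lift ord_max j))).
have tE j : lift ord_max (t j) = s (lift ord_max j).
  rewrite /t; case: unliftP => [? -> //|E].
  have /perm_inj/eqP := etrans E (esym smax).
  by rewrite eq_sym (negbTE (neq_lift _ _)).
have t_inj : injective t.
  by move=> j j' /(congr1 (lift ord_max)); rewrite !tE => /perm_inj/lift_inj.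
have sE : s = lift_perm ord_max ord_max (perm t_inj).
  apply/permP => j; case: (unliftP ord_max j) => [j' ->|->].
    by rewrite lift_perm_lift permE tE.
  by rewrite lift_perm_id smax.
have qE : ((x, s), k) = lift_simplex ([ffun j => x (lift ord_max j)], perm t_inj).
  rewrite /lift_simplex -sE kE; congr (_, _, _); apply/ffunP => j; rewrite ffunE.
  case: unliftP => [j' ->|->]; first by rewrite ffunE.
  by apply: val_inj; rewrite /= -iE xi.
exists ([ffun j => x (lift ord_max j)], perm t_inj) => //.
apply/forallP => j; have [l [lk lE]] := dP j.
have ld := lmax _ lk; apply/existsP; exists (inord l); rewrite inordK ?ltnS //.
have := lE; rewrite labelS; last by rewrite b0 //; have := lk0 _ ld; rewrite iE.
rewrite -[(x, s)]/((x, s), k).1 qE.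
by rewrite lift_simplex_vertex // => ->.
Qed.

Lemma odd_rainbows d : odd #|[set p : simplex d | rainbow b p]|.
Proof.
elim: d => [|d IHd].
  rewrite (_ : [set p | _] = finset.setT); last first.
    apply/setP => p; rewrite !inE; apply/forallP => j; apply/existsP; exists ord0.
    by rewrite fintype.ord1.
  by rewrite cardsT card_prod card_ffun !card_ord expn0 mul1n card_Sn.
rewrite -odd_doors odd_boundary_doors.
rewrite (_ : [set q | _] = (@lift_simplex d) @: [set p | rainbow b p]).
  by rewrite (card_imset _ (@lift_simplex_inj d)).
apply/setP => q; rewrite !inE.
apply/boundary_doorP/imsetP => -[p rp ->]; exists p => //; first by rewrite inE.
by rewrite inE in rp.
Qed.

(** In a rainbow simplex the vertex labelled [i] fails [b i], and the vertex labelled [d] satisfies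
    every [b i]. *)
Theorem kuhn_cube d : exists2 x : nat -> nat, (forall i, i < d -> x i < m) &
  forall i, i < d -> exists r r' : nat -> nat,
   [/\ forall j, j < d -> x j <= r j <= (x j).+1,
       forall j, j < d -> x j <= r' j <= (x j).+1, ~~ b i r & b i r'].
Proof.
case: (set_0Vmem [set p : simplex d | rainbow b p]) => [E|[p]].
  by have := odd_rainbows d; rewrite E cards0.
rewrite inE => /forallP rp; exists (vertex p 0) => [i id|i id].
  by rewrite -[i]/(val (Ordinal id)) vertex_ord ltn0 addn0.
have vP k j : j < d -> vertex p 0 j <= vertex p k j <= (vertex p 0 j).+1.
  move=> jd; rewrite -[j]/(val (Ordinal jd)) !vertex_ord ltn0; lia.
have /existsP[k /eqP kE] := rp (Ordinal (ltnW id : i < d.+1)).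
have /existsP[k' /eqP k'E] := rp (Ordinal (ltnSn d)).
exists (vertex p k), (vertex p k'); split => //; try by move=> j; apply: vP.
  have : label b d (vertex p k) < d by rewrite kE.
  by move/label_lt; rewrite kE.
by apply: (@label_before _ d); rewrite k'E.
Qed.

End induction_step.

End kuhn.

Local Open Scope classical_set_scope.
Local Open Scope ring_scope.

(** * Poincare-Miranda and stability of images *)

Section max_norm.
Variables (R : realType) (d : nat).
Implicit Types (x y : 'rV[R]_d) (e : R).

Lemma norm_coord x i : `|x ord0 i| <= `|x|.
Proof.
by rewrite [leRHS]/Num.Def.normr /= mx_normrE; apply/bigmax_geP; right => /=; exists (ord0, i).
Qed.

Lemma norm_leP x e : 0 <= e -> (forall i, `|x ord0 i| <= e) -> `|x| <= e.
Proof.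
move=> e0 H; rewrite [leLHS]/Num.Def.normr /= mx_normrE; apply/bigmax_leP; split => // -[i j] _ /=.
by rewrite (ord1 i).
Qed.

Lemma norm_ltP x e : 0 < e -> (forall i, `|x ord0 i| < e) -> `|x| < e.
Proof.
move=> e0 H; rewrite [ltLHS]/Num.Def.normr /= mx_normrE; apply/bigmax_ltP; split => // -[i j] _ /=.
by rewrite (ord1 i).
Qed.

End max_norm.

Definition box (R : realType) d (c : 'rV[R]_d) (b : R) : set 'rV[R]_d :=
  [set x | `|x - c| <= b].

Definition ucont (R : realType) (V W : normedModType R) (S : set V) (h : V -> W) :=
  forall e, 0 < e -> exists2 dl, 0 < dl &
    forall x y, S x -> S y -> `|x - y| < dl -> `|h x - h y| < e.

Section miranda.
Variables (R : realType) (d : nat) (c : 'rV[R]_d) (b : R).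
Hypothesis b_gt0 : 0 < b.

(** One cell of a fine grid has, for every component of [F], corners where it is nonpositive and
    corners where it is nonnegative; uniform continuity then bounds all components by [e]. *)
Lemma poincare_miranda (F : 'rV[R]_d -> 'rV[R]_d) : ucont (box c b) F ->
  (forall x i, box c b x -> x ord0 i = c ord0 i - b -> F x ord0 i < 0) ->
  (forall x i, box c b x -> x ord0 i = c ord0 i + b -> 0 < F x ord0 i) ->
  forall e, 0 < e -> exists2 x, box c b x & `|F x| <= e.
Proof.
move=> uF Fl Fr e e0; have [dl dl0 Fdl] := uF _ e0.
have [m' Hm] : exists m' : nat, 2 * b / m'.+1%:R < dl.
  exists (Num.truncn (dl^-1 * (2 * b))).
  rewrite ltr_pdivrMr ?ltr0n // -ltr_pdivrMl //; exact: truncnS_gt.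
pose m := m'.+1.
have m0 : (0 : R) < m%:R by rewrite ltr0n.
pose pt (v : nat -> nat) : 'rV[R]_d := \row_i (c ord0 i - b + 2 * b / m%:R * (v i)%:R).
(* The clauses on [v i] impose the boundary pattern of [kuhn_cube] on all functions [v]; on the two
   faces of the grid they agree with the sign of [F]. Beyond the dimension the default is [true]. *)
pose B i v := (v i == m) || (v i != 0%N) && (if insub i is Some j then 0 < F (pt v) ord0 j else true).
have B0 i v : v i = 0%N -> ~~ B i v by move=> v0; rewrite /B v0.
have Bm i v : v i = m -> B i v by move=> v0; rewrite /B v0 eqxx.
have [x xm xP] := kuhn_cube B0 Bm d.
have bptP v : (forall i, (i < d)%N -> (v i <= m)%N) -> box c b (pt v).
  move=> vm; apply: norm_leP; first exact: ltW.
  move=> i; rewrite !mxE; have := vm _ (ltn_ord i); rewrite -(ler_nat R) => vmi.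
  have : 0 <= (v i)%:R / m%:R :> R by rewrite divr_ge0.
  have : (v i)%:R / m%:R <= 1 :> R by rewrite ler_pdivrMr // mul1r.
  have -> : c ord0 i - b + 2 * b / m%:R * (v i)%:R - c ord0 i = b * (2 * ((v i)%:R / m%:R) - 1).
    by field; rewrite gt_eqF.
  move: (_ / _) => t t1 t0; rewrite normrM (gtr0_norm b_gt0).
  by apply: ler_piMr; [exact: ltW | rewrite ler_norml; lra].
have close v : (forall j, (j < d)%N -> (x j <= v j <= (x j).+1)%N) ->
    box c b (pt v) /\ `|pt v - pt x| < dl.
  move=> xv; split.
    by apply: bptP => i id; have := xv _ id; have := xm _ id; lia.
  apply: norm_ltP => // i; rewrite !mxE.
  have -> : c ord0 i - b + 2 * b / m%:R * (v i)%:R - (c ord0 i - b + 2 * b / m%:R * (x i)%:R)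
     = (2 * b / m%:R) * ((v i)%:R - (x i)%:R) by ring.
  have tb : 0 < 2 * b / m%:R by rewrite divr_gt0 // mulr_gt0.
  rewrite normrM gtr0_norm //; apply: le_lt_trans Hm; apply: ler_piMr; first exact: ltW.
  have /andP[] := xv _ (ltn_ord i); rewrite -!(ler_nat R) -[(x i).+1]addn1 natrD.
  by rewrite ler_norml; lra.
have [bx _] := close x (fun j _ => (introT andP (conj (leqnn _) (leqnSn _)))).
exists (pt x) => //; apply: norm_leP; first exact: ltW.
move=> i; have [r [r' [rP r'P Br Br']]] := xP i (ltn_ord i).
have [br rdl] := close _ rP; have [br' r'dl] := close _ r'P.
have Fr1 : F (pt r) ord0 i <= 0.
  move: Br; rewrite /B negb_or negb_and negbK valK => /andP[rm /orP[/eqP r0|]].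
    by apply/ltW/Fl => //; rewrite mxE r0 mulr0 addr0.
  by rewrite -leNgt.
have Fr2 : 0 <= F (pt r') ord0 i.
  move: Br'; rewrite /B valK => /orP[/eqP r0|/andP[_ /ltW //]].
  by apply/ltW/Fr => //; rewrite mxE r0; field; rewrite gt_eqF.
have := Fdl _ _ br bx rdl => /(le_lt_trans (norm_coord _ i)); rewrite !mxE ltr_norml.
have := Fdl _ _ br' bx r'dl => /(le_lt_trans (norm_coord _ i)); rewrite !mxE ltr_norml.
rewrite ler_norml; lra.
Qed.

End miranda.

(** * Boxes, translations and covers in Lebesgue measure *)

Section borel.
Variables (R : realType) (d : nat).

Lemma boxE (c : 'rV[R]_d) b : 0 <= b ->
  box c b = [set x | forall i, `[c ord0 i - b, c ord0 i + b]%classic (x ord0 i)].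
Proof.
move=> b0; apply/seteqP; split => x /= H.
  by move=> i; have := le_trans (norm_coord _ i) H; rewrite !mxE in_itv /= ler_distl.
by apply: norm_leP => // i; have := H i; rewrite !mxE in_itv /= ler_distl.
Qed.

Lemma measurable_box (c : 'rV[R]_d) b : measurable (box c b).
Proof.
case: (leP 0 b) => b0.
  by rewrite boxE //; exact: (@measurable_rV_box R d (fun i => `[c ord0 i - b, c ord0 i + b]%classic)).
rewrite (_ : box c b = set0) //; apply/seteqP; split => x //= H.
by have := lt_le_trans (le_lt_trans H b0) (normr_ge0 (x - c)); rewrite ltxx.
Qed.

Lemma lebesgue_box (c : 'rV[R]_d) b : 0 <= b ->
  lebesgue_rV R d (box c b) = ((2 * b) ^+ d)%:E.
Proof.
move=> b0; rewrite boxE // (@lebesgue_rV_box R d (fun i => `[c ord0 i - b, c ord0 i + b]%classic)) //.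
rewrite (eq_bigr (fun=> (2 * b)%:E)) => [|i _].
  by rewrite prodEFin prodr_const card_ord.
rewrite lebesgue_measure_itv /= lte_fin; case: ltP => [_|H].
  by rewrite -EFinD; congr EFin; ring.
by congr EFin; lra.
Qed.

Lemma compact_box (c : 'rV[R]_d) b : compact (box c b).
Proof.
case: (leP 0 b) => b0.
  rewrite boxE //.
  apply: (@rV_compact R d (fun i => `[c ord0 i - b, c ord0 i + b]%classic)) => i.
  exact: segment_compact.
rewrite (_ : box c b = set0); first exact: compact0.
apply/seteqP; split => x //= H.
by have := lt_le_trans (le_lt_trans H b0) (normr_ge0 (x - c)); rewrite ltxx.
Qed.

(** The sigma-algebra is generated by coordinates, so [U] is written as a countable union of boxes:
    those contained in [U] that have radius [1 / (n + 1)] and a centre with coordinates in the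
    multiples of [1 / (n + 1)]. *)
Lemma open_measurable_rV (U : set 'rV[R]_d) : open U -> measurable U.
Proof.
move=> oU.
pose pt (q : nat * 'rV[int]_d) : 'rV[R]_d := \row_i ((q.2 ord0 i)%:~R / q.1.+1%:R).
pose F q := if `[< box (pt q) (q.1.+1%:R^-1) `<=` U >] then box (pt q) (q.1.+1%:R^-1) else set0.
rewrite (_ : U = \bigcup_q F q).
  apply: countable_bigcupT_measurable; first exact: countableP.
  by move=> q; rewrite /F; case: ifP => _ //; exact: measurable_box.
apply/seteqP; split => [x Ux|x [q _]]; last first.
  by rewrite /F; case: asboolP => [+|//]; apply.
have /nbhs_ballP[e /= e0 eU] : nbhs x U by apply: open_nbhs_nbhs.
pose n := Num.truncn (2 / e).
have n0 : (0 : R) < n.+1%:R by rewrite ltr0n.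
have ne : 2 / n.+1%:R < e.
  by rewrite ltr_pdivrMr // -ltr_pdivrMl // mulrC; exact: truncnS_gt.
exists (n, \row_i Num.floor (x ord0 i * n.+1%:R)) => //.
have xb : `|x - pt (n, \row_i Num.floor (x ord0 i * n.+1%:R))| <= n.+1%:R^-1.
  apply: norm_leP; first by rewrite invr_ge0 ltW.
  move=> i; rewrite !mxE /=.
  have := floor_le_tmp (x ord0 i * n.+1%:R); have := floorD1_gt (x ord0 i * n.+1%:R).
  rewrite intrD; move: (_%:~R : R) => z H1 H2.
  have -> : x ord0 i - z / n.+1%:R = (x ord0 i * n.+1%:R - z) / n.+1%:R.
    by rewrite mulrBl mulfK // gt_eqF.
  have n0' : 0 <= n.+1%:R^-1 :> R by rewrite invr_ge0 ltW.
  rewrite normrM (ger0_norm n0'); apply: ler_piMl => //.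
  by rewrite ler_norml; lra.
rewrite /F; case: asboolP => [_|[]]; first exact: xb.
move=> y yb; apply: eU; rewrite -ball_normE /=.
have := ler_distD (pt (n, \row_i Num.floor (x ord0 i * n.+1%:R))) x y.
rewrite (distrC (pt _) y); move: yb xb; rewrite /box /=; move: ne; move: (n.+1%:R^-1) => k; lra.
Qed.

Lemma closed_measurable_rV (U : set 'rV[R]_d) : closed U -> measurable U.
Proof.
by move=> cU; rewrite -(setCK U); apply: measurableC; apply: open_measurable_rV; exact: closed_openC.
Qed.

Lemma compact_measurable_rV (U : set 'rV[R]_d) : compact U -> measurable U.
Proof.
by move=> cU; apply: closed_measurable_rV; apply: compact_closed => //; exact: norm_hausdorff.
Qed.

End borel.

Section translation.
Variable R : realType.

Lemma measurable_shift_rV d (t : 'rV[R]_d) : measurable_fun [set: 'rV[R]_d] (fun x => x + t).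
Proof.
apply/measurable_fun_rVP => i.
rewrite (_ : (fun _ => _) = (fun x : 'rV[R]_d => x ord0 i + t ord0 i)); last first.
  by apply/funext => x; rewrite mxE.
by apply: measurable_funD => //; exact: measurable_coord.
Qed.

Lemma lebesgue_shift (t : R) (A : set (measurableTypeR R)) : measurable A ->
  lebesgue_measure ((fun x => x + t) @^-1` A) = lebesgue_measure A.
Proof.
have mf : measurable_fun [set: measurableTypeR R] ((fun x => x + t) : measurableTypeR R -> measurableTypeR R).
  by apply: measurable_funD.
move=> mA; rewrite -[LHS]/(pushforward lebesgue_measure ((fun x => x + t) : measurableTypeR R -> measurableTypeR R) A).
apply/esym/lebesgue_measure_unique => //= _ [[a b]] _ <-.
rewrite /pushforward.
have -> : (fun x => x + t) @^-1` `]a, b] = `]a - t, b - t]%classic.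
  by apply/seteqP; split => x /=; rewrite !in_itv /=; lra.
rewrite !lebesgue_measure_itv /= !lte_fin ltrD2r; case: ifP => // _.
by rewrite -!EFinD; congr EFin; ring.
Qed.

(** Induction on the dimension: a shift acts separately on the first coordinate and on the others,
    and a product measure is determined by its values on rectangles. *)
Lemma lebesgue_rV_shift d (t : 'rV[R]_d) (A : set 'rV[R]_d) : measurable A ->
  lebesgue_rV R d ((fun x => x + t) @^-1` A) = lebesgue_rV R d A.
Proof.
elim: d t A => [|d IHd] t A mA.
  congr (lebesgue_rV R 0 _); apply/seteqP; split => x /=.
    by rewrite (_ : x + t = x) //; apply/rowP => -[].
  by rewrite (_ : x + t = x) //; apply/rowP => -[].
rewrite /= /lebesgue_rVS /pushforward.
pose t2 : 'rV[R]_d := \row_j t ord0 (lift ord0 j).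
pose s (p : measurableTypeR R * 'rV[R]_d) : measurableTypeR R * 'rV[R]_d :=
  (p.1 + t ord0 ord0, p.2 + t2).
have ms : measurable_fun setT s.
  apply/measurable_fun_pairP; split.
    exact: (measurable_funD (@measurable_fst _ _ (measurableTypeR R) _) (measurable_cst _)).
  exact: (measurableT_comp (measurable_shift_rV t2) measurable_snd).
have mcA : measurable (@rV_cons R d @^-1` A).
  by rewrite -[X in measurable X]setTI; exact: measurable_rV_cons.
have -> : @rV_cons R d @^-1` ((fun x => x + t) @^-1` A) = s @^-1` (@rV_cons R d @^-1` A).
  apply/seteqP; split => -[u x] /=.
    rewrite (_ : rV_cons _ + t = rV_cons (s (u, x))) //.
    by apply/rowP => j; rewrite !mxE /=; case: unliftP => [k ->|->]; rewrite ?mxE.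
  rewrite (_ : rV_cons _ + t = rV_cons (s (u, x))) //.
  by apply/rowP => j; rewrite !mxE /=; case: unliftP => [k ->|->]; rewrite ?mxE.
rewrite -[LHS]/(pushforward (lebesgue_measure \x lebesgue_rV R d)%E s _).
apply/esym/product_measure_unique => // B C mB mC.
rewrite /= /pushforward.
rewrite (_ : s @^-1` (B `*` C) =
  ((fun x => x + t ord0 ord0) @^-1` B) `*` ((fun x => x + t2) @^-1` C)) //.
have mD : measurable_fun [set: measurableTypeR R]
    ((fun x => x + t ord0 ord0) : measurableTypeR R -> measurableTypeR R).
  by apply: measurable_funD.
have mB' := mD measurableT _ mB; rewrite setTI in mB'.
have mC' := @measurable_shift_rV _ t2 measurableT _ mC; rewrite setTI in mC'.
rewrite product_measure1E // IHd //; congr (_ * _)%E; exact: lebesgue_shift.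
Qed.

End translation.

Section cover.
Variable R : realType.

Lemma lebesgue_cover d (P : seq 'rV[R]_d) rho (A : set 'rV[R]_d) : 0 <= rho -> measurable A ->
  (forall x, A x -> exists2 y, y \in P & `|x - y| <= rho) ->
  (lebesgue_rV R d A <= ((size P)%:R * (2 * rho) ^+ d)%:E)%E.
Proof.
move=> r0 mA AP.
pose B i := box (nth 0 P i) rho.
have mP i : measurable (B i) by exact: measurable_box.
have : (lebesgue_rV R d A <= lebesgue_rV R d (\big[setU/set0]_(i < size P) B i))%E.
  apply: le_measure; rewrite ?inE //; first by apply: bigsetU_measurable.
  move=> x /AP[y yP xy]; rewrite -bigcup_mkord.
  have iP : (index y P < size P)%N by rewrite index_mem.
  by exists (index y P) => //=; rewrite /B /box /= nth_index.
move/le_trans; apply; apply: le_trans (Boole_inequality _ _) _ => //.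
rewrite (eq_bigr (fun=> ((2 * rho) ^+ d)%:E)) => [|i _]; last by rewrite [LHS]lebesgue_box.
by rewrite sumEFin sumr_const card_ord lee_fin -(mulr_natl (_ ^+ _)).
Qed.

Lemma subdivide (L u : R) (q : nat) : (0 < q)%N -> 0 < L -> 0 <= u <= L ->
  exists2 n, (n < q)%N & n%:R * (L / q%:R) <= u <= n.+1%:R * (L / q%:R).
Proof.
move=> q0 L0 /andP[u0 uL].
have q0' : (0 : R) < q%:R by rewrite ltr0n.
case: (ltP u L) => [uL'|Lu]; last first.
  have -> : u = L by lra.
  exists q.-1; first by rewrite ltn_predL.
  rewrite prednK // [q%:R * _]mulrC divfK ?gt_eqF // lexx andbT.
  rewrite mulrCA; apply: ler_piMr; first exact: ltW.
  by rewrite ler_pdivrMr // mul1r ler_nat leq_pred.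
have Lq : 0 < L / q%:R by rewrite divr_gt0.
exists (Num.truncn (u / (L / q%:R))).
  have := truncn_le (u / (L / q%:R)); rewrite divr_ge0 ?(ltW Lq) // => H.
  rewrite -(ltr_nat R); apply: le_lt_trans H _.
  by rewrite ltr_pdivrMr // mulrC divfK // gt_eqF.
rewrite -ler_pdivlMr // truncn_le divr_ge0 ?(ltW Lq) //=.
by rewrite -ler_pdivrMr // ltW // truncnS_gt.
Qed.

(** Each face needs [q ^ d] points, one power of [q] less than a solid box. Boxes of radius of order
    [1 / q] around the images of these points thus have total volume of order [1 / q]. *)
Lemma boundary_cover d (c : 'rV[R]_d.+1) b q : 0 < b -> (0 < q)%N ->
  exists2 P : seq 'rV[R]_d.+1, size P = (d.+1 * 2 * q ^ d)%N &
  (forall y, y \in P -> `|y - c| = b) /\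
  forall x, `|x - c| = b -> exists2 y, y \in P & `|x - y| <= 2 * b / q%:R.
Proof.
move=> b0 q0.
pose I := ('I_d.+1 * bool * {ffun 'I_d -> 'I_q})%type.
pose pt (k : I) : 'rV[R]_d.+1 := \row_j
  if unlift k.1.1 j is Some j' then c ord0 j - b + (k.2 j')%:R * (2 * b / q%:R)
  else c ord0 j + (-1) ^+ k.1.2 * b.
have q0' : (0 : R) < q%:R by rewrite ltr0n.
exists [seq pt k | k <- enum {: I}].
  by rewrite size_map -cardE !card_prod card_ffun card_bool !card_ord.
split=> [y /mapP[[[i s] n] _ ->]|x xb].
  apply/eqP; rewrite eq_le; apply/andP; split.
    apply: norm_leP; first exact: ltW.
    move=> j; rewrite !mxE; case: unliftP => [j' _|_] /=.
      have : 0 <= (n j')%:R / q%:R :> R by rewrite divr_ge0.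
      have : (n j')%:R / q%:R <= 1 :> R.
        by rewrite ler_pdivrMr // mul1r ler_nat ltnW.
      have -> : c ord0 j - b + (n j')%:R * (2 * b / q%:R) - c ord0 j =
         b * (2 * ((n j')%:R / q%:R) - 1) by field; rewrite gt_eqF.
      move: (_ / _) => t t1 t0; rewrite normrM (gtr0_norm b0).
      by apply: ler_piMr; [exact: ltW | rewrite ler_norml; lra].
    by rewrite addrAC subrr add0r normrM normr_sign mul1r gtr0_norm.
  apply: le_trans (norm_coord _ i); rewrite !mxE /= unlift_none.
  by rewrite addrAC subrr add0r normrM normr_sign mul1r gtr0_norm.
have [i xi] : exists i, `|x ord0 i - c ord0 i| = b.
  apply: contrapT => /forallNP H; have : `|x - c| < b.
    apply: norm_ltP => // i; rewrite lt_neqAle; apply/andP; split.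
      by rewrite !mxE; apply/eqP; exact: H.
    by rewrite -[leRHS]xb; exact: norm_coord.
  by rewrite xb ltxx.
have xj j : 0 <= x ord0 j - c ord0 j + b <= 2 * b.
  by have := norm_coord (x - c) j; rewrite xb !mxE ler_norml; lra.
have /choice[n nP] : forall j : 'I_d, exists k : 'I_q,
    k%:R * (2 * b / q%:R) <= x ord0 (lift i j) - c ord0 (lift i j) + b <= k.+1%:R * (2 * b / q%:R).
  move=> j; have [|k kq H] := subdivide q0 _ (xj (lift i j)); first by rewrite mulr_gt0.
  by exists (Ordinal kq).
exists (pt (i, x ord0 i < c ord0 i, finfun n)).
  by apply/mapP; exists (i, x ord0 i < c ord0 i, finfun n) => //; rewrite mem_enum.
apply: norm_leP; first by rewrite divr_ge0 ?mulr_ge0 // ltW.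
move=> j; rewrite !mxE /=; case: unliftP => [j' ->|->].
  rewrite ffunE; have := nP j'; rewrite -[(n j').+1]addn1 natrD => H.
  by rewrite ler_norml; lra.
have e0 : 0 <= 2 * b / q%:R by rewrite divr_ge0 ?mulr_ge0 // ltW.
by move: xi; case: ltP => H; rewrite /= ?expr0 ?expr1 => xi;
  rewrite ler_norml; move: xi; [rewrite ltr0_norm | rewrite ger0_norm]; lra.
Qed.

End cover.

Section sphere_avoid.
Variables (R : realType) (d : nat).

(** The image of the sphere is covered by boxes of radius [rho] around the images of a fine net.
    Even with radius [2 * rho] these boxes have less volume than the box of radius [eta] around
    [v0], so some [v] in it is missed by a margin [rho]. *)
Lemma sphere_image_avoid (G : 'rV[R]_d.+1 -> 'rV[R]_d.+1) Lam p r :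
  0 < Lam -> 0 < r -> (forall x y, `|G x - G y| <= Lam * `|x - y|) ->
  forall v0 eta, 0 < eta -> exists2 v, `|v - v0| <= eta &
    exists2 k, 0 < k & forall z, `|z - p| = r -> k <= `|G z - v|.
Proof.
move=> L0 r0 GL v0 eta eta0.
(* [C / q] is the total volume of the boxes of radius [2 * rho], whose side is [8 * Lam * r / q]. *)
pose C : R := (d.+1 * 2)%:R * (8 * Lam * r) ^+ d.+1.
have C0 : 0 < C.
  by rewrite mulr_gt0 ?ltr0n ?muln_gt0 // exprn_gt0 // !mulr_gt0.
pose q := (Num.truncn (C / (2 * eta) ^+ d.+1)).+1.
have q0 : (0 < q)%N by [].
have qR : (0 : R) < q%:R by rewrite ltr0n.
have e0 : 0 < (2 * eta) ^+ d.+1 by rewrite exprn_gt0 // mulr_gt0.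
have qC : C / q%:R < (2 * eta) ^+ d.+1.
  rewrite ltr_pdivrMr // mulrC -ltr_pdivrMr //; exact: truncnS_gt.
have [P Ps [Pb Pc]] := boundary_cover p r0 q0.
pose rho := Lam * (2 * r / q%:R).
have rho0 : 0 < rho by rewrite mulr_gt0 // divr_gt0 // mulr_gt0.
have [v [vb vP]] : exists v, `|v - v0| <= eta /\ forall y, y \in P -> 2 * rho < `|v - G y|.
  apply: contrapT => /forallNP H.
  have : (lebesgue_rV R d.+1 (box v0 eta) <= ((size [seq G y | y <- P])%:R * (2 * (2 * rho)) ^+ d.+1)%:E)%E.
    apply: lebesgue_cover; [by rewrite mulr_ge0 // ltW | exact: measurable_box|].
    move=> v vb; have := H v; move/not_andP => [//|/existsNP[y /not_implyP[yP /negP]]].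
    by rewrite -leNgt => vy; exists (G y) => //; apply: map_f.
  rewrite (lebesgue_box _ (ltW eta0)) lee_fin size_map Ps leNgt.
  have -> : (d.+1 * 2 * q ^ d)%:R * (2 * (2 * rho)) ^+ d.+1 = C / q%:R :> R.
    rewrite /C /rho natrM natrX.
    have -> : 2 * (2 * (Lam * (2 * r / q%:R))) = (8 * Lam * r) / q%:R by ring.
    rewrite expr_div_n [q%:R ^+ d.+1]exprSr; move: (_ ^+ d.+1) => W.
    move: (_ * 2)%:R => D; move: qR; move: (q%:R : R) => Q Q0.
    by field; rewrite gt_eqF //= expf_neq0 // gt_eqF.
  by rewrite qC.
exists v => //; exists rho => // z zr; have [y yP zy] := Pc _ zr.
have := vP _ yP; have := ler_distD (G z) v (G y); have := GL z y.
rewrite (distrC v (G z)).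
have : Lam * `|z - y| <= rho by rewrite /rho ler_pM2l.
lra.
Qed.

End sphere_avoid.

Section robust_image.
Variables (R : realType) (d : nat).
Variables (c : 'rV[R]_d.+1) (b : R) (h1 h2 : 'rV[R]_d.+1 -> 'rV[R]_d.+1).
Let S := box c b.
Hypothesis b_gt0 : 0 < b.
Hypothesis u1 : ucont S h1.
Hypothesis u2 : ucont S h2.
Hypothesis inj1 : forall e, 0 < e -> exists2 k, 0 < k &
  forall x y, S x -> S y -> `|h1 x - h1 y| < k -> `|x - y| < e.

(* McShane: [G z i] is the infimum over [x] of [x_i + Lam * |z - h1 x|].  Being
   Lipschitz, [G] maps spheres to null sets, which a mere continuous extension of
   the inverse of [h1] need not do. *)
Lemma approx_inverse e : 0 < e -> exists G : 'rV[R]_d.+1 -> 'rV[R]_d.+1,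
  exists2 Lam, 0 < Lam & (forall x y, `|G x - G y| <= Lam * `|x - y|) /\
  forall x, S x -> forall i, x ord0 i - e <= G (h1 x) ord0 i <= x ord0 i.
Proof.
move=> e0; have [k k0 hk] := inj1 e0.
(* [Lam * k] is the width of the box, so a point [y] with [h1 y] at distance at least [k] from
   [h1 x] cannot bring the infimum below [x_i]. *)
pose Lam := 2 * b / k.
have L0 : 0 < Lam by rewrite divr_gt0 // mulr_gt0.
pose V z i := [set x ord0 i + Lam * `|z - h1 x| | x in S].
have Sc : S c by rewrite /S /box /= subrr normr0 ltW.
have Sx x i : S x -> c ord0 i - b <= x ord0 i <= c ord0 i + b.
  by move=> sx; have := le_trans (norm_coord _ i) sx; rewrite !mxE ler_norml; lra.
have lbV z i : lbound (V z i) (c ord0 i - b).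
  move=> _ [x sx <-]; have := Sx _ i sx.
  have : 0 <= Lam * `|z - h1 x| by rewrite mulr_ge0 // ltW.
  lra.
have hV z i : has_lbound (V z i) by exists (c ord0 i - b).
have nV z i : V z i !=set0 by exists (c ord0 i + Lam * `|z - h1 c|), c.
pose G z : 'rV[R]_d.+1 := \row_i inf (V z i).
have GL z z' i : inf (V z i) <= inf (V z' i) + Lam * `|z - z'|.
  rewrite -lerBlDr; apply: lb_le_inf => // _ [x sx <-].
  rewrite lerBlDr; apply: le_trans (_ : x ord0 i + Lam * `|z - h1 x| <= _).
    by apply: ge_inf => //; exists x.
  rewrite -addrA lerD2l -mulrDr ler_pM2l // [leRHS]addrC; exact: ler_distD.
exists G, Lam => //; split.
  move=> x y; apply: norm_leP; first by rewrite mulr_ge0 // ltW.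
  move=> i; rewrite !mxE; have := GL x y i; have := GL y x i.
  rewrite (distrC y x) ler_norml; lra.
move=> x sx i; rewrite mxE; apply/andP; split; last first.
  by apply: ge_inf => //; exists x => //; rewrite subrr normr0 mulr0 addr0.
apply: lb_le_inf => // _ [y sy <-].
case: (ltP `|h1 x - h1 y| k) => H.
  have := le_lt_trans (norm_coord _ i) (hk _ _ sx sy H); rewrite !mxE ltr_norml.
  have : 0 <= Lam * `|h1 x - h1 y| by rewrite mulr_ge0 // ltW.
  lra.
have : Lam * k <= Lam * `|h1 x - h1 y| by rewrite ler_pM2l.
have := Sx _ i sx; have := Sx _ i sy; rewrite [Lam * k]divfK ?gt_eqF //; lra.
Qed.

Variables (x0 : 'rV[R]_d.+1) (dl : R).
Hypothesis Sx0 : S x0.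
Hypothesis dl_gt0 : 0 < dl.
Let p := h1 x0.
Hypothesis close12 : forall x, S x -> `|h1 x - h2 x| <= dl.
Hypothesis far_boundary : forall x, `|x - c| = b -> 4 * dl <= `|h1 x - p|.

Let cut (s : R) := Num.max 0 (Num.min 1 (3 - s / dl)).

Let cut_lip s t : `|cut s - cut t| <= `|s - t| / dl.
Proof.
rewrite -[dl in leRHS]gtr0_norm // -normrV ?unitfE ?gt_eqF // -normrM mulrBl.
rewrite /cut; move: (s / dl) (t / dl) => a a'.
by rewrite /Num.max /Num.min !ler_norml; do ! case: ifP; case: (ltrP 0 (a - a')) => H *;
  rewrite ?(gtr0_norm H) ?(ler0_norm H); lra.
Qed.

Let cut_bound s : 0 <= cut s <= 1.
Proof. by rewrite /cut /Num.max /Num.min; do ! case: ifP; lra. Qed.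

Let cut1 s : s <= 2 * dl -> cut s = 1.
Proof.
move=> H; have : s / dl <= 2 by rewrite ler_pdivrMr.
by rewrite /cut /Num.max /Num.min; do ! case: ifP; lra.
Qed.

Let cut0 s : 3 * dl <= s -> cut s = 0.
Proof.
move=> H; have : 3 <= s / dl by rewrite ler_pdivlMr.
by rewrite /cut /Num.max /Num.min; do ! case: ifP; lra.
Qed.

(** Equal to [h2] where [h1] is within [2 * dl] of [p], and to [h1] where it is at least [3 * dl]
    away, in particular on the boundary of the box. *)
Let mid x := h1 x + cut `|h1 x - p| *: (h2 x - h1 x).

Let mid_h1 x : 3 * dl <= `|h1 x - p| -> mid x = h1 x.
Proof. by move=> H; rewrite /mid cut0 // scale0r addr0. Qed.

Let mid_close x : S x -> `|mid x - h1 x| <= dl.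
Proof.
move=> sx; rewrite /mid addrAC subrr add0r normrZ.
have /andP[? ?] := cut_bound `|h1 x - p|; rewrite ger0_norm //.
have := close12 sx; rewrite distrC => H; apply: le_trans H.
by apply: ler_piMl.
Qed.

Let ucont_mid : ucont S mid.
Proof.
move=> e e0; have e4 : 0 < e / 4 by rewrite divr_gt0.
have [a1 a10 H1] := u1 e4; have [a2 a20 H2] := u2 e4.
exists (Num.min a1 a2); first by rewrite lt_min a10.
move=> x y sx sy; rewrite lt_min => /andP[xy1 xy2].
have {xy1} := H1 _ _ sx sy xy1; have {xy2} := H2 _ _ sx sy xy2.
set A := `|h2 x - h2 y|; set B := `|h1 x - h1 y| => Ae Be.
have cl := cut_lip `|h1 x - p| `|h1 y - p|.
have cb := cut_bound `|h1 x - p|.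
rewrite /mid; move: cl cb; set lx := cut _; set ly := cut _ => cl cb.
have -> : h1 x + lx *: (h2 x - h1 x) - (h1 y + ly *: (h2 y - h1 y)) =
  (h1 x - h1 y) + (lx *: ((h2 x - h2 y) - (h1 x - h1 y)) + (lx - ly) *: (h2 y - h1 y)).
  by apply/rowP => i; rewrite !mxE; ring.
have t1 : `|lx *: ((h2 x - h2 y) - (h1 x - h1 y))| <= A + B.
  rewrite normrZ; have /andP[l0 l1] := cb; rewrite ger0_norm //.
  apply: le_trans (ler_piMl _ l1) _ => //; exact: ler_normB.
have t2 : `|(lx - ly) *: (h2 y - h1 y)| <= B.
  rewrite normrZ; have := close12 sy; rewrite distrC => h12.
  apply: le_trans (ler_pM _ _ cl h12) _ => //.
  rewrite divfK ?gt_eqF //; apply: le_trans (ler_dist_dist _ _) _.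
  by rewrite opprB addrA subrK.
apply: le_lt_trans (ler_normD _ _) _; rewrite -/B.
have := ler_normD (lx *: ((h2 x - h2 y) - (h1 x - h1 y))) ((lx - ly) *: (h2 y - h1 y)).
lra.
Qed.

(** Radial projection of the punctured ball of radius [4 * dl] around [p] to its sphere, continued
    by the identity. *)
Let push (z : 'rV[R]_d.+1) := p + Num.max 1 (4 * dl / `|z - p|) *: (z - p).

Let push_id z : 4 * dl <= `|z - p| -> push z = z.
Proof.
move=> H; rewrite /push max_l; first by rewrite scale1r addrC subrK.
rewrite ler_pdivrMr ?mul1r //; apply: lt_le_trans H; by rewrite mulr_gt0.
Qed.

Let push_sphere z : 0 < `|z - p| -> `|z - p| <= 4 * dl -> `|push z - p| = 4 * dl.
Proof.
move=> z0 H; rewrite /push addrAC subrr add0r max_r ?ler_pdivlMr ?mul1r //.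
by rewrite normrZ normrM normfV !gtr0_norm ?mulr_gt0 // divfK // gt_eqF.
Qed.

Let push_lip m z z' : 0 < m -> m <= `|z - p| -> m <= `|z' - p| ->
  `|push z - push z'| <= (1 + 2 * (4 * dl / m)) * `|z - z'|.
Proof.
move=> m0; wlog zz' : z z' / `|z' - p| <= `|z - p|.
  move=> H mz mz'; case: (leP `|z' - p| `|z - p|) => zz'; first exact: H.
  by rewrite distrC (distrC z); apply: H => //; exact: ltW.
move=> mz mz'; rewrite /push.
have C0 : 0 < 4 * dl by rewrite mulr_gt0.
have a0 := lt_le_trans m0 mz; have a'0 := lt_le_trans m0 mz'.
set a := `|z - p| in zz' mz a0 *; set a' := `|z' - p| in zz' mz' a'0 *.
set C := 4 * dl in C0 *.
set M := Num.max 1 (C / a); set M' := Num.max 1 (C / a').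
have CmE : C / a <= C / m by rewrite ler_pM2l // lef_pV2 ?posrE.
have Cm0 : 0 < C / m by rewrite divr_gt0.
have M0 : 0 <= M <= 1 + C / m.
  by rewrite /M /Num.max; case: ifP; lra.
have MM : 0 <= M' - M.
  have : C / a <= C / a' by rewrite ler_pM2l // lef_pV2 ?posrE.
  by rewrite /M /M' /Num.max; do ! case: ifP; lra.
have aM : a' * (M' - M) <= C / m * (a - a').
  case: (ltP a' C) => H.
    have -> : M' = C / a' by rewrite /M' max_r // ler_pdivlMr // mul1r ltW.
    have MC : C / a <= M by rewrite /M le_max lexx orbT.
    apply: le_trans (_ : a' * (C / a' - C / a) <= _).
      by rewrite ler_pM2l // lerD2l lerN2.
    have -> : a' * (C / a' - C / a) = C / a * (a - a') by field; rewrite !gt_eqF.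
    by apply: ler_wpM2r => //; lra.
  have -> : M' = 1 by rewrite /M' max_l // ler_pdivrMr // mul1r.
  have : 1 <= M by rewrite /M le_max lexx.
  have : 0 <= C / m * (a - a') by rewrite mulr_ge0 ?subr_ge0 // ltW.
  move=> h1' h2'; apply: le_trans h1'; rewrite pmulr_rle0 //; lra.
have -> : p + M *: (z - p) - (p + M' *: (z' - p)) = M *: (z - z') + (M - M') *: (z' - p).
  by apply/rowP => i; rewrite !mxE; ring.
have aa : a - a' <= `|z - z'|.
  apply: le_trans (ler_norm _) _; apply: le_trans (ler_dist_dist _ _) _.
  by rewrite opprB addrA subrK.
apply: le_trans (ler_normD _ _) _; rewrite !normrZ -/a' (distrC M M') (ger0_norm MM).
have /andP[M0' M1] := M0; rewrite (ger0_norm M0').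
have : M * `|z - z'| <= (1 + C / m) * `|z - z'| by apply: ler_wpM2r.
have : C / m * (a - a') <= C / m * `|z - z'| by rewrite ler_pM2l.
move: aM; rewrite (mulrC a'); move: (C / m) (`|z - z'|) => u w; lra.
Qed.

(* If [h2] stayed away from [p], then pushing [h2 x] radially out of a ball around
   [p] and applying the near inverse of [h1] would give a map that is close to the
   identity on the boundary but avoids a value near [x0]. *)
Theorem robust_image : forall e, 0 < e -> exists2 x, S x & `|h2 x - p| < e.
Proof.
move=> e0 e0_gt0; apply: contrapT => none.
(* [m] keeps [mid] away from [p]: by the negated claim where [mid] is [h2], and elsewhere because
   [h1] is more than [2 * dl] away and [mid] is within [dl] of it. *)
pose m := Num.min e0 dl.
have m0 : 0 < m by rewrite lt_min e0_gt0.
have mid_far x : S x -> m <= `|mid x - p|.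
  move=> sx; case: (leP `|h1 x - p| (2 * dl)) => H.
    rewrite /mid cut1 // scale1r [h1 x + _]addrC subrK ge_min; apply/orP; left.
    by rewrite leNgt; apply/negP => ?; apply: none; exists x.
  rewrite ge_min; apply/orP; right.
  have := mid_close sx; have := ler_distD (mid x) (h1 x) p.
  rewrite (distrC (h1 x) (mid x)); lra.
have near_x0 : `|x0 - c| < b.
  rewrite lt_neqAle; apply/andP; split => //; apply/eqP => /far_boundary.
  by rewrite subrr normr0; have := dl_gt0; lra.
have dl3 : 0 < 3 * dl by rewrite mulr_gt0.
have [a a0 Ha] := u1 dl3.
(* The first bound keeps the signs on the faces in spite of the errors of [G] and [v], the second
   one keeps the approximate zero within [a] of [x0]. *)
pose eta := Num.min ((b - `|x0 - c|) / 4) (a / 4).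
have eta0 : 0 < eta by rewrite lt_min; lra.
have etab : 4 * eta <= b - `|x0 - c|.
  have : eta <= (b - `|x0 - c|) / 4 by rewrite ge_min lexx.
  lra.
have etaa : 4 * eta <= a.
  have : eta <= a / 4 by rewrite ge_min lexx orbT.
  lra.
have [G [Lam L0 [GL Gh]]] := approx_inverse eta0.
have C0 : 0 < 4 * dl by rewrite mulr_gt0.
have [v vx [k k0 vk]] := sphere_image_avoid p L0 C0 GL x0 eta0.
pose F x := G (push (mid x)) - v.
have uF : ucont S F.
  move=> e e_gt0; pose Lp := 1 + 2 * (4 * dl / m).
  have Lp0 : 0 < Lp.
    have : 0 < 4 * dl / m by rewrite divr_gt0.
    rewrite /Lp; lra.
  have [r r0 Hr] := ucont_mid (divr_gt0 e_gt0 (mulr_gt0 L0 Lp0)).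
  exists r => // x y sx sy xy.
  have := Hr _ _ sx sy xy; rewrite ltr_pdivlMr ?mulr_gt0 // => H.
  rewrite /F opprB addrA subrK; apply: le_lt_trans (GL _ _) _; apply: le_lt_trans H.
  rewrite [leRHS]mulrC -mulrA ler_pM2l //.
  by apply: push_lip => //; apply: mid_far.
have Fb x : S x -> `|x - c| = b -> F x = G (h1 x) - v.
  move=> sx /far_boundary H; rewrite /F mid_h1 ?push_id //.
  by move: H; have := dl_gt0; lra.
have vb i : `|v ord0 i - c ord0 i| <= b - 3 * eta.
  have := norm_coord (v - c) i; rewrite !mxE => /le_trans; apply.
  by have := ler_distD x0 v c; lra.
have bd x i (s : R) : `|s| = 1 -> S x -> x ord0 i = c ord0 i + s * b -> `|x - c| = b.
  move=> s1 sx xi; apply/eqP; rewrite eq_le sx /=.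
  apply: le_trans (norm_coord _ i); rewrite !mxE xi addrAC subrr add0r normrM s1 mul1r.
  exact: ler_norm.
have Fl x i : S x -> x ord0 i = c ord0 i - b -> F x ord0 i < 0.
  move=> sx xi; have xb : `|x - c| = b.
    by apply: (@bd x i (-1)); rewrite ?normrN1 // mulN1r.
  rewrite Fb // !mxE; have := Gh _ sx i; have := vb i; rewrite ler_norml; lra.
have Fr x i : S x -> x ord0 i = c ord0 i + b -> 0 < F x ord0 i.
  move=> sx xi; have xb : `|x - c| = b.
    by apply: (@bd x i 1); rewrite ?normr1 // mul1r.
  rewrite Fb // !mxE; have := Gh _ sx i; have := vb i; rewrite ler_norml; lra.
have e1 : 0 < Num.min (k / 2) eta by rewrite lt_min; lra.
have [x sx] := poincare_miranda b_gt0 uF Fl Fr e1; rewrite le_min => /andP[Fk Fe].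
(* Inside the ball, [push] lands on the sphere, whose image under [G] is at least [k] away from [v].
   Outside, [mid] is [h1], and [x] is so close to [x0] that [h1 x] lies within [3 * dl] of [p]; both
   are contradictions. *)
case: (leP `|mid x - p| (4 * dl)) => H.
  have := vk _ (push_sphere (lt_le_trans m0 (mid_far _ sx)) H); rewrite -/(F x); lra.
have h1far : 3 * dl < `|h1 x - p|.
  have := mid_close sx; have := ler_distD (h1 x) (mid x) p; lra.
move: Fe; rewrite /F mid_h1 ?(ltW h1far) // push_id; last first.
  by move: H; rewrite mid_h1 ?(ltW h1far) // => /ltW.
move=> Fe; have xG : `|x - G (h1 x)| <= eta.
  apply: norm_leP; first exact: ltW.
  by move=> i; rewrite !mxE; have := Gh _ sx i; rewrite ler_norml; lra.
have : `|x - x0| < a.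
  have := ler_distD v x x0; have := ler_distD (G (h1 x)) x v; lra.
by move/(Ha _ _ sx Sx0); rewrite -/p; lra.
Qed.

End robust_image.

(** * A scale at which the map is almost a translation *)

Section euclid.
Variables (R : realType) (d : nat).
Implicit Types (x y z : 'rV[R]_d).

Definition dot x y := \sum_i x ord0 i * y ord0 i.

Lemma dotC x y : dot x y = dot y x.
Proof. by apply: eq_bigr => i _; rewrite mulrC. Qed.

Lemma dotDl x y z : dot (x + y) z = dot x z + dot y z.
Proof. by rewrite /dot -big_split /=; apply: eq_bigr => i _; rewrite mxE mulrDl. Qed.

Lemma dotZl a x z : dot (a *: x) z = a * dot x z.
Proof. by rewrite /dot mulr_sumr; apply: eq_bigr => i _; rewrite mxE mulrA. Qed.

Lemma dotBl x y z : dot (x - y) z = dot x z - dot y z.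
Proof. by rewrite -scaleN1r dotDl dotZl mulN1r. Qed.

Lemma dot_suml I (r : seq I) (P : pred I) (F : I -> 'rV[R]_d) z :
  dot (\sum_(i <- r | P i) F i) z = \sum_(i <- r | P i) dot (F i) z.
Proof.
apply: (big_morph (dot^~ z)) => [x y|]; first exact: dotDl.
by rewrite /dot big1 // => i _; rewrite mxE mul0r.
Qed.

Lemma dot_ge0 x : 0 <= dot x x.
Proof. by apply: sumr_ge0 => i _; rewrite -expr2 sqr_ge0. Qed.

Lemma enorm_ge0 x : 0 <= enorm x.
Proof. exact: sqrtr_ge0. Qed.

Lemma enorm_sq x : enorm x ^+ 2 = dot x x.
Proof.
by rewrite /enorm sqr_sqrtr; [apply: eq_bigr => i _; rewrite expr2 | apply: sumr_ge0 => i _; rewrite sqr_ge0].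
Qed.

Lemma enormN x : enorm (- x) = enorm x.
Proof. by congr Num.sqrt; apply: eq_bigr => i _; rewrite mxE sqrrN. Qed.

Lemma enormC x y : enorm (x - y) = enorm (y - x).
Proof. by rewrite -enormN opprB. Qed.

Lemma dot_le_enorm x y : dot x y <= enorm x * enorm y.
Proof.
have [a0 b0] := (enorm_ge0 x, enorm_ge0 y).
have sq a b : 0 <= a ^+ 2 * dot x x - 2 * a * b * dot x y + b ^+ 2 * dot y y.
  have := dot_ge0 (a *: x - b *: y); rewrite dotBl !dotZl !(dotC _ (_ - _)) !dotBl !dotZl (dotC y x).
  by move=> H; apply: le_trans H _; rewrite le_eqVlt; apply/orP; left; apply/eqP; ring.
case: (ltrP 0 (enorm x * enorm y)) => ab.
  have := sq (enorm y) (enorm x); rewrite -!enorm_sq => H.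
  rewrite -(ler_pM2l ab); nra.
have ab0 : enorm x * enorm y = 0 by apply/eqP; rewrite eq_le ab mulr_ge0.
rewrite ab0; move/eqP: ab0; rewrite mulf_eq0 => /orP[] /eqP E.
  rewrite leNgt; apply/negP => xy.
  have := sq ((dot y y + 1) / dot x y) 1; rewrite -[dot x x]enorm_sq E expr0n /= mulr0 expr1n mul1r add0r mulr1.
  by rewrite -mulrA divfK ?gt_eqF //; have := dot_ge0 y; lra.
rewrite leNgt; apply/negP => xy.
have := sq 1 ((dot x x + 1) / dot x y); rewrite -[dot y y]enorm_sq E expr0n /= mulr0 expr1n mul1r addr0 mulr1.
by rewrite -mulrA divfK ?gt_eqF //; have := dot_ge0 x; lra.
Qed.

Lemma ler_enormD x y : enorm (x + y) <= enorm x + enorm y.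
Proof.
rewrite -(@ler_pXn2r _ 2) ?nnegrE ?addr_ge0 ?enorm_ge0 //.
rewrite enorm_sq dotDl !(dotC _ (_ + _)) !dotDl (dotC y x) -!enorm_sq.
have := dot_le_enorm x y; nra.
Qed.

Lemma ler_enorm_dist z x y : enorm (x - y) <= enorm (x - z) + enorm (z - y).
Proof. by apply: le_trans (ler_enormD _ _); rewrite addrA subrK. Qed.

Lemma norm_le_enorm x : `|x| <= enorm x.
Proof.
apply: norm_leP => [|i]; first exact: enorm_ge0.
rewrite -(@ler_pXn2r _ 2) ?nnegrE ?enorm_ge0 // enorm_sq /dot (bigD1 i) //=.
rewrite real_normK ?num_real // expr2 lerDl; apply: sumr_ge0 => j _.
by rewrite -expr2 sqr_ge0.
Qed.

Lemma enorm_le_norm x : enorm x <= d%:R * `|x|.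
Proof.
rewrite -(@ler_pXn2r _ 2) ?nnegrE ?enorm_ge0 ?mulr_ge0 // enorm_sq /dot.
apply: le_trans (_ : \sum_(i < d) `|x| ^+ 2 <= _).
  apply: ler_sum => i _; rewrite -expr2 -[leLHS]real_normK ?num_real //.
  by rewrite ler_pXn2r ?nnegrE // norm_coord.
rewrite sumr_const card_ord exprMn -[leLHS]mulr_natl ler_wpM2r ?sqr_ge0 //.
case: (d) => [|n]; first by rewrite expr0n.
by rewrite expr2 ler_peMl // ler1n.
Qed.

End euclid.

Section growth.
Variable R : realType.

(* By Bernoulli a growth factor [1 + k] at each of [J] steps exceeds [Lam]. *)
Lemma slow_growth_step (S : nat -> R) c0 k Lam J : 0 < c0 -> 0 <= k -> c0 <= S 0%N ->
  S J <= Lam -> Lam < (1 + J%:R * k) * c0 ->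
  exists j, [/\ (j < J)%N, c0 <= S j & S j.+1 <= (1 + k) * S j].
Proof.
move=> c00 k0 S0 SJ H; apply: contrapT => none.
have : forall j, (j <= J)%N -> (1 + j%:R * k) * c0 <= S j.
  elim=> [|j IH] jJ; first by rewrite mul0r addr0 mul1r.
  have Sj := IH (ltnW jJ).
  have jk : 0 <= j%:R * k by rewrite mulr_ge0.
  have c0j : c0 <= S j.
    apply: le_trans Sj; apply: ler_peMl; [exact: ltW | lra].
  have : ~~ (S j.+1 <= (1 + k) * S j) by apply/negP => ?; apply: none; exists j.
  rewrite -ltNge => /ltW; apply: le_trans.
  have -> : (1 + j.+1%:R * k) * c0 = (1 + j%:R * k) * c0 + k * c0 by rewrite -addn1 natrD; ring.
  rewrite [leRHS]mulrDl mul1r lerD // ler_wpM2l //.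
by move/(_ J (leqnn _)); lra.
Qed.

Lemma pigeonhole_real n (a : 'I_n -> R) T : (0 < n)%N -> \sum_i a i <= n%:R * T ->
  exists i, a i <= T.
Proof.
move=> n0 H; apply: contrapT => /forallNP none.
suff : n%:R * T < \sum_i a i by rewrite ltNge H.
have -> : n%:R * T = \sum_(i < n) T by rewrite sumr_const card_ord mulr_natl.
case: n a n0 H none => // n a _ _ none.
rewrite !big_ord_recl /=; apply: ltr_leD; first by rewrite ltNge; apply/negP/none.
by apply: ler_sum => i _; rewrite ltW // ltNge; apply/negP/none.
Qed.

End growth.

Lemma finite_max (R : realType) (T : finType) (x0 : T) (F : T -> R) :
  exists x, forall y, F y <= F x.
Proof.
by case: (@arg_maxP _ _ _ x0 xpredT F isT) => x _ H; exists x => y; exact: H.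
Qed.

Lemma ucont_within (R : realType) (V W : normedModType R) (S : set V) (h : V -> W) :
  ucont S h -> {within S, continuous h}.
Proof.
move=> uh; apply/subspace_continuousP => x Sx.
apply/cvgrPdist_lt => e e0; have [dl dl0 H] := uh _ e0.
apply/nbhs_ballP; exists dl => // y /=; rewrite -ball_normE /= => xy Sy.
exact: H.
Qed.

Lemma compact_ucont_image (R : realType) (V W : normedModType R) (S : set V) (h : V -> W) :
  ucont S h -> compact S -> compact (h @` S).
Proof. by move=> uh; apply: continuous_compact; exact: ucont_within. Qed.

Lemma enormZ (R : realType) d a (x : 'rV[R]_d) : 0 <= a -> enorm (a *: x) = a * enorm x.
Proof.
move=> a0; apply/eqP; rewrite -(@eqrXn2 _ 2) ?enorm_ge0 ?mulr_ge0 ?enorm_ge0 //.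
by rewrite exprMn !enorm_sq dotZl dotC dotZl mulrA -expr2.
Qed.

Lemma enormB_sq (R : realType) d (x y : 'rV[R]_d) :
  enorm (x - y) ^+ 2 = enorm x ^+ 2 - 2 * dot x y + enorm y ^+ 2.
Proof.
rewrite enorm_sq dotBl (dotC x) (dotC y (_ - _)) !dotBl -!enorm_sq (dotC y x); ring.
Qed.

(** The checkerboard is positive on the pieces [2 i] and negative on the pieces [2 i + 1], so only
    the increments of even number are of use. *)
Lemma even_subsum (R : realType) (F : nat -> R) n : (0 < n)%N ->
  (forall i, (i < n.*2.-1)%N -> 0 <= F i) ->
  \sum_(i < n) F i.*2 <= \sum_(i < n.*2.-1) F i.
Proof.
case: n => // n _; elim: n => [|n IH] F0; first by rewrite !big_ord1.
rewrite big_ord_recr /= doubleS /= [leRHS]big_ord_recr [X in _ <= X + _]big_ord_recr /=.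
have : \sum_(i < n.+1) F i.*2 <= \sum_(i < n.*2.+1) F i.
  by apply: IH => i iN; apply: F0; rewrite doubleS /=; lia.
have : 0 <= F n.*2.+1 by apply: F0; rewrite doubleS /=; lia.
lra.
Qed.

Lemma even_lt N' (i : 'I_N') : (i.*2 < N'.*2.-1)%N.
Proof. by have := ltn_ord i; lia. Qed.

Section stretching.
Variables (R : realType) (d : nat).
Local Notation D := d.+2.
Variables (o : 'rV[R]_D) (t0 : R) (N' q J : nat) (Lam c0 k : R) (g : 'rV[R]_D -> 'rV[R]_D).
Local Notation N := (N'.*2).
Local Notation M := (4 * q)%N.
Local Notation B := (N * M)%N.
Hypotheses (t0_gt0 : 0 < t0) (N'_gt0 : (0 < N')%N) (q_gt0 : (0 < q)%N)
  (Lam_gt0 : 0 < Lam) (c0_gt0 : 0 < c0) (k_ge0 : 0 <= k).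

(** A cell of side [t j] has [N = 2 N'] pieces along the first axis, and each piece has [M = 4 q]
    lattice steps of length [t j.+1]. The factor 4 puts the ends of the middle half of a piece on
    lattice points. *)
Definition scale (N' q : nat) (t0 : R) j := t0 / ((N'.*2 * (4 * q)) ^ j)%:R.
Local Notation t := (scale N' q t0).
Definition axis : 'rV[R]_D := delta_mx ord0 ord0.
Definition lattice s (n : 'I_D -> nat) : 'rV[R]_D := o + \row_r (s * (n r)%:R).
Definition cubeQ : set 'rV[R]_D := [set x | forall r, 0 <= x ord0 r - o ord0 r <= t0].
Local Notation Q := cubeQ.

Hypothesis g_upper : forall s x y, t J <= s -> Q x -> Q y -> `|x - y| <= s ->
  enorm (g x - g y) <= Lam * s.
Hypothesis g_lower : c0 * t0 <= enorm (g (o + t0 *: axis) - g o).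
Hypothesis growth : Lam < (1 + J%:R * k) * c0.
Hypothesis flat : k ^+ 2 + 2 * ((M ^ D)%:R * (2 * k + 2 * Lam / (c0 * N'%:R))) <= (2 * q%:R) ^- 2.

Let B_gt0 : (0 < B)%N. Proof. by rewrite !muln_gt0 double_gt0 N'_gt0 q_gt0. Qed.
Let BR j : (0 : R) < (B ^ j)%:R. Proof. by rewrite ltr0n expn_gt0 B_gt0. Qed.

Lemma scale_gt0 j : 0 < t j. Proof. by rewrite divr_gt0. Qed.

Lemma scaleS j : t j = t j.+1 * B%:R.
Proof.
rewrite /scale expnSr (natrM _ (B ^ j) B) invfM mulrA divfK // gt_eqF // ltr0n.
exact: B_gt0.
Qed.

Lemma scale_le j : (j <= J)%N -> t J <= t j.
Proof.
by move=> jJ; rewrite ler_pM2l // lef_pV2 ?posrE // ler_nat leq_pexp2l ?B_gt0.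
Qed.

Lemma latticeQ j (n : 'I_D -> nat) : (forall r, (n r <= B ^ j)%N) -> Q (lattice (t j) n).
Proof.
move=> nB r; rewrite /lattice !mxE addrAC subrr add0r mulr_ge0 ?(ltW (scale_gt0 j)) //=.
by rewrite /scale -mulrA ler_piMr ?(ltW t0_gt0) // mulrC ler_pdivrMr // mul1r ler_nat.
Qed.

Lemma norm_axis a : `|a *: axis| <= `|a|.
Proof.
by apply: norm_leP => // r; rewrite !mxE eqxx /=; case: eqP; rewrite ?mulr1 ?mulr0 ?normr0.
Qed.

Let bump (a : 'I_D -> nat) c r := (a r + (r == ord0) * c)%N.

Let bump_lt a c X : (forall r, (a r < X)%N) -> (a ord0 + c < X)%N -> forall r, (bump a c r < X)%N.
Proof.
move=> aX acX r; rewrite /bump; case: eqP => [->|_]; rewrite ?mul1n //.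
by rewrite mul0n addn0.
Qed.

Let bump1_le a X : (forall r, (a r < X)%N) -> forall r, (bump a 1 r <= X)%N.
Proof.
move=> aX r; rewrite -ltnS; apply: bump_lt => [r'|]; first exact: leqW.
by rewrite addn1 ltnS.
Qed.

Let bumpS a c r (b : 'I_D -> nat) : (b r + bump a (c + 1) r = bump (fun r => b r + bump a c r) 1 r)%N.
Proof. by rewrite /bump; case: (r == ord0) => /=; lia. Qed.

Let bump_bump a c c' : bump (bump a c) c' = bump a (c + c').
Proof. by apply/funext => r; rewrite /bump mulnDr addnA. Qed.

Let piece_lt i a : (i < N.-1)%N -> (a < M)%N -> (a + i * M + M <= B)%N.
Proof.
move=> iN; move: (M) => M' aM; apply: leq_trans (_ : (i.+2 * M' <= _)%N); last first.
  by rewrite leq_mul2r; apply/orP; right; lia.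
by rewrite !mulSnr leq_add2r addnC leq_add2l ltnW.
Qed.

Let lattice_bump s a c : lattice s (bump a c) = lattice s a + (s * c%:R) *: axis.
Proof.
apply/rowP => r; rewrite !mxE eqxx /= natrD natrM; case: eqP => _ /=.
  by rewrite mul1r mulr1; ring.
by rewrite mul0r mulr0; ring.
Qed.

Let stretch j n := enorm (g (lattice (t j) (bump n 1)) - g (lattice (t j) n)).

Let max_stretch : exists S : nat -> R,
  (forall j n, (forall r, (n r < B ^ j)%N) -> stretch j n <= S j * t j) /\
  (forall j, exists2 n, (forall r, (n r < B ^ j)%N) & stretch j n = S j * t j).
Proof.
have x0 j : {ffun 'I_D -> 'I_(B ^ j)}.
  by apply: finfun => r; exists 0%N; rewrite expn_gt0 B_gt0.
have ex : forall j, exists n : {ffun 'I_D -> 'I_(B ^ j)},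
    forall n' : {ffun 'I_D -> 'I_(B ^ j)}, stretch j (fun r => n' r) <= stretch j (fun r => n r).
  by move=> j; exact: (finite_max (x0 j) (fun n : {ffun 'I_D -> 'I_(B ^ j)} => stretch j (fun r => n r))).
pose n j := sval (cid (ex j)); have nP j := svalP (cid (ex j)).
exists (fun j => stretch j (fun r => n j r) / t j); split => [j m mB|j].
  rewrite divfK ?gt_eqF ?scale_gt0 //.
  have := nP j (finfun (fun r => Ordinal (mB r))).
  have E : (fun r => nat_of_ord (finfun (fun r => Ordinal (mB r)) r)) = m.
    by apply/funext => r; rewrite ffunE.
  by rewrite E.
by exists (fun r => n j r); [move=> r; exact: ltn_ord | rewrite divfK ?gt_eqF ?scale_gt0].
Qed.

(* In the cell where the maximal stretching of level [j] is attained, the increments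
   of [g] over the next scale have almost maximal length and almost maximal sum of
   components in the direction of their sum, so on average they are almost equal. *)
Lemma almost_linear_piece : exists j n i v, [/\ (j < J)%N, (forall r, (n r < B ^ j)%N), (i < N')%N &
  forall m, (forall r, (m r < M)%N) ->
  forall z, z = lattice (t j.+1) (bump (fun r => B * n r + m r)%N (i.*2 * M)%N) ->
  enorm (g (z + (t j.+1 * M%:R) *: axis) - g z - v) <= Lam * (t j.+1 * M%:R) / (2 * q%:R)].
Proof.
have [S [S_ub S_att]] := max_stretch.
have SJ : S J <= Lam.
  have [n nB nS] := S_att J.
  rewrite -(ler_pM2r (scale_gt0 J)) -nS; apply: g_upper => //.
  - by apply: latticeQ => r; exact: bump1_le.
  - by apply: latticeQ => r; exact: ltnW.
  - rewrite lattice_bump addrAC subrr add0r mulr1.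
    by apply: le_trans (norm_axis _) _; rewrite gtr0_norm ?scale_gt0.
have S0 : c0 <= S 0%N.
  rewrite -(ler_pM2r (scale_gt0 0)) /scale expn0 divr1.
  have := @S_ub 0%N (fun=> 0%N) (fun r => ltnSn 0); rewrite /stretch lattice_bump.
  rewrite /scale expn0 divr1 mulr1 => H; apply: le_trans H; apply: le_trans g_lower _.
  rewrite (_ : lattice t0 _ = o) //; apply/rowP => r; rewrite !mxE mulr0 addr0 //.
have [j [jJ c0S SS]] := slow_growth_step c0_gt0 k_ge0 S0 SJ growth.
have [n nB nS] := S_att j.
pose h := t j.+1; have h0 : 0 < h by exact: scale_gt0.
pose ell := h * M%:R.
have MR : (0 : R) < M%:R by rewrite ltr0n muln_gt0.
have ell0 : 0 < ell by rewrite mulr_gt0.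
have tN : t j = ell * N%:R by rewrite scaleS (natrM _ N M) /ell mulrA mulrAC.
have S0' : 0 < S j by apply: lt_le_trans c0S.
have tJh : t J <= h by exact: scale_le.
have SjL : S j <= Lam.
  rewrite -(ler_pM2r (scale_gt0 j)) -nS; apply: g_upper; first exact/scale_le/ltnW.
  - by apply: latticeQ => r; exact: bump1_le.
  - by apply: latticeQ => r; exact: ltnW.
  - rewrite lattice_bump addrAC subrr add0r mulr1.
    by apply: le_trans (norm_axis _) _; rewrite gtr0_norm ?scale_gt0.
pose Z a := lattice h (fun r => B * n r + a r)%N.
have ZQ a : (forall r, (a r <= B)%N) -> Q (Z a).
  move=> aB; apply: latticeQ => r; have := nB r; have := aB r; rewrite expnS.
  move: (a r) (n r) => a' n' a'B n'B.
  by apply: leq_trans (leq_add (leqnn _) a'B) _; rewrite -mulnSr leq_mul2l n'B orbT.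
have Zbump a c : Z (bump a c) = Z a + (h * c%:R) *: axis.
  rewrite -lattice_bump /Z; congr lattice; apply/funext => r.
  by rewrite /bump addnA.
have chain c a : (forall r, (a r < B)%N) -> (a ord0 + c <= B)%N ->
    enorm (g (Z (bump a c)) - g (Z a)) <= S j.+1 * h * c%:R.
  move=> aB; elim: c => [|c IH] ac.
    by rewrite Zbump !mulr0 scale0r addr0 subrr /enorm big1 ?sqrtr0 // => i _; rewrite mxE expr0n.
  apply: le_trans (ler_enorm_dist (g (Z (bump a c))) _ _) _.
  rewrite -[c.+1]addn1 natrD mulrDr mulr1 addrC; apply: lerD.
    by apply: IH; apply: leq_trans ac; rewrite leq_add2l.
  have : forall r, (B * n r + bump a c r < B ^ j.+1)%N.
    move=> r; have := nB r; have : (bump a c r < B)%N by apply: bump_lt => //; rewrite -addnS.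
    rewrite expnS; move: (bump a c r) (n r) => a' n' a'B n'B.
    apply: leq_trans (_ : B * n'.+1 <= _)%N; last by rewrite leq_mul2l n'B orbT.
    by rewrite mulnS [X in (_ <= X)%N]addnC -addnS leq_add2l.
  move/S_ub; apply: le_trans; rewrite /stretch le_eqVlt; apply/orP; left; apply/eqP.
  congr (enorm (g (lattice _ _) - _)); apply/funext => r.
  exact: (bumpS a c r (fun r => B * n r)%N).
pose x := lattice (t j) n.
have xE : Z (fun=> 0%N) = x.
  apply/rowP => r; rewrite !mxE addn0 natrM mulrA; congr (_ + _ * _).
  by rewrite [t j]scaleS.
have xQ : Q x by rewrite -xE; apply: ZQ.
pose u := g (x + t j *: axis) - g x.
have xe : x + t j *: axis = lattice (t j) (bump n 1) by rewrite lattice_bump mulr1.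
have xeQ : Q (x + t j *: axis) by rewrite xe; apply: latticeQ => r; exact: bump1_le.
have NR : (0 : R) < N%:R by rewrite ltr0n double_gt0.
pose v := N%:R^-1 *: u.
pose V := S j * ell.
have V0 : 0 < V by rewrite mulr_gt0.
have uE : enorm u = V * N%:R by rewrite /u xe [LHS]nS tN /V mulrA.
have vE : enorm v = V by rewrite enormZ ?invr_ge0 ?(ltW NR) // uE mulrC mulfK // gt_eqF.
have uv : u = N%:R *: v by rewrite scalerA divff ?scale1r // gt_eqF.
(* The increment over piece [i] along the row that is parallel to the extremal edge and offset by
   [m]. *)
pose dd m i := g (Z (bump m (i.+1 * M)%N)) - g (Z (bump m (i * M)%N)).
have dd_norm m i : (forall r, (m r < M)%N) -> (i < N.-1)%N -> enorm (dd m i) <= (1 + k) * V.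
  move=> mM iN; rewrite /dd mulSnr -bump_bump.
  have MB : (M <= B)%N by rewrite leq_pmull // double_gt0.
  have pl := piece_lt iN (mM ord0).
  apply: le_trans (chain _ _ _ _) _.
  - apply: bump_lt => [r|]; first exact: leq_trans (mM r) MB.
    by apply: leq_trans pl; rewrite -[ltnLHS]addn0 ltn_add2l muln_gt0.
  - by rewrite /bump eqxx mul1n.
  - by rewrite -mulrA -/ell /V [leRHS]mulrA ler_pM2r.
have dd_sum m : \sum_(i < N.-1) dd m i = g (Z (bump m (N.-1 * M)%N)) - g (Z m).
  rewrite -(big_mkord xpredT (dd m)) /dd.
  rewrite (telescope_sumr (fun i => g (Z (bump m (i * M)%N))) (leq0n _)) mul0n.
  by congr (_ - g (Z _)); apply/funext => r; rewrite /bump muln0 addn0.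
(* With an offset, only [N - 1] pieces are sure to fit into the cell. The ends of the row are within
   [ell] of the ends of the extremal edge, which costs [Lam * ell] at each end. *)
have end_bound m : (forall r, (m r < M)%N) ->
    N%:R * V ^+ 2 - 2 * Lam * ell * V <= dot (\sum_(i < N.-1) dd m i) v.
  move=> mM; rewrite dd_sum.
  have MB : (M <= B)%N by rewrite leq_pmull // double_gt0.
  have mZ : Q (Z m) by apply: ZQ => r; apply: ltnW; exact: leq_trans (mM r) MB.
  have NMB : (N.-1 * M + M)%N = B by rewrite -mulSnr prednK // double_gt0.
  have mZ' : Q (Z (bump m (N.-1 * M)%N)).
    apply: ZQ => r; apply: ltnW; apply: bump_lt => [r'|]; first exact: leq_trans (mM r') MB.
    by rewrite addnC -NMB ltn_add2l.
  have ellJ : t J <= ell.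
    by apply: le_trans tJh _; rewrite /ell ler_peMr ?(ltW h0) // ler1n muln_gt0.
  have e1 : enorm (g (Z m) - g x) <= Lam * ell.
    apply: g_upper => //; rewrite -xE; apply: norm_leP; first exact: ltW.
    move=> r; rewrite !mxE addn0 natrD.
    have -> : o ord0 r + h * ((B * n r)%:R + (m r)%:R) - (o ord0 r + h * (B * n r)%:R) = h * (m r)%:R.
      by ring.
    have hm := mulr_ge0 (ltW h0) (ler0n R (m r)).
    by rewrite (ger0_norm hm) ler_pM2l // ler_nat ltnW.
  have e2 : enorm (g (Z (bump m (N.-1 * M)%N)) - g (x + t j *: axis)) <= Lam * ell.
    apply: g_upper => //.
    rewrite Zbump -xE; apply: norm_leP; first exact: ltW.
    move=> r; rewrite !mxE eqxx /= addn0 natrD tN.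
    have -> : N%:R = N.-1%:R + 1 :> R by rewrite natr1 prednK // double_gt0.
    have hm : 0 <= h * (m r)%:R <= ell.
      by rewrite (mulr_ge0 (ltW h0) (ler0n R (m r))) /= ler_pM2l // ler_nat ltnW.
    rewrite (natrM _ N.-1 M).
    have -> : o ord0 r + h * ((B * n r)%:R + (m r)%:R) + h * (N.-1%:R * M%:R) * (r == ord0)%:R
       - (o ord0 r + h * (B * n r)%:R + ell * (N.-1%:R + 1) * (r == ord0)%:R)
       = h * (m r)%:R - ell * (r == ord0)%:R by rewrite /ell; ring.
    by rewrite ler_norml; case: eqP => _ /=; lra.
  have -> : g (Z (bump m (N.-1 * M)%N)) - g (Z m) =
     u - ((g (x + t j *: axis) - g (Z (bump m (N.-1 * M)%N))) + (g (Z m) - g x)).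
    by rewrite /u; apply/rowP => r; rewrite !mxE; ring.
  rewrite dotBl uv dotZl -enorm_sq vE.
  have := dot_le_enorm ((g (x + t j *: axis) - g (Z (bump m (N.-1 * M)%N))) + (g (Z m) - g x)) v.
  rewrite vE => H.
  have : enorm ((g (x + t j *: axis) - g (Z (bump m (N.-1 * M)%N))) + (g (Z m) - g x)) * V <= 2 * Lam * ell * V.
    rewrite ler_pM2r //; apply: le_trans (ler_enormD _ _) _.
    by move: e2; rewrite enormC; lra.
  lra.
(* The deficit of an increment against the largest possible product with [v]: nonnegative for each
   piece, small in sum over the row. *)
pose def m i := (1 + k) * V ^+ 2 - dot (dd m i) v.
have def_ge0 m i : (forall r, (m r < M)%N) -> (i < N.-1)%N -> 0 <= def m i.
  move=> mM iN; rewrite subr_ge0; apply: le_trans (dot_le_enorm _ _) _.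
  by rewrite vE expr2 mulrA ler_pM2r //; exact: dd_norm.
pose T0 := V ^+ 2 * (N%:R * k + 2 * Lam / c0).
have def_sum m : (forall r, (m r < M)%N) -> \sum_(i < N.-1) def m i <= T0.
  move=> mM; rewrite sumrB -dot_suml sumr_const card_ord.
  have := end_bound m mM; have -> : N.-1 = (N - 1)%N by rewrite subn1.
  move=> H; rewrite -mulr_natl natrB ?double_gt0 //.
  (* Here the lower bound [c0] for the stretching makes the error at the ends small relative to
     [V]. *)
  have cV : ell * V <= V ^+ 2 / c0.
    by rewrite ler_pdivlMr // expr2 mulrAC ler_pM2r // /V mulrC ler_pM2r.
  have : 2 * Lam * (ell * V) <= 2 * Lam * (V ^+ 2 / c0) by rewrite ler_pM2l // mulr_gt0.
  have : 0 <= (1 + k) * V ^+ 2 by rewrite mulr_ge0 ?sqr_ge0 // addr_ge0.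
  have -> : T0 = N%:R * k * V ^+ 2 + 2 * Lam * (V ^+ 2 / c0) by rewrite /T0; ring.
  lra.
pose T := V ^+ 2 * ((M ^ D)%:R * (2 * k + 2 * Lam / (c0 * N'%:R))).
(* Summing over all [M ^ D] offsets before [i] is chosen yields one piece that serves every
   offset. *)
have [i iT] : exists i : 'I_N', \sum_(m : {ffun 'I_D -> 'I_M}) def (fun r => m r) i.*2 <= T.
  apply: pigeonhole_real => //; rewrite exchange_big /=.
  apply: le_trans (_ : \sum_(m : {ffun 'I_D -> 'I_M}) T0 <= _).
    apply: ler_sum => m _; have mM r : (m r < M)%N by exact: ltn_ord.
    apply: le_trans (def_sum (fun r => m r) mM).
    apply: (even_subsum (F := fun i => def (fun r => m r) i)) => // i' i'N.
    exact: def_ge0.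
  rewrite sumr_const card_ffun !card_ord -[leLHS]mulr_natl le_eqVlt; apply/orP; left; apply/eqP.
  have N'R : (0 : R) < N'%:R by rewrite ltr0n.
  by rewrite /T /T0 -muln2 natrM; field; rewrite !gt_eqF.
exists j, n, i, v; split => // m mM z zdef.
have zE : z = Z (bump m (i.*2 * M)%N).
  by rewrite zdef /Z; congr lattice; apply/funext => r; rewrite /bump addnA.
have -> : g (z + (t j.+1 * M%:R) *: axis) - g z - v = dd m i.*2 - v.
  by rewrite /dd (mulSnr i.*2 M) -bump_bump Zbump -zE.
have iN : (i.*2 < N.-1)%N by exact: even_lt.
have dT : def m i.*2 <= T.
  apply: le_trans iT; pose m' : {ffun 'I_D -> 'I_M} := [ffun r => Ordinal (mM r)].
  rewrite (bigD1 m') //=.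
  have -> : (fun r => nat_of_ord (m' r)) = m by apply/funext => r; rewrite ffunE.
  by rewrite lerDl; apply: sumr_ge0 => m'' _; apply: def_ge0.
have QR : (0 : R) < 2 * q%:R by rewrite mulr_gt0 // ltr0n.
(* Expanding the square, a small deficit bounds the distance from [v]: what remains is at most
   [k ^ 2 * V ^ 2 + 2 * T], and [flat] controls it. *)
have dv : enorm (dd m i.*2 - v) <= V / (2 * q%:R).
  rewrite -(@ler_pXn2r _ 2) ?nnegrE ?enorm_ge0 ?divr_ge0 ?(ltW V0) ?(ltW QR) //.
  rewrite enormB_sq vE.
  have dn : enorm (dd m i.*2) ^+ 2 <= ((1 + k) * V) ^+ 2.
    have kV : 0 <= (1 + k) * V by rewrite mulr_ge0 ?(ltW V0) // addr_ge0.
    by rewrite ler_pXn2r ?nnegrE ?enorm_ge0 //; exact: (dd_norm m i.*2 mM iN).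
  have : V ^+ 2 * (k ^+ 2 + 2 * ((M ^ D)%:R * (2 * k + 2 * Lam / (c0 * N'%:R)))) <= V ^+ 2 * (2 * q%:R) ^- 2.
    by rewrite ler_pM2l // exprn_gt0.
  rewrite expr_div_n mulrDr [V ^+ 2 * (2 * _)]mulrCA -/T.
  move: dT; rewrite /def; move: dn; rewrite exprMn; clear iT.
  move: (V ^+ 2) (dot (dd m i.*2) v) (enorm (dd m i.*2) ^+ 2) T => W p E T'.
  move=> H1 H2 H3; apply: le_trans _ H3.
  have -> : W * k ^+ 2 + 2 * T' = (1 + k) ^+ 2 * W + W - 2 * ((1 + k) * W - T') by ring.
  lra.
by apply: le_trans dv _; rewrite ler_pM2r ?invr_gt0 // ler_pM2r.
Qed.

End stretching.

Lemma compact_approx (R : realType) d (A : set 'rV[R]_d) w : compact A ->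
  (forall e, 0 < e -> exists2 y, A y & `|y - w| < e) -> A w.
Proof.
move=> cA H; have : closed A by apply: compact_closed => //; exact: norm_hausdorff.
apply => U /nbhs_ballP[e /= e0 eU]; have [y Ay yw] := H _ e0.
by exists y; split => //; apply: eU; rewrite -ball_normE /= distrC.
Qed.

Lemma ucont_sub (R : realType) (V W : normedModType R) (S T : set V) (h : V -> W) :
  S `<=` T -> ucont T h -> ucont S h.
Proof.
by move=> ST uT e /uT[dl dl0 H]; exists dl => // x y /ST ? /ST ?; apply: H.
Qed.

Lemma double_succ_le i n : (i < n)%N -> (i.*2 + 2 <= n.*2)%N.
Proof. lia. Qed.

Lemma measure_le_setD dd (T : measurableType dd) (R : realType)
    (mu : {measure set T -> \bar R}) (A A' : set T) : measurable A -> measurable A' ->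
  (mu A <= mu A' + mu (A `\` A'))%E.
Proof.
move=> mA mA'; apply: le_trans (measureU2 _ mA' (measurableD mA mA')).
apply: le_measure; rewrite ?inE //; first by apply: measurableU => //; exact: measurableD.
by move=> w Aw; have [?|?] := pselect (A' w); [left | right].
Qed.

Section volume.
Variables (R : realType) (d : nat).
Local Notation D := d.+2.
Variables (o : 'rV[R]_D) (t0 : R) (N' q J : nat) (Lam c0 k : R) (g : 'rV[R]_D -> 'rV[R]_D).
Local Notation N := (N'.*2).
Local Notation M := (4 * q)%N.
Local Notation B := (N * M)%N.
Hypotheses (t0_gt0 : 0 < t0) (N'_gt0 : (0 < N')%N) (q_gt0 : (0 < q)%N)
  (Lam_gt0 : 0 < Lam) (c0_gt0 : 0 < c0) (k_ge0 : 0 <= k).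
Local Notation t := (scale N' q t0).
Local Notation axis := (axis R d).
Local Notation Q := (cubeQ o t0).

Hypothesis g_upper : forall s x y, t J <= s -> Q x -> Q y -> `|x - y| <= s ->
  enorm (g x - g y) <= Lam * s.
Hypothesis g_lower : c0 * t0 <= enorm (g (o + t0 *: axis) - g o).
Hypothesis growth : Lam < (1 + J%:R * k) * c0.
Hypothesis flat : k ^+ 2 + 2 * ((M ^ D)%:R * (2 * k + 2 * Lam / (c0 * N'%:R))) <= (2 * q%:R) ^- 2.
Hypothesis g_ucont : ucont Q g.
Hypothesis g_inv : forall e, 0 < e -> exists2 k, 0 < k &
  forall x y, Q x -> Q y -> `|g x - g y| < k -> `|x - y| < e.

(** The [N] cubes of side [t j / N] lined up along the edge of the cell that starts at its lowest
    corner. Only their middle halves, boxes of radius a quarter of the side, are used: there the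
    checkerboard takes its extreme values. *)
Definition piece_center j (n : 'I_D -> nat) i : 'rV[R]_D :=
  o + \row_r (t j * (n r)%:R + t j / N%:R / 2 + (r == ord0)%:R * (i%:R * (t j / N%:R))).

Lemma cell_le j a : (a < B ^ j)%N -> t j * a%:R + t j <= t0.
Proof.
move=> aB; have tj0 : 0 < t j by exact: scale_gt0.
have E : t0 = t j * (B ^ j)%:R.
  rewrite /scale divfK // pnatr_eq0 -lt0n expn_gt0 !muln_gt0 double_gt0.
  by rewrite N'_gt0 q_gt0.
by rewrite [leRHS]E -[X in _ + X]mulr1 -mulrDr natr1 ler_pM2l // ler_nat.
Qed.

Lemma piece_in_cube j n i x : (forall r, (n r < B ^ j)%N) -> (i < N)%N ->
  box (piece_center j n i) (t j / N%:R / 4) x -> Q x.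
Proof.
move=> nB iN bx r.
have tj0 : 0 < t j by exact: scale_gt0.
have NR : (0 : R) < N%:R by rewrite ltr0n double_gt0.
have l0 : 0 < t j / N%:R by rewrite divr_gt0.
have tN : t j = t j / N%:R * N%:R by rewrite divfK // gt_eqF.
have := le_trans (norm_coord _ r) bx; rewrite !mxE ler_norml.
have il : i%:R * (t j / N%:R) + t j / N%:R <= t j.
  by rewrite [leRHS]tN -[X in _ + X]mul1r -mulrDl natr1 mulrC ler_pM2l // ler_nat.
have i0 : 0 <= i%:R * (t j / N%:R) by rewrite mulr_ge0 // ltW.
have n0 : 0 <= t j * (n r)%:R by rewrite mulr_ge0 // ltW.
have nt := cell_le (nB r).
move: (t j / N%:R) l0 il i0 {tN} => l l0 il i0.
by case: eqP => _ /=; rewrite ?mul1r ?mul0r; lra.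
Qed.

(* On the boundary of the piece [g] and the translate of [g] differ by [Lam * l / q],
   so by [robust_image] one image is covered by the other together with a
   neighbourhood of the image of the boundary. *)
Lemma volume_almost_preserved : exists j n i, [/\ (j < J)%N, (forall r, (n r < B ^ j)%N), (i < N')%N &
  let l := t j / N%:R in
  (lebesgue_rV R D (g @` box (piece_center j n i.*2) (l / 4)) <=
   lebesgue_rV R D (g @` box (piece_center j n i.*2.+1) (l / 4)) +
   (D%:R * (20 * Lam * l) ^+ D / q%:R)%:E)%E].
Proof.
have [j [n [i [v [jJ nB iN' Hv]]]]] :=
  almost_linear_piece t0_gt0 N'_gt0 q_gt0 Lam_gt0 c0_gt0 k_ge0 g_upper g_lower growth flat.
exists j, n, i; split => // l.
have NR : (0 : R) < N%:R by rewrite ltr0n double_gt0.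
have QR : (0 : R) < q%:R by rewrite ltr0n.
have tj0 : 0 < t j by exact: scale_gt0.
have l0 : 0 < l by rewrite divr_gt0.
pose h := t j.+1; have h0 : 0 < h by exact: scale_gt0.
have lh : l = h * M%:R.
  rewrite /l (scaleS t0 N'_gt0 q_gt0) (natrM _ N M) -/h mulrA mulrAC mulfK // gt_eqF //.
have hl : h = l / (4 * q%:R).
  by rewrite lh natrM mulfK // gt_eqF // mulr_gt0.
have tN : t j = l * N%:R by rewrite divfK // gt_eqF.
have tJh : t J <= h by apply: scale_le.
set c := piece_center j n i.*2; set c' := piece_center j n i.*2.+1.
have cc' : c' = c + l *: axis.
  apply/rowP => r; rewrite !mxE eqxx /= -/l -natr1; case: eqP => _ /=; ring.
have i2N : (i.*2.+1 < N)%N by have := double_succ_le iN'; rewrite addn2.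
have SQ x : box c (l / 4) x -> Q x by apply: piece_in_cube => //; exact: ltnW.
have SQ' x : box c (l / 4) x -> Q (x + l *: axis).
  move=> bx; apply: (@piece_in_cube j n i.*2.+1) => //.
  by rewrite -/c' cc' /box /= opprD addrACA subrr addr0.
(* The distance between [g] and its translate: [dl / 2] at lattice points, and [dl / 4] twice for
   passing from [y] to a lattice point. *)
pose dl := Lam * l / q%:R.
have dl0 : 0 < dl by rewrite divr_gt0 // mulr_gt0.
have Lh : Lam * h = dl / 4.
  by rewrite hl /dl; field; rewrite gt_eqF.
pose h2 y := g (y + l *: axis) - v.
have close y : box c (l / 4) y -> `|g y - h2 y| <= dl.
  move=> yS.
  have yr r : 0 <= y ord0 r - (o ord0 r + t j * (n r)%:R + (r == ord0)%:R * (i.*2%:R * l)) <= l.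
    have := le_trans (norm_coord _ r) yS; rewrite !mxE -/l ler_norml; lra.
  have il : i.*2%:R * l + 2 * l <= t j.
    by rewrite [leRHS]tN -mulrDl -natrD mulrC ler_pM2l // ler_nat double_succ_le.
  have M0 : (0 < M)%N by rewrite muln_gt0.
  have /choice[m mP] : forall r : 'I_D, exists k : 'I_M,
      k%:R * h <= y ord0 r - (o ord0 r + t j * (n r)%:R + (r == ord0)%:R * (i.*2%:R * l)) <= k.+1%:R * h.
    move=> r; have [a aM Ha] := subdivide M0 l0 (yr r).
    by exists (Ordinal aM); rewrite natrM -hl in Ha.
  pose z := lattice o (t j.+1) (fun r => (B * n r + m r) + (r == ord0) * (i.*2 * M))%N.
  have zr r : z ord0 r = o ord0 r + t j * (n r)%:R + (r == ord0)%:R * (i.*2%:R * l) + (m r)%:R * h.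
    rewrite !mxE -/h.
    have -> : (B * n r + m r + (r == ord0) * (i.*2 * M))%N%:R =
      N%:R * M%:R * (n r)%:R + (m r)%:R + (r == ord0)%:R * (i.*2%:R * M%:R) :> R.
      by move: (nat_of_ord (m r)) => a; move: (M) (N) => M1 N1; rewrite !natrD !natrM.
    by rewrite tN lh; move: (M%:R : R) (N%:R : R) => a b; ring.
  have yz : `|y - z| <= h.
    apply: norm_leP; first exact: ltW.
    move=> r; rewrite 2!mxE zr; have := mP r; rewrite -natr1 ler_norml; lra.
  have zQ e : 0 <= e <= l -> Q (z + e *: axis).
    move=> /andP[e0 el] r; rewrite mxE zr !mxE eqxx /=.
    have mh : (m r)%:R * h + h <= l.
      by rewrite lh -[X in _ + X]mul1r -mulrDl natr1 mulrC ler_pM2l // ler_nat.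
    have mh0 : 0 <= (m r)%:R * h by rewrite mulr_ge0 // ltW.
    have n0 : 0 <= t j * (n r)%:R by rewrite mulr_ge0 // ltW.
    have := cell_le (nB r); have i0 : 0 <= i.*2%:R * l by rewrite mulr_ge0 // ltW.
    by case: eqP => _ /=; rewrite ?mul1r ?mul0r ?mulr1 ?mulr0; lra.
  have Hz := Hv (fun r => m r) (fun r => ltn_ord (m r)) z erefl.
  rewrite -/h -lh in Hz.
  have e1 : enorm (g (y + l *: axis) - g (z + l *: axis)) <= dl / 4.
    rewrite -Lh; apply: (g_upper tJh); [exact: SQ' | by apply: zQ; lra|].
    by rewrite opprD addrACA subrr addr0.
  have e2 : enorm (g z - g y) <= dl / 4.
    rewrite -Lh; apply: (g_upper tJh); [|exact: SQ|by rewrite distrC].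
    by rewrite -[z]addr0 -(scale0r axis); apply: zQ; lra.
  rewrite distrC; apply: le_trans (norm_le_enorm _) _.
  have -> : h2 y - g y = (g (y + l *: axis) - g (z + l *: axis)) +
      ((g (z + l *: axis) - g z - v) + (g z - g y)).
    by rewrite /h2; apply/rowP => r; rewrite !mxE; ring.
  apply: le_trans (ler_enormD _ _) _.
  have := ler_enormD (g (z + l *: axis) - g z - v) (g z - g y).
  have : Lam * l / (2 * q%:R) = dl / 2 by rewrite /dl; field; rewrite gt_eqF.
  by move: Hz => /[swap] -> ; lra.
have u1 : ucont (box c (l / 4)) g by apply: ucont_sub g_ucont.
have u2 : ucont (box c (l / 4)) h2.
  move=> e e0; have [r r0 Hr] := g_ucont e0; exists r => // x y xS yS xy.
  rewrite /h2 opprB addrA subrK; apply: Hr; [exact: SQ'|exact: SQ'|].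
  by rewrite opprD addrACA subrr addr0.
have inj1 e : 0 < e -> exists2 k, 0 < k &
  forall x y, box c (l / 4) x -> box c (l / 4) y -> `|g x - g y| < k -> `|x - y| < e.
  by move=> /g_inv[r r0 Hr]; exists r => // x y /SQ ? /SQ ?; apply: Hr.
have l4 : 0 < l / 4 by rewrite divr_gt0.
have cA := compact_ucont_image u1 (@compact_box _ _ c (l / 4)).
have cA2 := compact_ucont_image u2 (@compact_box _ _ c (l / 4)).
have mA := compact_measurable_rV cA; have mA2 := compact_measurable_rV cA2.
have A2E : lebesgue_rV R D (h2 @` box c (l / 4)) = lebesgue_rV R D (g @` box c' (l / 4)).
  have cA' : compact (g @` box c' (l / 4)).
    apply: compact_ucont_image (@compact_box _ _ _ _); apply: ucont_sub g_ucont => x.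
    exact: piece_in_cube.
  rewrite -(lebesgue_rV_shift v (compact_measurable_rV cA')); congr (lebesgue_rV R D _).
  apply/seteqP; split => [_ [x xS <-]|y /= [x xS xy]] /=.
    rewrite /h2 subrK; exists (x + l *: axis) => //.
    by rewrite /box /= cc' opprD addrACA subrr addr0.
  exists (x - l *: axis).
    by move: xS; rewrite /box /= cc' opprD addrA (addrAC x).
  by rewrite /h2 subrK xy addrK.
(* With [2 * q] divisions the net on the boundary of the half-size box has mesh [h], a distance at
   which [g_upper] still applies. *)
have q20 : (0 < 2 * q)%N by rewrite muln_gt0.
have [P Ps [Pb Pc]] := boundary_cover c l4 q20.
rewrite -A2E; apply: le_trans (measure_le_setD _ mA mA2) _.
apply: leeD2l.
apply: le_trans (lebesgue_cover (P := [seq g y | y <- P]) (rho := 5 * dl) _ (measurableD mA mA2) _) _.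
- exact: mulr_ge0 (ler0n _ _) (ltW dl0).
- move=> w [[x0 x0S <-] nA2].
  (* If the images of all boundary points were at least [4 * dl] away from [g x0], then
     [robust_image] would put [g x0] into the compact image of [h2]. *)
  have [x [xb xw]] : exists x, `|x - c| = l / 4 /\ `|g x - g x0| < 4 * dl.
    apply: contrapT => /forallNP H; apply: nA2; apply: (compact_approx cA2) => e e0.
    have far x : `|x - c| = l / 4 -> 4 * dl <= `|g x - g x0|.
      by move=> xb; rewrite leNgt; apply/negP => xlt; exact: (H x (conj xb xlt)).
    have [x xS xw] := robust_image l4 u1 u2 inj1 x0S dl0 close far e0.
    by exists (h2 x); [exists x | exact: xw].
  have [y yP xy] := Pc _ xb.
  exists (g y); first exact: map_f.
  have e3 : enorm (g x - g y) <= dl / 4.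
    rewrite -Lh; apply: (g_upper tJh).
    - by apply: SQ; rewrite /box /= xb lexx.
    - by apply: SQ; rewrite /box /= (Pb _ yP) lexx.
    - by apply: le_trans xy _; rewrite natrM hl le_eqVlt; apply/orP; left; apply/eqP; field; rewrite gt_eqF.
  have := le_trans (norm_le_enorm _) e3; have := ler_distD (g x) (g x0) (g y).
  rewrite (distrC (g x0) (g x)); lra.
rewrite size_map Ps lee_fin le_eqVlt; apply/orP; left; apply/eqP.
rewrite !natrM natrX natrM /dl.
have -> : 2 * (5 * (Lam * l / q%:R)) = (10 * Lam * l) / q%:R by ring.
have -> : 20 * Lam * l = 2 * (10 * Lam * l) by ring.
rewrite expr_div_n [in RHS]exprMn exprMn.
rewrite !(exprS _ d.+1); move: ((10 * Lam * l) * _) (D%:R : R) => W D'.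
have := expf_neq0 d.+1 (lt0r_neq0 QR); move: (lt0r_neq0 QR) (q%:R ^+ d.+1 : R) (2 ^+ d.+1 : R).
by move: (q%:R : R) => x x0 xd d2 xd0; field; rewrite x0.
Qed.

End volume.

(** * The checkerboard *)

Section real_continuity.
Variables (R : realType) (T : topologicalType).
Implicit Types f g : T -> R.

Lemma continuous_sub f g x : {for x, continuous f} -> {for x, continuous g} ->
  {for x, continuous (fun z => f z - g z)}.
Proof. exact: cvgB. Qed.

Lemma continuous_add f g x : {for x, continuous f} -> {for x, continuous g} ->
  {for x, continuous (fun z => f z + g z)}.
Proof. exact: cvgD. Qed.

Lemma continuous_mul f g x : {for x, continuous f} -> {for x, continuous g} ->
  {for x, continuous (fun z => f z * g z)}.
Proof. exact: cvgM. Qed.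

Lemma continuous_compose f (h : R -> R) x : {for x, continuous f} -> continuous h ->
  {for x, continuous (fun z => h (f z))}.
Proof. by move=> cf ch; exact: (continuous_comp cf (ch _)). Qed.

End real_continuity.

Section train.
Variable R : realType.

Definition clamp (lo : R) (z : R) : R := Num.max lo (Num.min 1 z).

Lemma clamp_bound lo z : lo <= 1 -> lo <= clamp lo z <= 1.
Proof. by rewrite /clamp /Num.max /Num.min => ?; do ! case: ifP; lra. Qed.

Lemma clamp_id lo z : lo <= z <= 1 -> clamp lo z = z.
Proof. by rewrite /clamp /Num.max /Num.min => ?; do ! case: ifP; lra. Qed.

Lemma clamp_continuous lo (T : topologicalType) (f : T -> R) :
  continuous f -> continuous (fun x => clamp lo (f x)).
Proof.
move=> cf x.
apply: (@continuous_max R T (fun=> lo) (fun x => Num.min 1 (f x)) x); first exact: cst_continuous.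
by apply: (@continuous_min R T (fun=> 1) f x); [exact: cst_continuous | exact: cf].
Qed.

Definition hat (z : R) := clamp 0 (2 - 4 * `|z|).

Lemma hat1 z : `|z| <= 1 / 4 -> hat z = 1.
Proof. by rewrite /hat /clamp /Num.max /Num.min => ?; do ! case: ifP; lra. Qed.

Lemma hat0 z : 1 / 2 <= `|z| -> hat z = 0.
Proof. by rewrite /hat /clamp /Num.max /Num.min => ?; do ! case: ifP; lra. Qed.

Lemma hat_continuous : continuous hat.
Proof.
apply: clamp_continuous => x.
apply: (@continuous_sub R R (fun=> 2) (fun z => 4 * `|z|) x); first exact: cst_continuous.
apply: (@continuous_mul R R (fun=> 4) (fun z => `|z|) x); first exact: cst_continuous.
exact: norm_continuous.
Qed.

Definition train (s c : nat -> R) n z := \sum_(m < n) s m * hat (z - c m).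

Lemma train_continuous s c n : continuous (train s c n).
Proof.
move=> x; rewrite /train; elim: n => [|n IH].
  rewrite (_ : (fun z => _) = cst 0); first exact: cst_continuous.
  by apply/funext => z; rewrite big_ord0.
rewrite (_ : (fun z => _) = (fun z => \sum_(m < n) s m * hat (z - c m) + s n * hat (z - c n))); last first.
  by apply/funext => z; rewrite big_ord_recr.
apply: (@continuous_add R R _ (fun z => s n * hat (z - c n)) x); first exact: IH.
apply: (@continuous_mul R R (fun=> s n) (fun z => hat (z - c n)) x); first exact: cst_continuous.
apply: (@continuous_compose R R (fun z : R => z - c n) hat x); last exact: hat_continuous.
by apply: (@continuous_sub R R id (fun=> c n) x); [exact: cvg_id | exact: cst_continuous].
Qed.

Lemma train_at s c n m z : (forall a b, a != b -> 1 <= `|c a - c b|) -> (m < n)%N ->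
  `|z - c m| <= 1 / 4 -> train s c n z = s m.
Proof.
move=> sep mn zm; rewrite /train (bigD1 (Ordinal mn)) //= hat1 // mulr1 big1 ?addr0 // => i im.
have im' : m != i by apply: contra im => /eqP E; rewrite -val_eqE /= E.
rewrite hat0 ?mulr0 //; have := sep _ _ im'; have := ler_distD z (c m) (c i).
by rewrite (distrC (c m) z); lra.
Qed.

Lemma train_off s c n z : (forall m, (m < n)%N -> 1 / 2 <= `|z - c m|) -> train s c n z = 0.
Proof. by move=> H; rewrite /train big1 // => i _; rewrite hat0 ?mulr0 //; exact: H. Qed.

End train.

Section checker.
Variables (R : realType) (d : nat).
Local Notation D := d.+2.
Variables (o : 'rV[R]_D) (t0 : R) (N' q : nat).
Local Notation N := (N'.*2).
Local Notation M := (4 * q)%N.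
Local Notation B := (N * M)%N.
Hypotheses (t0_gt0 : 0 < t0) (N'_gt0 : (0 < N')%N) (q_gt0 : (0 < q)%N).
Local Notation t := (scale N' q t0).
(** The slabs need a direction transversal to the wave; here the dimension being at least two
    enters. *)
Definition second : 'I_D := lift ord0 ord0.

Let l j := t j / N%:R.

(** In units of the piece length, field [m] is centred at [m + 1/2] and has the value [(-1) ^ m] on
    its middle half. The clamp makes the bound by 1 immediate. *)
Definition wave_sign j (y : R) :=
  clamp (-1) (train (fun m => (-1) ^+ m) (fun m => m%:R + 1 / 2) (N * B ^ j) ((y - o ord0 ord0) / (t j / N%:R))).

(** Slab [n] is the first of the [N] strips of the [n]-th cell in the second direction, hence the
    centre [N * n + 1/2]. The cutoff is 1 on its middle half and 0 off all slabs. *)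
Definition slab_cutoff j (y : R) :=
  clamp 0 (train (fun=> 1) (fun m => (N * m)%:R + 1 / 2) (B ^ j) ((y - o ord0 second) / (t j / N%:R))).

(* The wave of level [j] lives on slabs in the second coordinate that are as thin as
   one field; later levels overwrite earlier ones there, which changes the earlier
   levels only on a set of small proportion. *)
Fixpoint checker J (x : 'rV[R]_D) : R :=
  if J is j.+1 then
    (1 - slab_cutoff j (x ord0 second)) * checker j x +
    slab_cutoff j (x ord0 second) * wave_sign j (x ord0 ord0)
  else 0.

Definition slab j n : set R :=
  `]o ord0 second + n%:R * t j, o ord0 second + n%:R * t j + t j / N%:R[%classic.

Definition slabs j : set R := \big[setU/set0]_(n < B ^ j) slab j n.

(** Each level is a convex combination of the previous one and a wave. *)
Lemma checker_bound J x : `|checker J x| <= 1.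
Proof.
elim: J => [|j IH] /=; first by rewrite normr0.
have : 0 <= slab_cutoff j (x ord0 second) <= 1 by apply: clamp_bound.
have : -1 <= wave_sign j (x ord0 ord0) <= 1 by apply: clamp_bound; lra.
move: (slab_cutoff _ _) (wave_sign _ _) (checker j x) IH => u v w.
rewrite !ler_norml => /andP[w1 w2] /andP[v1 v2] /andP[u1 u2].
have : 0 <= (1 - u) * (1 - w) by rewrite mulr_ge0 // subr_ge0.
have : 0 <= (1 - u) * (1 + w) by rewrite mulr_ge0 //; lra.
have : 0 <= u * (1 - v) by rewrite mulr_ge0 // subr_ge0.
have : 0 <= u * (1 + v) by rewrite mulr_ge0 //; lra.
lra.
Qed.

(** The perturbed density has to stay in the space of continuous functions; therefore the fields
    have linear transitions instead of jumps. *)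
Lemma checker_continuous J : continuous (checker J).
Proof.
have aff (a b : R) : continuous (fun y : R => (y - a) / b).
  move=> y; apply: (@continuous_mul R R (fun y => y - a) (fun=> b^-1) y); last exact: cst_continuous.
  by apply: (@continuous_sub R R id (fun=> a) y); [exact: cvg_id | exact: cst_continuous].
have cs j : continuous (slab_cutoff j).
  apply: clamp_continuous => y.
  apply: (@continuous_compose R R (fun y : R => (y - o ord0 second) / (t j / N%:R)) (train _ _ _) y).
    exact: aff.
  exact: train_continuous.
have cw j : continuous (wave_sign j).
  apply: clamp_continuous => y.
  apply: (@continuous_compose R R (fun y : R => (y - o ord0 ord0) / (t j / N%:R)) (train _ _ _) y).
    exact: aff.
  exact: train_continuous.
have cc (f : R -> R) i : continuous f -> continuous (fun x : 'rV[R]_D => f (x ord0 i)).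
  move=> cf x; apply: (@continuous_compose R 'rV[R]_D (fun x : 'rV[R]_D => x ord0 i) f x).
    exact: coord_continuous.
  exact: cf.
elim: J => [|j IH]; first by move=> x; exact: cst_continuous.
move=> x; rewrite /=.
apply: (@continuous_add R 'rV[R]_D (fun x => (1 - slab_cutoff j (x ord0 second)) * checker j x)
  (fun x => slab_cutoff j (x ord0 second) * wave_sign j (x ord0 ord0)) x).
  apply: (@continuous_mul R 'rV[R]_D (fun x => 1 - slab_cutoff j (x ord0 second)) (checker j) x).
    apply: (@continuous_sub R 'rV[R]_D (fun=> 1) (fun x => slab_cutoff j (x ord0 second)) x).
      exact: cst_continuous.
    exact: cc.
  exact: IH.
apply: (@continuous_mul R 'rV[R]_D (fun x => slab_cutoff j (x ord0 second))
  (fun x => wave_sign j (x ord0 ord0)) x); exact: cc.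
Qed.

Let t_gt0 j : 0 < t j. Proof. exact: scale_gt0. Qed.
Let NR : (0 : R) < N%:R. Proof. by rewrite ltr0n double_gt0. Qed.
Let l_gt0 j : 0 < l j. Proof. by rewrite divr_gt0. Qed.

Lemma slab_cutoff_off j y : ~ slabs j y -> slab_cutoff j y = 0.
Proof.
move=> ny; rewrite /slab_cutoff train_off ?clamp_id ?lexx ?ler01 // => n nB.
rewrite leNgt; apply/negP => H; apply: ny.
rewrite /slabs -bigcup_mkord; exists n => //=; rewrite /slab /= in_itv /=.
have tN : t j = N%:R * l j by rewrite mulrC divfK // gt_eqF.
have -> : y = o ord0 second + (y - o ord0 second) / l j * l j by rewrite divfK ?gt_eqF // addrC subrK.
move: H; rewrite -/(l j) tN; move: ((y - _) / _) (l_gt0 j) => z l0; rewrite ltr_norml natrM => /andP[H1 H2].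
have : 0 < (z - N%:R * n%:R) * l j by apply: mulr_gt0 => //; lra.
have : 0 < (N%:R * n%:R + 1 - z) * l j by apply: mulr_gt0 => //; lra.
lra.
Qed.

Let sep_nat (a b : nat) : a != b -> 1 <= `|a%:R + 1 / 2 - (b%:R + 1 / 2)| :> R.
Proof.
have -> : a%:R + 1 / 2 - (b%:R + 1 / 2) = a%:R - b%:R :> R by ring.
by rewrite neq_ltn => /orP[]; rewrite -(ler_nat R) -natr1 ler_normr; lra.
Qed.

Lemma piece_index_lt n i j : (n < B ^ j)%N -> (i < N)%N -> (N * n + i < N * B ^ j)%N.
Proof.
move: (B ^ j)%N (N) => b N0 nb iN; apply: leq_trans (_ : N0 * n.+1 <= _)%N.
  by rewrite mulnS -addnS addnC leq_add2r.
by rewrite leq_mul2l nb orbT.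
Qed.

(** [N] is even, so field [i] has the same sign in all cells. *)
Lemma sign_even n i : (-1) ^+ (N * n + i) = (-1) ^+ i :> R.
Proof. by rewrite exprD exprM -muln2 mulnC exprM sqrrN expr1n !expr1n mul1r. Qed.

Lemma checker_piece J j n i x : (j < J)%N -> (forall r, (n r < B ^ j)%N) -> (i < N)%N ->
  box (piece_center o t0 N' q j n i) (t j / N%:R / 4) x ->
  (forall j', (j < j' < J)%N -> ~ slabs j' (x ord0 second)) ->
  checker J x = (-1) ^+ i.
Proof.
move=> jJ nB iN bx; elim: J jJ => // J IH; rewrite ltnS leq_eqVlt => /orP[/eqP <-|jJ] off /=.
  have tN : t j = N%:R * l j by rewrite mulrC divfK // gt_eqF.
  have xr r (z : R) : z * l j + o ord0 r = piece_center o t0 N' q j n i ord0 r ->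
      `|(x ord0 r - o ord0 r) / (t j / N%:R) - z| <= 1 / 4.
    move=> zE; have := le_trans (norm_coord _ r) bx.
    rewrite 2!mxE -zE -/(l j) => H.
    have -> : (x ord0 r - o ord0 r) / l j - z = (x ord0 r - (z * l j + o ord0 r)) / l j.
      by field; rewrite gt_eqF.
    rewrite normrM normfV (gtr0_norm (l_gt0 j)) ler_pdivrMr //; lra.
  have -> : slab_cutoff j (x ord0 second) = 1.
    rewrite /slab_cutoff (@train_at _ _ _ _ (n second)) ?clamp_id ?ler01 ?lexx //.
      move=> a b ab; apply: sep_nat; apply: contra ab; rewrite eqn_mul2l.
      by rewrite double_eq0 -leqn0 leqNgt N'_gt0.
    by apply: xr; rewrite !mxE -/(l j) mul0r addr0 natrM tN; ring.
  have -> : wave_sign j (x ord0 ord0) = (-1) ^+ i.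
    rewrite /wave_sign (@train_at _ _ _ _ (N * n ord0 + i)).
    - rewrite sign_even clamp_id //; rewrite -signr_odd; case: odd; rewrite ?expr1 ?expr0; lra.
    - exact: sep_nat.
    - exact: piece_index_lt.
    - by apply: xr; rewrite !mxE eqxx -/(l j) (natrD _ (N * n ord0) i) (natrM _ N) tN /=; ring.
  by rewrite subrr mul0r mul1r add0r.
rewrite slab_cutoff_off; last by apply: off; rewrite jJ /=.
rewrite subr0 mul1r mul0r addr0; apply: IH => // j' /andP[jj' j'J].
by apply: off; rewrite jj' ltnS ltnW.
Qed.

Lemma measurable_slabs j : measurable (slabs j).
Proof. by apply: bigsetU_measurable => n _; exact: measurable_itv. Qed.

Definition cells j (a b : nat) : set R :=
  `[o ord0 second + a%:R * t j, o ord0 second + b%:R * t j]%classic.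

(** The lattice of level [j'] refines that of level [j.+1], so an interval between two points of the
    latter consists of whole cells of level [j'], and the slabs take up the proportion [1 / N] of
    each. *)
Lemma slabs_in_cells j j' (a b : nat) : (j < j')%N ->
  (lebesgue_measure (cells j.+1 a b `&` slabs j') <=
    ((b - a)%:R * t j.+1 / N%:R)%:E)%E.
Proof.
move=> jj'; pose K := (B ^ (j' - j.+1))%N.
have B0 : (0 < B)%N by rewrite !muln_gt0 double_gt0 N'_gt0 q_gt0.
have tK : t j.+1 = K%:R * t j'.
  have BR e : (0 : R) < (B ^ e)%:R by rewrite ltr0n expn_gt0 B0.
  rewrite /scale /K -{2}(subnK jj') expnD [in RHS]natrM; field.
  by rewrite !gt_eqF.
pose F m : set R := `]o ord0 second + (a * K + m)%:R * t j', o ord0 second + (a * K + m)%:R * t j' + l j'[%classic.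
have sub : cells j.+1 a b `&` slabs j' `<=`
    \big[setU/set0]_(m < ((b - a) * K)%N) F m.
  move=> y []; rewrite /cells /= in_itv /= => /andP[y1 y2].
  rewrite /slabs -bigcup_mkord => -[n _] /=; rewrite /slab /= in_itv /= => /andP[yn1 yn2].
  have lt' : l j' <= t j'.
    by rewrite /l ler_pdivrMr // ler_peMr ?(ltW (t_gt0 _)) // ler1n double_gt0.
  have t'0 := t_gt0 j'.
  have n1 : (a * K < n.+1)%N.
    rewrite -(ltr_nat R) -(ltr_pM2r t'0) natrM -natr1 -mulrA -tK.
    by move: yn2; rewrite -/(l j'); lra.
  have n2 : (n < b * K)%N.
    by rewrite -(ltr_nat R) -(ltr_pM2r t'0) natrM -mulrA -tK; lra.
  rewrite -bigcup_mkord; exists (n - a * K)%N => /=.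
    by rewrite mulnBl ltn_sub2r // (leq_ltn_trans _ n2).
  by rewrite /F /= subnKC // in_itv /= yn1 yn2.
have mF m : measurable (F m) by exact: measurable_itv.
have mX : measurable (cells j.+1 a b `&` slabs j').
  by apply: measurableI; [exact: measurable_itv | exact: measurable_slabs].
have mY : measurable (\big[setU/set0]_(m < ((b - a) * K)%N) F m).
  by apply: bigsetU_measurable => m _; exact: mF.
apply: le_trans (le_measure lebesgue_measure (mem_set mX) (mem_set mY) sub) _.
apply: le_trans (@Boole_inequality _ R _ lebesgue_measure F _ (fun m _ => mF m)) _.
rewrite (eq_bigr (fun=> (l j')%:E)) => [|m _]; last first.
  rewrite [LHS]lebesgue_measure_itv /= lte_fin ltrDl l_gt0 -EFinD; congr EFin; ring.
rewrite sumEFin sumr_const card_ord lee_fin -[leLHS]mulr_natl natrM tK /l.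
by rewrite le_eqVlt; apply/orP; left; apply/eqP; ring.
Qed.

(** Only the second coordinate is restricted, so the measure factors; each of the at most [J] finer
    levels takes at most the proportion [1 / N] of that side. *)
Lemma finer_slabs_in_piece J j n i : (j < J)%N ->
  (lebesgue_rV R D (box (piece_center o t0 N' q j n i) (t j / N%:R / 4) `&`
     [set x | exists2 j', (j < j' < J)%N & slabs j' (x ord0 second)]) <=
   (J%:R / N%:R * (t j / N%:R / 2) ^+ D)%:E)%E.
Proof.
move=> jJ; set c := piece_center _ _ _ _ _ _ _.
pose I r : set R := `[c ord0 r - l j / 4, c ord0 r + l j / 4]%classic.
pose E : set R := \big[setU/set0]_(j' < J) (if (j < j')%N then slabs j' else set0).
have mE : measurable E.
  by apply: bigsetU_measurable => j' _; case: ifP => // _; exact: measurable_slabs.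
pose A r : set R := if r == second then I r `&` E else I r.
have mI r : measurable (I r) by exact: measurable_itv.
have mA r : measurable (A r) by rewrite /A; case: ifP => _; [exact: measurableI | exact: mI].
have l4 : 0 <= l j / 4 by rewrite divr_ge0 // ltW.
have -> : box c (t j / N%:R / 4) `&` [set x | exists2 j', (j < j' < J)%N & slabs j' (x ord0 second)] =
    [set x | forall r, A r (x ord0 r)].
  rewrite boxE //; apply/seteqP; split => x /= => [[bx [j' /andP[jj' j'J] xj']] r|Ax].
    rewrite /A; case: eqP => [->|_]; last exact: bx.
    split; first exact: bx.
    by rewrite /E -(bigcup_mkord J (fun j' => if (j < j')%N then slabs j' else set0)); exists j'; rewrite //= jj'.
  split=> [r|]; first by have := Ax r; rewrite /A; case: ifP => // _ [].
  have := Ax second; rewrite /A eqxx => -[_].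
  rewrite /E -(bigcup_mkord J (fun j' => if (j < j')%N then slabs j' else set0)) => -[j' /= j'J].
  by case: ifP => // jj' xj'; exists j' => //; rewrite jj'.
rewrite lebesgue_rV_box //.
have lI r : lebesgue_measure (I r) = (l j / 2)%:E.
  rewrite lebesgue_measure_itv /= lte_fin ifT; last by have := l_gt0 j; lra.
  by rewrite -EFinD; congr EFin; field.
rewrite (bigD1 second) //= {1}/A eqxx.
have -> : (\prod_(r < D | r != second) lebesgue_measure (A r) = ((l j / 2) ^+ d.+1)%:E)%E.
  rewrite (eq_bigr (fun=> (l j / 2)%:E)) => [|r /negbTE rs]; last by rewrite /A rs lI.
  rewrite prodEFin prodr_const; congr (EFin (_ ^+ _)).
  by have := cardC1 second; rewrite card_ord.
have IE : (lebesgue_measure (I second `&` E) <= (J%:R / N%:R * (l j / 2))%:E)%E.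
  have -> : I second `&` E = \big[setU/set0]_(j' < J) (if (j < j')%N then I second `&` slabs j' else set0).
    rewrite /E big_distrr /=; apply: eq_bigr => j' _; case: ifP => // _; exact: setI0.
  have mIE j' : measurable (if (j < j')%N then I second `&` slabs j' else set0).
    by case: ifP => _; [apply: measurableI; [exact: mI | exact: measurable_slabs] | exact: measurable0].
  apply: le_trans (@Boole_inequality _ R _ lebesgue_measure
    (fun j' => if (j < j')%N then I second `&` slabs j' else set0) _ (fun j' _ => mIE j')) _.
  apply: le_trans (_ : (\sum_(j' < J) (l j / 2 / N%:R)%:E <= _)%E); last first.
    rewrite sumEFin sumr_const card_ord lee_fin -[leLHS]mulr_natl.
    by rewrite le_eqVlt; apply/orP; left; apply/eqP; ring.
  apply: lee_sum => j' _; case: ifP => [jj'|_]; last by rewrite measure0 lee_fin !divr_ge0 // ltW.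
  have tS : t j = t j.+1 * B%:R by exact: scaleS.
  have lq : l j / 4 = q%:R * t j.+1.
    rewrite /l tS (natrM _ N M) natrM; field; rewrite gt_eqF //.
  (* The side of the half-size box runs between the lattice points [B * n + q] and [B * n + 3 * q]
     of the next level. *)
  have := @slabs_in_cells j j' (B * n second + q)%N (B * n second + 3 * q)%N jj'.
  have -> : (B * n second + 3 * q - (B * n second + q))%N = (2 * q)%N.
    by rewrite subnDl -[X in (_ - X)%N]mul1n -mulnBl.
  have -> : cells j.+1 (B * n second + q)%N (B * n second + 3 * q)%N = I second.
    have cE : c ord0 second = o ord0 second + (t j * (n second)%:R + l j / 2).
      by rewrite /c !mxE mul0r addr0.
    have e1 : c ord0 second - l j / 4 = o ord0 second + (B * n second + q)%:R * t j.+1.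
      by rewrite cE (natrD _ (B * _)) (natrM _ B) mulrDl -lq tS; field.
    have e2 : c ord0 second + l j / 4 = o ord0 second + (B * n second + 3 * q)%:R * t j.+1.
      rewrite cE (natrD _ (B * _)) (natrM _ B) (natrM _ 3) mulrDl -[3%:R * _ * _]mulrA -lq tS.
      by field.
    by rewrite /cells /I e1 e2.
  move/le_trans; apply; rewrite lee_fin (natrM _ 2) -[2%:R * _ * _]mulrA -lq.
  by rewrite le_eqVlt; apply/orP; left; apply/eqP; field; rewrite gt_eqF.
apply: le_trans (_ : (J%:R / N%:R * (l j / 2))%:E * ((l j / 2) ^+ d.+1)%:E <= _)%E.
  by apply: lee_pmul => //; rewrite lee_fin exprn_ge0 // divr_ge0 // ltW.
by rewrite -EFinM lee_fin (exprS _ d.+1) [leRHS]mulrA lexx.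
Qed.

End checker.

(** * Solutions and their images *)

Section measurable_preimage.
Variables (R : realType) (n m : nat).

Lemma measurable_within_continuous (S : set 'rV[R]_n) (h : 'rV[R]_n -> R) :
  compact S -> {within S, continuous h} -> measurable_fun S (h : _ -> measurableTypeR R).
Proof.
move=> cS /subspace_continuousP ch mS; apply: (measurability _ (RGenCInfty.measurableE R)) => //.
move=> _ [_ [x ->] <-]; apply: closed_measurable_rV => z clz.
have clS : closed S by apply: compact_closed => //; exact: norm_hausdorff.
have Sz : S z by apply: clS => U /clz[y [[Sy _] Uy]]; exists y.
split => //=; rewrite in_itv /= andbT leNgt; apply/negP => hx.
have e0 : 0 < x - h z by rewrite subr_gt0.
have /cvgrPdist_lt/(_ _ e0)/nbhs_ballP[dl /= dl0 H] := ch _ Sz.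
have [y [[Sy hy] zy]] := clz _ (nbhsx_ballx z dl dl0).
move: (H y zy Sy) hy; rewrite ltr_norml /= in_itv /= andbT => /andP[h1 _] h2; rewrite /from_subspace in h1; lra.
Qed.

Lemma measurable_ucont (S : set 'rV[R]_n) (h : 'rV[R]_n -> 'rV[R]_m) Y :
  compact S -> ucont S h -> measurable Y -> measurable (S `&` h @^-1` Y).
Proof.
move=> cS uh mY; have mS := compact_measurable_rV cS.
pose H x := if x \in S then h x else 0.
have mH : measurable_fun setT H.
  apply/measurable_fun_rVP => i.
  have -> : (fun x => H x ord0 i) = (fun x => if x \in S then h x ord0 i else 0).
    by apply/funext => x; rewrite /H; case: ifP; rewrite ?mxE.
  apply: measurable_fun_if => //.
  - apply: (measurable_fun_bool true); rewrite setTI.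
    by rewrite (_ : _ @^-1` _ = S) //; apply/seteqP; split => x; [exact: set_mem | exact: mem_set].
  - rewrite setTI (_ : _ @^-1` _ = S); last first.
      by apply/seteqP; split => x; [exact: set_mem | exact: mem_set].
    apply: measurable_within_continuous => //; apply: ucont_within => e e0.
    have [dl dl0 Hd] := uh _ e0.
    exists dl => // x y Sx Sy xy; apply: le_lt_trans (Hd _ _ Sx Sy xy).
    by have := norm_coord (h x - h y) i; rewrite !mxE.
rewrite (_ : _ `&` _ = S `&` H @^-1` Y).
  by apply: measurableI => //; have := mH measurableT _ mY; rewrite setTI.
by apply/seteqP; split => x [Sx] /=; rewrite /H mem_set.
Qed.

End measurable_preimage.

Section solution.
Variables (R : realType) (n : nat).
Local Notation L := (lebesgue_rV R n).
Local Notation cube := (cube R n).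
Implicit Types (f g : 'rV[R]_n -> 'rV[R]_n) (rho : 'rV[R]_n -> R).

Definition topological_solution rho f g := [/\ ucont cube f, ucont (f @` cube) g,
  {in cube, cancel f g} & pushforward_equation rho f].

Variables (rho : 'rV[R]_n -> R) (f g : 'rV[R]_n -> 'rV[R]_n).
Hypothesis mrho : measurable_fun setT rho.
Hypothesis sol : topological_solution rho f g.

Let compact_image : compact (f @` cube).
Proof. by have [uf _ _ _] := sol; apply: compact_ucont_image => //; exact: cube_compact. Qed.

Let image_cubeE B : f @` (cube `&` B) = f @` cube `&` g @^-1` B.
Proof.
have [_ _ fK _] := sol; apply/seteqP; split => [_ [x [cx Bx] <-]|_ [[x cx <-] /= Bx]].
  by split; [exists x | rewrite /= fK // inE].
by exists x => //; split => //; rewrite fK ?inE // in Bx.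
Qed.

Lemma measurable_image B : measurable B -> measurable (f @` (cube `&` B)).
Proof.
by have [_ ug _ _] := sol; move=> mB; rewrite image_cubeE; exact: measurable_ucont.
Qed.

(** The equation is applied to the image itself. It is Borel, being the preimage of [B] under the
    continuous inverse on a compact set, and by injectivity its own preimage in the cube is the
    given set. *)
Lemma image_measure B : measurable B ->
  L (f @` (cube `&` B)) = (\int[L]_(x in cube `&` B) (rho^\+ x)%:E
                           - \int[L]_(x in cube `&` B) (rho^\- x)%:E)%E.
Proof.
have [_ _ fK eqn] := sol; move=> mB.
have := eqn _ (measurable_image mB); rewrite /signed_pushforward /pushforward /density.
have -> : cube `&` f @^-1` (f @` (cube `&` B)) = cube `&` B.
  apply/seteqP; split => [x [cx [y [cy By] /= fxy]]|x [cx Bx]]; last by split => //; exists x.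
  split => //; suff <- : y = x by [].
  by rewrite -[LHS]fK ?inE // fxy fK ?inE.
move->; congr (L _); apply/seteqP; split => [y [x [cx Bx] <-]|y [[x [cx Bx] <-] _]].
  by split; exists x.
by exists x.
Qed.

Let mcB B : measurable B -> measurable (cube `&` B).
Proof. by move=> mB; apply: measurableI => //; exact: measurable_cube. Qed.

Let mpos B : measurable_fun B (fun x => (rho^\+ x)%:E).
Proof. by apply/measurable_EFinP; apply: measurable_funTS; exact: measurable_funrpos. Qed.

Let mneg B : measurable_fun B (fun x => (rho^\- x)%:E).
Proof. by apply/measurable_EFinP; apply: measurable_funTS; exact: measurable_funrneg. Qed.

(** The image of the set where [rho < 0] has as its measure minus the integral of the negative part.
    Measures being nonnegative, this integral vanishes. *)
Lemma solution_ge0 : {ae L, forall x, cube x -> 0 <= rho x}.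
Proof.
pose B := [set x | rho x < 0].
have mB : measurable B.
  rewrite (_ : B = rho @^-1` `]-oo, 0[%classic).
    by rewrite -[X in measurable X]setTI; exact: mrho.
  by apply/seteqP; split => x /=; rewrite in_itv.
have := image_measure mB.
rewrite [X in (X - _)%E]integral0_eq; last first.
  by move=> x [_ /=]; rewrite /B /= => x0; rewrite /funrpos max_r // ltW.
rewrite sub0e => H.
have neg0 : (\int[L]_(x in cube `&` B) (rho^\- x)%:E = 0)%E.
  apply/eqP; rewrite eq_le; apply/andP; split; last first.
    by apply: integral_ge0 => x _; rewrite lee_fin /funrneg le_max lexx orbT.
  have : (0 <= L (f @` (cube `&` B)))%E by [].
  by rewrite H oppe_ge0.
have /(ae_eq_integral_abs L (mcB mB) (@mneg _)) :
    (\int[L]_(x in cube `&` B) `|(rho^\- x)%:E| = 0)%E.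
  rewrite -[RHS]neg0; apply: eq_integral => x _.
  by rewrite gee0_abs // lee_fin /funrneg le_max lexx orbT.
apply: filterS => x Hx cx; rewrite leNgt; apply/negP => x0.
have := Hx (conj cx x0); rewrite /funrneg => -[]; rewrite max_l; first by move/eqP; rewrite oppr_eq0 lt_eqF.
by rewrite oppr_ge0 ltW.
Qed.

Lemma image_measure_ge0 B : measurable B ->
  L (f @` (cube `&` B)) = (\int[L]_(x in cube `&` B) (rho^\+ x)%:E)%E.
Proof.
move=> mB; rewrite image_measure // [X in (_ - X)%E](_ : _ = 0%E) ?sube0 //.
rewrite (@ae_eq_integral _ _ _ L (cube `&` B) (cst 0%E)) ?integral0 //; first exact: mcB.
apply: filterS solution_ge0 => x Hx [cx _] /=.
by rewrite /funrneg max_r // oppr_le0 Hx.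
Qed.

End solution.

Section compare.
Variables (R : realType) (n : nat).
Local Notation L := (lebesgue_rV R n).
Local Notation cube := (cube R n).
Variables (rho0 rho : 'rV[R]_n -> R) (f0 g0 f g : 'rV[R]_n -> 'rV[R]_n).
Hypothesis (mrho0 : measurable_fun setT rho0) (mrho : measurable_fun setT rho).
Hypothesis (sol0 : topological_solution rho0 f0 g0) (sol : topological_solution rho f g).

Lemma image_measure_le c B : 0 <= c -> measurable B ->
  {ae L, forall x, (cube `&` B) x -> rho x <= c * rho0 x} ->
  (L (f @` (cube `&` B)) <= c%:E * L (f0 @` (cube `&` B)))%E.
Proof.
move=> c0 mB H; rewrite (image_measure_ge0 mrho sol mB) (image_measure_ge0 mrho0 sol0 mB).
have mcB : measurable (cube `&` B) by apply: measurableI => //; exact: measurable_cube.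
have mp (r : 'rV[R]_n -> R) : measurable_fun setT r -> measurable_fun (cube `&` B) (fun x => (r^\+ x)%:E).
  by move=> mr; apply/measurable_EFinP; apply: measurable_funTS; exact: measurable_funrpos.
have pos (r : 'rV[R]_n -> R) (x : 'rV[R]_n) : (0 <= (r^\+ x)%:E)%E by rewrite lee_fin /funrpos le_max lexx orbT.
rewrite -ge0_integralZl_EFin //; last exact: mp.
apply: ae_ge0_le_integral => //; first exact: mp.
- by move=> x _; rewrite mule_ge0 // lee_fin.
- by apply: measurable_funeM; exact: mp.
apply: filterS H => x Hx xB; rewrite -EFinM lee_fin /funrpos.
have := Hx xB; case: (leP (rho0 x) 0) => r0 H.
  rewrite mulr0 ge_max lexx andbT; apply: le_trans H _; exact: mulr_ge0_le0.
by rewrite ge_max H mulr_ge0 // ltW.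
Qed.

End compare.

Section transfer.
Variables (R : realType) (n : nat).
Local Notation L := (lebesgue_rV R n).
Local Notation cube := (cube R n).
Variables (rho0 rho : 'rV[R]_n -> R) (f0 g0 f g1 : 'rV[R]_n -> 'rV[R]_n).
Hypothesis (mrho0 : measurable_fun setT rho0) (mrho : measurable_fun setT rho).
Hypothesis (sol0 : topological_solution rho0 f0 g0) (sol : topological_solution rho f g1).
Let g := f \o g0.

Let preimage_measurable S : measurable S -> measurable (cube `&` f0 @^-1` S).
Proof.
by have [u0 _ _ _] := sol0; move=> mS; apply: measurable_ucont => //; exact: cube_compact.
Qed.

Let image_f0 S : S `<=` f0 @` cube -> f0 @` (cube `&` (cube `&` f0 @^-1` S)) = S.
Proof.
move=> Ss; apply/seteqP; split => [_ [x [_ [_ Sx]] <-] //|y Sy].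
by have [x cx xy] := Ss _ Sy; exists x => //; rewrite /= xy.
Qed.

Let image_f S : S `<=` f0 @` cube -> f @` (cube `&` (cube `&` f0 @^-1` S)) = g @` S.
Proof.
have [_ _ fK _] := sol0; move=> Ss; apply/seteqP; split => [_ [x [_ [cx Sx]] <-]|_ [y Sy <-]].
  by exists (f0 x) => //; rewrite /g /= fK // inE.
have [x cx xy] := Ss _ Sy; exists x; first by rewrite /= xy.
by rewrite /g /= -xy fK // inE.
Qed.

Lemma measurable_transfer S : S `<=` f0 @` cube -> measurable S -> measurable (g @` S).
Proof.
by move=> Ss mS; rewrite -image_f //; apply: (measurable_image sol); exact: preimage_measurable.
Qed.

(** In the sense of measures, the Jacobian of [g] is the ratio [rho / rho0] read through [f0]; a
    bound for the ratio bounds the volumes of images. *)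
Lemma transfer_le c S : 0 <= c -> S `<=` f0 @` cube -> measurable S ->
  {ae L, forall x, cube x -> S (f0 x) -> rho x <= c * rho0 x} ->
  (L (g @` S) <= c%:E * L S)%E.
Proof.
move=> c0 Ss mS H; rewrite -image_f // -[in leRHS](image_f0 Ss).
apply: (image_measure_le mrho0 mrho sol0 sol) => //; first exact: preimage_measurable.
by apply: filterS H => x Hx [_ [cx Sx]]; exact: Hx.
Qed.

Lemma transfer_ge c S : 0 <= c -> S `<=` f0 @` cube -> measurable S ->
  {ae L, forall x, cube x -> S (f0 x) -> rho0 x <= c * rho x} ->
  (L S <= c%:E * L (g @` S))%E.
Proof.
move=> c0 Ss mS H; rewrite -image_f // -[in leLHS](image_f0 Ss).
apply: (image_measure_le mrho mrho0 sol sol0) => //; first exact: preimage_measurable.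
by apply: filterS H => x Hx [_ [cx Sx]]; exact: Hx.
Qed.

Lemma ucont_transfer S : S `<=` f0 @` cube -> ucont S g.
Proof.
have [_ ug0 fK _] := sol0; have [uf _ _ _] := sol; move=> Ss e e0.
have [a a0 Ha] := uf _ e0; have [b b0 Hb] := ug0 _ a0.
exists b => // x y Sx Sy xy; rewrite /g /=.
have cg z : S z -> cube (g0 z) by move=> /Ss[u cu <-]; rewrite fK ?inE.
by apply: Ha; [exact: cg|exact: cg|]; apply: Hb => //; exact: Ss.
Qed.

Lemma ucont_transfer_inv S : S `<=` f0 @` cube -> forall e, 0 < e -> exists2 k, 0 < k &
  forall x y, S x -> S y -> `|g x - g y| < k -> `|x - y| < e.
Proof.
have [u0 _ fK0 _] := sol0; have [_ ug fK _] := sol; move=> Ss e e0.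
have [a a0 Ha] := u0 _ e0; have [b b0 Hb] := ug _ a0.
exists b => // x y /Ss[x' cx <-] /Ss[y' cy <-]; rewrite /g /= !fK0 ?inE // => xy.
apply: Ha => //; rewrite -(fK x') ?inE // -(fK y') ?inE //.
by apply: Hb.
Qed.

End transfer.

Section no_solution.
Variables (R : realType) (d : nat).
Local Notation D := d.+2.
Local Notation L := (lebesgue_rV R D).
Local Notation cube := (cube R D).
Variables (o : 'rV[R]_D) (t0 : R) (N' q J : nat) (Lam c0 k tau : R).
Variables (rho0 rho : 'rV[R]_D -> R) (f0 g0 f g1 : 'rV[R]_D -> 'rV[R]_D).
Hypothesis (mrho0 : measurable_fun setT rho0) (mrho : measurable_fun setT rho).
Hypothesis (sol0 : topological_solution rho0 f0 g0) (sol : topological_solution rho f g1).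
Let g := f \o g0.
Local Notation N := (N'.*2).
Local Notation M := (4 * q)%N.
Hypotheses (t0_gt0 : 0 < t0) (N'_gt0 : (0 < N')%N) (q_gt0 : (0 < q)%N)
  (Lam_gt0 : 0 < Lam) (c0_gt0 : 0 < c0) (k_ge0 : 0 <= k).
Local Notation t := (scale N' q t0).
Local Notation axis := (axis R d).
Local Notation Q := (cubeQ o t0).
Hypothesis Q_image : Q `<=` f0 @` cube.
Hypothesis g_upper : forall s x y, t J <= s -> Q x -> Q y -> `|x - y| <= s ->
  enorm (g x - g y) <= Lam * s.
Hypothesis g_lower : c0 * t0 <= enorm (g (o + t0 *: axis) - g o).
Hypothesis growth : Lam < (1 + J%:R * k) * c0.
Hypothesis flat : k ^+ 2 + 2 * ((M ^ D)%:R * (2 * k + 2 * Lam / (c0 * N'%:R))) <= (2 * q%:R) ^- 2.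
Hypothesis thin : J%:R / N%:R <= tau / 8.
Hypothesis sharp : D%:R * (40 * Lam) ^+ D < tau * q%:R.
Hypothesis tau_range : 0 < tau <= 1 / 4.
Hypothesis rho_near : {ae L, forall x, cube x ->
  `|rho x - rho0 x * (1 + tau * checker o t0 N' q J (f0 x))| <= tau / 8 * rho0 x}.

Let piece j n i := box (piece_center o t0 N' q j n i) (t j / N%:R / 4).
Let finer j := [set x : 'rV[R]_D | exists2 j', (j < j' < J)%N & slabs o t0 N' q j' (x ord0 (second d))].

Let measurable_finer j : measurable (finer j).
Proof.
rewrite (_ : finer j = \bigcup_j' (if (j < j' < J)%N then
    (fun x : 'rV[R]_D => x ord0 (second d)) @^-1` slabs o t0 N' q j' else set0)).
  apply: bigcup_measurable => j' _; case: ifP => // _.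
  rewrite -[X in measurable X]setTI; apply: measurable_coord => //.
  exact: measurable_slabs.
apply/seteqP; split => [x [j' jj' sx]|x [j' _]]; first by exists j' => //; rewrite jj'.
by case: ifP => // jj' sx; exists j'.
Qed.

(** The image of the positive field has volume at least [(1 + 3/4 tau) V] up to a term in [tau ^ 2],
    that of the negative field at most [(1 - 5/8 tau) V]. The gap exceeds [tau * V], and by [sharp]
    the error in [volume_almost_preserved] is less than that. *)
Lemma no_checker_solution : False.
Proof.
have [j [n [i [jJ nB iN' vol]]]] := volume_almost_preserved t0_gt0 N'_gt0 q_gt0 Lam_gt0 c0_gt0 k_ge0
  g_upper g_lower growth flat (ucont_transfer sol0 sol Q_image) (ucont_transfer_inv sol0 sol Q_image).
move: vol => /=; set l := t j / N%:R => vol.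
have l0 : 0 < l by rewrite divr_gt0 ?scale_gt0 // ltr0n double_gt0.
have [tau0 tau1] := andP tau_range.
have i2N : (i.*2.+1 < N)%N by have := double_succ_le iN'; rewrite addn2.
pose V := (l / 2) ^+ D; have V0 : 0 < V by rewrite exprn_gt0 // divr_gt0.
have pE i' : L (piece j n i') = V%:E.
  have l4 : 0 <= l / 4 by rewrite divr_ge0 // ltW.
  rewrite /piece -/l (lebesgue_box _ l4) /V; have -> : 2 * (l / 4) = l / 2 by field.
  by [].
have pm i' : measurable (piece j n i') by exact: measurable_box.
have fm := measurable_finer j.
have pQ i' : (i' < N)%N -> piece j n i' `<=` Q.
  by move=> i'N x; exact: (piece_in_cube t0_gt0 N'_gt0 q_gt0 nB i'N).
have pF i' : (L (piece j n i' `&` finer j) <= (tau / 8 * V)%:E)%E.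
  apply: le_trans (finer_slabs_in_piece o t0_gt0 N'_gt0 q_gt0 n i' jJ) _.
  by rewrite lee_fin; apply: ler_wpM2r => //; exact: ltW.
have near_piece i' s : (i' < N)%N -> (-1) ^+ i' = s -> {ae L, forall x, cube x ->
    (piece j n i' `\` finer j) (f0 x) ->
    `|rho x - rho0 x * (1 + tau * s)| <= tau / 8 * rho0 x}.
  move=> i'N <-; apply: filterS rho_near => x Hx cx [px nfx]; have := Hx cx.
  rewrite (@checker_piece _ _ o t0 N' q t0_gt0 N'_gt0 q_gt0 J j n i') //.
  by move=> j' jj' sx; apply: nfx; exists j'.
set A := piece j n i.*2; set A' := piece j n i.*2.+1.
have AQ : A `<=` f0 @` cube by apply: subset_trans Q_image; apply: pQ; exact: ltnW.
have A'Q : A' `<=` f0 @` cube by apply: subset_trans Q_image; exact: pQ.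
have lower : (((1 + 7 / 8 * tau) * (1 - tau / 8) * V)%:E <= L (g @` A))%E.
  have c1 : 0 < 1 + 7 / 8 * tau by lra.
  have ADQ : A `\` finer j `<=` f0 @` cube by apply: subset_trans AQ => x [].
  have mAD : measurable (A `\` finer j) by exact: measurableD (pm _) fm.
  have H : (L (A `\` finer j) <= ((1 + 7 / 8 * tau)^-1)%:E * L (g @` (A `\` finer j)))%E.
    apply: (transfer_ge mrho0 mrho sol0 sol) => //; first by rewrite invr_ge0 ltW.
    apply: filterS (near_piece _ 1 (ltnW i2N) _) => [x Hx cx Ax|]; last first.
      by rewrite -signr_odd odd_double expr0.
    have := Hx cx Ax; rewrite ler_norml => /andP[h1 h2].
    rewrite ler_pdivlMl //; lra.
  have H2 : (L (g @` (A `\` finer j)) <= L (g @` A))%E.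
    have m1 := measurable_transfer sol0 sol ADQ mAD.
    have m2 := measurable_transfer sol0 sol AQ (pm _).
    by apply: (le_measure L (mem_set m1) (mem_set m2)) => _ [x [Ax _] <-]; exists x.
  have H3 : (((1 - tau / 8) * V)%:E <= L (A `\` finer j))%E.
    have H4 : (V%:E <= (tau / 8 * V)%:E + L (A `\` finer j))%E.
      rewrite -(pE i.*2); apply: le_trans (measure_le_setD L (pm _) (measurableI _ _ (pm i.*2) fm)) _.
      have -> : piece j n i.*2 `\` (piece j n i.*2 `&` finer j) = A `\` finer j.
        by rewrite setDIr setDv set0U.
      apply: leeD2r; exact: pF.
    have -> : ((1 - tau / 8) * V)%:E = (V%:E - (tau / 8 * V)%:E)%E by rewrite -EFinB; congr EFin; ring.
    by rewrite leeBlDl.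
  have : (((1 - tau / 8) * V)%:E <= ((1 + 7 / 8 * tau)^-1)%:E * L (g @` A))%E.
    apply: le_trans H3 (le_trans H _); apply: lee_wpmul2l H2.
    by rewrite lee_fin invr_ge0 ltW.
  rewrite (muleC ((_)^-1)%:E) (lee_pdivlMr _ _ c1) -EFinM => H5; apply: le_trans H5; rewrite lee_fin le_eqVlt.
  by apply/orP; left; apply/eqP; ring.
have upper : (L (g @` A') <= ((1 - 7 / 8 * tau) * V + 2 * (tau / 8 * V))%:E)%E.
  have ADQ : A' `\` finer j `<=` f0 @` cube by apply: subset_trans A'Q => x [].
  have AIQ : A' `&` finer j `<=` f0 @` cube by apply: subset_trans A'Q => x [].
  have mAD : measurable (A' `\` finer j) by exact: measurableD (pm _) fm.
  have mAI : measurable (A' `&` finer j) by exact: measurableI (pm _) fm.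
  have -> : g @` A' = g @` (A' `\` finer j) `|` g @` (A' `&` finer j).
    rewrite -image_setU; congr (_ @` _); rewrite setDE -setIUr.
    by rewrite setUC setUv setIT.
  have m1 := measurable_transfer sol0 sol ADQ mAD.
  have m2 := measurable_transfer sol0 sol AIQ mAI.
  apply: le_trans (measureU2 L m1 m2) _; rewrite EFinD; apply: leeD.
    apply: le_trans (transfer_le mrho0 mrho sol0 sol (c := 1 - 7 / 8 * tau) _ ADQ mAD _) _; first lra.
      apply: filterS (near_piece _ (-1) i2N _) => [x Hx cx Ax|]; last first.
        by rewrite -signr_odd /= odd_double expr1.
      have := Hx cx Ax; rewrite ler_norml => /andP[h1 h2]; lra.
    rewrite EFinM; apply: lee_wpmul2l; first by rewrite lee_fin; lra.
    rewrite -(pE i.*2.+1); apply: (le_measure L (mem_set mAD) (mem_set (pm _))) => x [] //.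
  (* On the finer slabs the value of the checkerboard is not known and only the ratio 2 is
     available; [thin] keeps their volume below [tau / 8 * V]. *)
  apply: le_trans (transfer_le mrho0 mrho sol0 sol (c := 2) _ AIQ mAI _) _ => //.
    apply: filterS rho_near => x Hx cx _; have := Hx cx.
    have := checker_bound o t0 N' q J (f0 x); move: (checker _ _ _ _ _ _) => s.
    rewrite !ler_norml => /andP[s1 s2] /andP[h1 h2].
    have r0 : 0 <= rho0 x by nra.
    have : 0 <= rho0 x * (tau * (1 - s)) by rewrite !mulr_ge0 // ?(ltW tau0) // subr_ge0.
    nra.
  by rewrite EFinM; apply: lee_wpmul2l; [|exact: pF].
have err : D%:R * (20 * Lam * l) ^+ D / q%:R < tau * V.
  have -> : 20 * Lam * l = 40 * Lam * (l / 2) by field.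
  rewrite exprMn -/V mulrA mulrAC ltr_pM2r // ltr_pdivrMr ?ltr0n //.
have := le_trans lower (le_trans vol (leeD upper (lexx _))).
rewrite -EFinD lee_fin; apply/negP; rewrite -ltNge.
have t2 : tau * tau <= tau / 4 by rewrite ler_pM2l //; lra.
have : tau * tau * V <= tau / 4 * V by rewrite ler_pM2r.
have : 0 < tau * V by rewrite mulr_gt0.
move: err; lra.
Qed.

End no_solution.

(** * Choice of the parameters *)

Lemma nat_above (R : realType) (x : R) : exists2 n : nat, (0 < n)%N & x < n%:R.
Proof. by exists (Num.truncn x).+1 => //; exact: truncnS_gt. Qed.

Section parameters.
Variable R : realType.

(* With [q ~ lam^D], [1/k ~ q^(D+2)] and [J, N' ~ lam / k], the logarithm of the
   smallest scale is at most a constant times [lam^(degree D)]. *)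
Definition degree (D : nat) := (D * (D + 2) + 2)%N.
Definition critical_exponent (D : nat) : R := (4 * (degree D)%:R)^-1.

Lemma critical_exponent_gt0 D : 0 < critical_exponent D.
Proof. by rewrite invr_gt0 mulr_gt0 // ltr0n /degree addn2. Qed.

Lemma critical_exponent_le1 D : critical_exponent D <= 1.
Proof.
rewrite invf_le1; last by rewrite mulr_gt0 // ltr0n /degree addn2.
have : (1 : R) <= (degree D)%:R by rewrite ler1n /degree addn2.
lra.
Qed.

Lemma ln_le_id (x : R) : 0 < x -> ln x <= x.
Proof.
move=> x0; have H : -1 < x - 1 by lra.
by have := le_ln1Dx H; rewrite [1 + _]addrC subrK; lra.
Qed.

(* The scale [(B0 m^(2e))^-J] with [J = A m^(2p)] costs only [m^(1/2)] in the
   modulus of continuity. *)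
Lemma log_power_bound (D A B0 e : nat) (E U : R) : (0 < D)%N -> (0 < A)%N -> (0 < B0)%N -> 0 <= U ->
  exists2 m : nat, (0 < m)%N &
  E * (Num.max 0 (U + 2 * ((A * (m ^ 2) ^ (degree D).-1)%:R * ln (B0 * (m ^ 2) ^ e)%:R))
        `^ critical_exponent D) ^+ 2 <= (m ^ 2)%:R.
Proof.
move=> D0 A0 B00 U0.
pose al := critical_exponent D; pose C : R := U + 2 * A%:R * (B0%:R + e%:R).
have C0 : 0 <= C by rewrite addr_ge0 // !mulr_ge0 // addr_ge0.
(* The left-hand side grows only like [m], the right-hand side is [m ^ 2]; the spare factor [m]
   absorbs all constants. *)
have [m m0 mE] := nat_above (`|E| * (C `^ al) ^+ 2).
exists m => //.
have mR : (1 : R) <= m%:R by rewrite ler1n.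
have mR0 : (0 : R) < m%:R by rewrite ltr0n.
pose la : R := (m ^ 2)%:R.
have la1 : 1 <= la by rewrite /la natrX exprn_ege1.
have la0 : 0 < la by lra.
set X := U + _.
have X_le : X <= C * la ^+ degree D.
  have lnB : ln (B0 * (m ^ 2) ^ e)%:R <= (B0%:R + e%:R) * la.
    rewrite natrM natrX lnM ?posrE ?ltr0n // ?exprn_gt0 // lnXn // mulrDl; apply: lerD.
      apply: le_trans (ln_le_id _) _; first by rewrite ltr0n.
      by rewrite ler_peMr.
    by rewrite -(mulr_natl (ln _)); apply: ler_wpM2l => //; exact: ln_le_id.
  have -> : la ^+ degree D = la ^+ (degree D).-1 * la.
    by rewrite -exprSr /degree addn2.
  have lp1 : 1 <= la ^+ (degree D).-1 by rewrite exprn_ege1.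
  have -> : C * (la ^+ (degree D).-1 * la) =
    U * (la ^+ (degree D).-1 * la) + 2 * (A%:R * la ^+ (degree D).-1 * ((B0%:R + e%:R) * la)).
    by rewrite /C; ring.
  apply: lerD; first by rewrite ler_peMr // mulr_ege1.
  rewrite ler_pM2l // natrM natrX -/la; apply: ler_wpM2l lnB.
  by rewrite mulr_ge0 // ltW // exprn_gt0.
have P_le : Num.max 0 X `^ al <= C `^ al * m%:R `^ (2^-1).
  have -> : m%:R `^ (2^-1) = (la ^+ degree D) `^ al :> R.
    rewrite /la natrX -exprM -(powR_mulrn _ (ltW mR0)) -powRrM; congr (_ `^ _).
    rewrite /al /critical_exponent natrM; field.
    by rewrite pnatr_eq0 /degree addn2.
  have lD : 0 <= la ^+ degree D by rewrite exprn_ge0 // ltW.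
  rewrite -powRM //; apply: ge0_ler_powR; rewrite ?nnegrE ?le_max ?lexx ?mulr_ge0 //.
    exact: ltW (critical_exponent_gt0 D).
  by rewrite ge_max mulr_ge0.
have P0 : 0 <= Num.max 0 X `^ al by exact: powR_ge0.
have sq : (Num.max 0 X `^ al) ^+ 2 <= (C `^ al) ^+ 2 * m%:R.
  apply: le_trans (_ : (C `^ al * m%:R `^ (2^-1)) ^+ 2 <= _).
    by rewrite ler_pXn2r // nnegrE // mulr_ge0 // powR_ge0.
  rewrite exprMn -(powR_mulrn 2 (powR_ge0 m%:R 2^-1)) -powRrM mulVf ?powRr1 //.
apply: le_trans (_ : `|E| * ((C `^ al) ^+ 2 * m%:R) <= _).
  apply: le_trans (ler_wpM2r (sqr_ge0 _) (ler_norm E)) _.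
  by apply: ler_wpM2l.
by rewrite mulrA natrX expr2 ler_pM2r // ltW.
Qed.

(** The order is [lam], [q], then [k] and [J], then [N'], each determined by those before. The last
    condition closes the circle: [lam] must bound the stretching down to the smallest scale, which
    all of them determine. *)
Theorem parameters (D : nat) (tau c0 E U : R) : (0 < D)%N -> 0 < tau -> 0 < c0 -> 0 <= U ->
  exists lam q J N' : nat, exists k : R, [/\ (0 < lam)%N, (0 < q)%N, (0 < N')%N & 0 <= k] /\
  [/\ lam%:R < (1 + J%:R * k) * c0,
    k ^+ 2 + 2 * (((4 * q) ^ D)%:R * (2 * k + 2 * lam%:R / (c0 * N'%:R))) <= (2 * q%:R) ^- 2,
    J%:R / (N'.*2)%:R <= tau / 8,
    D%:R * (40 * lam%:R) ^+ D < tau * q%:R &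
    E * (Num.max 0 (U + 2 * (J%:R * ln (N'.*2 * (4 * q))%:R)) `^ critical_exponent D) ^+ 2 <= lam%:R].
Proof.
move=> D0 tau0 c00 U0.
(* [C1] serves the condition comparing [q] with [lam ^ D], [C3] the growth over [J] steps, [C4] the
   thinness of the slabs, and [C2] the flatness condition. *)
have [C1 C10 HC1] := nat_above (D%:R * 40 ^+ D / tau).
have [C3 C30 HC3] := nat_above c0^-1.
have [C4 C40 HC4] := nat_above (4 / tau).
have [C2 C2E C20] : exists2 c, c = (64 * 4 ^ D)%N & (0 < c)%N.
  by eexists; [reflexivity | rewrite muln_gt0 expn_gt0].
have [A AE A0] : exists2 c, c = (C3 * C2 * C1 ^ (D + 2))%N & (0 < c)%N.
  by eexists; [reflexivity | rewrite !muln_gt0 C30 C20 expn_gt0 C10].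
have [B0 B0E B00] : exists2 c, c = (8 * (C4 * A * C1))%N & (0 < c)%N.
  by eexists; [reflexivity | rewrite !muln_gt0 C40 A0 C10].
have [m m0 Hm] := @log_power_bound D A B0 ((degree D).-1 + D)%N E U D0 A0 B00 U0.
have [lam lamE lam0] : exists2 c, c = (m ^ 2)%N & (0 < c)%N.
  by eexists; [reflexivity | rewrite expn_gt0 m0].
rewrite -lamE in Hm.
have [q qE q0] : exists2 c, c = (C1 * lam ^ D)%N & (0 < c)%N.
  by eexists; [reflexivity | rewrite muln_gt0 C10 expn_gt0 lam0].
have [J Jdef J0] : exists2 c, c = (C3 * C2 * lam * q ^ (D + 2))%N & (0 < c)%N.
  by eexists; [reflexivity | rewrite !muln_gt0 C30 C20 lam0 expn_gt0 q0].
have [N' N'E N'0] : exists2 c, c = (C4 * J)%N & (0 < c)%N.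
  by eexists; [reflexivity | rewrite muln_gt0 C40 J0].
pose k : R := (C2%:R * q%:R ^+ (D + 2))^-1.
have [qR lR JR NR] : [/\ (0 : R) < q%:R, (0 : R) < lam%:R, (0 : R) < J%:R & (0 : R) < N'%:R].
  by rewrite !ltr0n.
have [C2R C3R C4R] : [/\ (0 : R) < C2%:R, (0 : R) < C3%:R & (0 : R) < C4%:R] by rewrite !ltr0n.
have qD : (0 : R) < q%:R ^+ (D + 2) by rewrite exprn_gt0.
have k0 : 0 < k by rewrite invr_gt0 mulr_gt0.
have JE : J = (A * lam ^ (degree D).-1)%N.
  have -> : (degree D).-1 = (D * (D + 2)).+1 by rewrite /degree addn2.
  rewrite Jdef AE qE expnMn -expnM.
  have -> : (lam ^ (D * (D + 2)).+1 = lam * lam ^ (D * (D + 2)))%N by rewrite expnS.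
  by ring.
have NE : (N'.*2 * (4 * q) = B0 * lam ^ ((degree D).-1 + D))%N.
  by rewrite N'E B0E JE qE -muln2 expnD; ring.
have Jk : J%:R * k = C3%:R * lam%:R.
  by rewrite Jdef /k !natrM natrX; field; rewrite !gt_eqF.
exists lam, q, J, N', k; split; [by split => //; exact: ltW | split].
- rewrite Jk mulrDl mul1r; apply: ltr_pwDl => //.
  have : 1 <= C3%:R * c0 by rewrite -ler_pdivrMr // div1r ltW.
  by rewrite mulrAC; move=> H; rewrite ler_peMl // ltW.
- have k2 : 4 ^+ D * q%:R ^+ D * (8 * k) = 8^-1 * q%:R ^- 2.
    have q20 : (0 : R) < q%:R ^+ 2 by rewrite exprn_gt0.
    have qD0 : (0 : R) < q%:R ^+ D by rewrite exprn_gt0.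
    have D40 : (0 : R) < 4 ^+ D by rewrite exprn_gt0.
    rewrite /k C2E natrM natrX exprD; field.
    by rewrite !gt_eqF.
  have kk : lam%:R / (c0 * N'%:R) <= k.
    rewrite N'E natrM mulrA ler_pdivrMr; last by rewrite !mulr_gt0.
    have -> : k * (c0 * C4%:R * J%:R) = J%:R * k * (c0 * C4%:R) by ring.
    rewrite Jk mulrAC; apply: ler_peMl; first exact: ltW.
    have H1 : 1 <= C3%:R * c0 by rewrite -ler_pdivrMr // div1r ltW.
    have H2 : (1 : R) <= C4%:R by rewrite ler1n.
    by rewrite mulrA mulr_ege1.
  have q1 : (1 : R) <= q%:R by rewrite ler1n.
  have ksq : k ^+ 2 <= 8^-1 * q%:R ^- 2.
    apply: le_trans (_ : k <= _).
      rewrite expr2 ler_piMl ?(ltW k0) // invf_le1 ?mulr_gt0 // mulr_ege1 ?ler1n //.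
      exact: exprn_ege1.
    rewrite -k2 mulrA ler_peMl ?(ltW k0) // mulr_ege1 //; last by rewrite ler1n.
    by rewrite mulr_ege1 // exprn_ege1 // ler1n.
  have -> : (2 * q%:R) ^- 2 = 4^-1 * q%:R ^- 2 :> R by rewrite exprMn; field; rewrite gt_eqF.
  have M0 : 0 <= ((4 * q) ^ D)%:R :> R by [].
  have : ((4 * q) ^ D)%:R * (2 * k + 2 * lam%:R / (c0 * N'%:R)) <= ((4 * q) ^ D)%:R * (4 * k).
    apply: ler_wpM2l => //; rewrite -mulrA; lra.
  have : ((4 * q) ^ D)%:R = 4 ^+ D * q%:R ^+ D :> R by rewrite natrX natrM exprMn.
  move=> ->; move: k2 ksq; lra.
- rewrite -muln2 N'E !natrM.
  have -> : J%:R / (C4%:R * J%:R * 2) = (2 * C4%:R)^-1 :> R by field; rewrite !gt_eqF.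
  have H : 4 < C4%:R * tau by rewrite -ltr_pdivrMr.
  rewrite -div1r ler_pdivrMr ?mulr_gt0 //; lra.
- rewrite qE natrM natrX exprMn !mulrA ltr_pM2r ?exprn_gt0 //.
  by rewrite ltr_pdivrMr // in HC1; rewrite [tau * _]mulrC.
- by rewrite NE JE.
Qed.

End parameters.

(** * Images of solutions and estimates for the modulus of continuity *)

Lemma cube_box (R : realType) n : cube R n = box (const_mx (1 / 2)) (1 / 2).
Proof.
have h0 : 0 <= (1 / 2 : R) by rewrite divr_ge0.
have e1 : (1 / 2 - 1 / 2 : R) = 0 by rewrite subrr.
have e2 : (1 / 2 + 1 / 2 : R) = 1 by field.
rewrite boxE //; apply/seteqP.
by split => x /= H i; have := H i; rewrite mxE in_itv /= e1 e2.
Qed.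

(** A weak invariance of domain. For [z] near the image of the centre, [robust_image] is applied to
    [f] and its translate by [f c - z]: the translate comes arbitrarily close to [f c], so [f] comes
    arbitrarily close to [z], and its image is compact. *)
Lemma image_has_interior (R : realType) d rho (f g : 'rV[R]_d.+1 -> 'rV[R]_d.+1) :
  topological_solution rho f g ->
  exists p, exists2 r, 0 < r & box p r `<=` f @` cube R d.+1.
Proof.
move=> [uf ug fK _]; pose c : 'rV[R]_d.+1 := const_mx (1 / 2).
have h0 : (0 : R) < 1 / 2 by lra.
have cc : cube R d.+1 c by rewrite cube_box /box /= subrr normr0 ltW.
have inv e : 0 < e -> exists2 k, 0 < k & forall x y, box c (1 / 2) x -> box c (1 / 2) y ->
    `|f x - f y| < k -> `|x - y| < e.
  rewrite -cube_box => e0; have [k k0 H] := ug _ e0; exists k => // x y cx cy.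
  by rewrite -{2}(fK x) ?inE // -{2}(fK y) ?inE //; apply: H; [exists x | exists y].
have [k k0 Hk] := inv _ h0.
exists (f c), (k / 4); first by rewrite divr_gt0.
move=> z zp; have k4 : 0 < k / 4 by rewrite divr_gt0.
have cf : compact (f @` cube R d.+1) by apply: compact_ucont_image => //; exact: cube_compact.
apply: (compact_approx cf) => e e0.
have uf' : ucont (box c (1 / 2)) f by rewrite -cube_box.
have uf2 : ucont (box c (1 / 2)) (fun x => f x + (f c - z)).
  move=> e' /uf'[dl dl0 H]; exists dl => // x y bx byy xy.
  by rewrite opprD addrACA subrr addr0; exact: H.
have cS : box c (1 / 2) c by rewrite -cube_box.
have close x : box c (1 / 2) x -> `|f x - (f x + (f c - z))| <= k / 4.
  by move=> _; rewrite opprD addrA subrr add0r opprB; exact: zp.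
have far x : `|x - c| = 1 / 2 -> 4 * (k / 4) <= `|f x - f c|.
  move=> xc; rewrite mulrC divfK // leNgt; apply/negP => H.
  by have := Hk x c _ cS H; rewrite xc ltxx => F; apply: notF; apply: F; rewrite /box /= xc.
have [x bx xz] := robust_image h0 uf' uf2 inv cS k4 close far e0.
exists (f x); first by exists x => //; rewrite cube_box.
have <- : f x + (f c - z) - f c = f x - z by apply/rowP => i; rewrite !mxE; ring.
exact: xz.
Qed.

Section omega.
Variables (R : realType) (a al : R) (w : R -> R).
Hypotheses (a_gt0 : 0 < a) (al_range : 0 < al <= 1).
Hypothesis wE : forall t, 0 < t < a -> w t = t * ln (1 / t) `^ al.

Let a1 := Num.min a 1.

(** With [s] the root of [t], the logarithm is [2 * ln (1 / s)], which is below [2 / s], and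
    [al <= 1]. This crude Hoelder bound serves wherever only some power of the distance matters. *)
Lemma omega_le_sqrt t : 0 < t -> t < a1 -> w t <= 2 * Num.sqrt t.
Proof.
move=> t0; rewrite lt_min => /andP[ta t1]; rewrite wE ?t0 //.
pose s := Num.sqrt t; have s0 : 0 < s by rewrite sqrtr_gt0.
have ts : t = s ^+ 2 by rewrite sqr_sqrtr // ltW.
have s1 : s < 1 by rewrite -(ltr_pXn2r (_ : 0 < 2)%N) ?nnegrE ?ler01 ?(ltW s0) // -ts expr1n.
have si : 1 <= s^-1 by rewrite invf_ge1 // ltW.
have lnE : ln (1 / t) = 2 * ln s^-1.
  have si0 : 0 < s^-1 by rewrite invr_gt0.
  by rewrite div1r ts -exprVn (lnXn 2 si0) mulr_natl.
have ln_s : ln s^-1 <= s^-1 - 1.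
  have := @le_ln1Dx R (s^-1 - 1); rewrite [1 + _]addrC subrK; apply; lra.
have y0 : 0 <= ln (1 / t) by rewrite lnE mulr_ge0 // ln_ge0.
have y_le : ln (1 / t) `^ al <= 2 * s^-1.
  have [al0 al1] := andP al_range.
  case: (leP (ln (1 / t)) 1) => H.
    apply: le_trans (_ : 1 `^ al <= _); last by rewrite powR1; lra.
    by apply: ge0_ler_powR; rewrite ?nnegrE // ltW.
  apply: le_trans (_ : ln (1 / t) `^ 1 <= _).
    by apply: ler_powR => //; exact: ltW.
  by rewrite powRr1 // lnE; lra.
apply: le_trans (ler_wpM2l (ltW t0) y_le) _.
rewrite [X in X * _]ts -/s; have -> : s ^+ 2 * (2 * s^-1) = 2 * s; last exact: lexx.
by field; rewrite gt_eqF.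
Qed.

Lemma ucont_omega n m (S : set 'rV[R]_n) (h : 'rV[R]_n -> 'rV[R]_m) K : 0 < K ->
  (forall x y, S x -> S y -> 0 < enorm (y - x) < a -> enorm (h y - h x) <= K * w (enorm (y - x))) ->
  ucont S h.
Proof.
move=> K0 H e e0.
pose r := Num.min a1 ((e / (2 * K)) ^+ 2).
have a10 : 0 < a1 by rewrite lt_min a_gt0 ltr01.
have r0 : 0 < r by rewrite lt_min a10 exprn_gt0 // divr_gt0 // mulr_gt0.
exists (r / n.+1%:R); first by rewrite divr_gt0.
move=> x y Sx Sy xy.
have xyr : enorm (x - y) < r.
  apply: le_lt_trans (enorm_le_norm _) _; rewrite ltr_pdivlMr // in xy.
  apply: le_lt_trans xy; rewrite mulrC; apply: ler_wpM2l => //.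
  by rewrite ler_nat.
have := enorm_ge0 (x - y); rewrite le_eqVlt => /orP[/eqP E|p0].
  have -> : x = y.
    apply/eqP; rewrite -subr_eq0 -normr_le0 E; exact: norm_le_enorm.
  by rewrite subrr normr0.
move: xyr; rewrite lt_min => /andP[xa xe].
have xa' : enorm (x - y) < a by move: xa; rewrite lt_min => /andP[].
apply: le_lt_trans (norm_le_enorm _) _; apply: le_lt_trans (H _ _ Sy Sx _) _.
  by rewrite p0.
have := omega_le_sqrt p0 xa; rewrite -(ler_pM2l K0) => /le_lt_trans; apply.
rewrite mulrCA mulrA -ltr_pdivlMl ?mulr_gt0 //.
rewrite -(ltr_pXn2r (_ : 0 < 2)%N) ?nnegrE ?sqrtr_ge0 ?mulr_ge0 ?invr_ge0 ?(ltW K0) ?(ltW e0) //.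
rewrite sqr_sqrtr ?(ltW p0) // [_^-1 * e]mulrC; first exact: xe.
by rewrite mulr_ge0 // ltW.
Qed.

End omega.

Section omega_solution.
Variables (R : realType) (n : nat).
Local Notation cube := (cube R n).

Definition omega_solution (a : R) (w : R -> R) (K : R) (rho : 'rV[R]_n -> R) (f g : 'rV[R]_n -> 'rV[R]_n) :=
  [/\ {in cube, cancel f g},
    (forall x y, cube x -> cube y -> 0 < enorm (y - x) < a ->
      enorm (f y - f x) <= K * w (enorm (y - x))),
    (forall x y, (f @` cube) x -> (f @` cube) y -> 0 < enorm (y - x) < a ->
      enorm (g y - g x) <= K * w (enorm (y - x))) &
    pushforward_equation rho f].

Lemma omega_topological a al w K rho f g : 0 < a -> 0 < al <= 1 -> 0 < K ->
  (forall t, 0 < t < a -> w t = t * ln (1 / t) `^ al) ->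
  omega_solution a w K rho f g -> topological_solution rho f g.
Proof.
move=> a0 al01 K0 wE [fK Hf Hg eqn]; split => //.
- exact: (ucont_omega a0 al01 wE K0 Hf).
- exact: (ucont_omega a0 al01 wE K0 Hg).
Qed.

End omega_solution.

Section omega_estimates.
Variables (R : realType) (a al : R) (w : R -> R) (K : R).
Hypotheses (a_gt0 : 0 < a) (al_range : 0 < al <= 1) (K_ge1 : 1 <= K).
Hypothesis wE : forall t, 0 < t < a -> w t = t * ln (1 / t) `^ al.
Let a1 := Num.min a 1.

Let K_gt0 : 0 < K. Proof. exact: lt_le_trans ltr01 K_ge1. Qed.

Lemma omega_le_log t l : 0 < t -> t < a1 -> t^-1 <= l -> w t <= t * ln l `^ al.
Proof.
move=> t0; rewrite lt_min => /andP[ta t1] tl; rewrite wE ?t0 // ler_pM2l // div1r.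
have ti : 1 <= t^-1 by rewrite invf_ge1 // ltW.
have ti0 : 0 < t^-1 by rewrite invr_gt0.
have l0 := lt_le_trans ti0 tl; have [al0 _] := andP al_range.
have ln_le : ln t^-1 <= ln l by rewrite ler_ln ?posrE.
have ln0 : 0 <= ln t^-1 by rewrite ln_ge0.
by apply: ge0_ler_powR; rewrite ?nnegrE ?(ltW al0) // (le_trans ln0 ln_le).
Qed.

(** The Hoelder bound read backwards: distances shrink at most quadratically. The minimum with [a1]
    covers the pairs that are too far apart for the modulus. *)
Lemma omega_inverse_bound n m (S : set 'rV[R]_n) (h : 'rV[R]_n -> 'rV[R]_m) x y :
  (forall x y, S x -> S y -> 0 < enorm (y - x) < a -> enorm (h y - h x) <= K * w (enorm (y - x))) ->
  S x -> S y -> Num.min a1 (enorm (h y - h x) ^+ 2 / (4 * K ^+ 2)) <= enorm (y - x).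
Proof.
move=> H Sx Sy; have := enorm_ge0 (y - x); rewrite le_eqVlt => /orP[/eqP E|p0].
  have -> : y = x by apply/eqP; rewrite -subr_eq0 -normr_le0 E; exact: norm_le_enorm.
  have e0 k : enorm (0 : 'rV[R]_k) = 0.
    by apply: le_anti; rewrite enorm_ge0 andbT; have := enorm_le_norm (0 : 'rV[R]_k); rewrite normr0 mulr0.
  by rewrite !subrr !e0 expr0n /= mul0r ge_min lexx orbT.
case: (leP a1 (enorm (y - x))) => [H1|H1]; rewrite ge_min; apply/orP; [by left | right].
have pa : enorm (y - x) < a by move: H1; rewrite lt_min => /andP[].
have := H _ _ Sx Sy; rewrite p0 pa => /(_ isT) H2.
have := omega_le_sqrt al_range wE p0 H1; rewrite -(ler_pM2l K_gt0) => H3.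
have H4 := le_trans H2 H3.
rewrite ler_pdivrMr ?mulr_gt0 ?exprn_gt0 //.
have -> : enorm (y - x) * (4 * K ^+ 2) = (K * (2 * Num.sqrt (enorm (y - x)))) ^+ 2.
  rewrite !exprMn sqr_sqrtr ?(ltW p0) //; ring.
by rewrite ler_pXn2r ?nnegrE ?enorm_ge0 // !mulr_ge0 ?sqrtr_ge0 // ltW.
Qed.

Variables (n : nat) (rho0 rho : 'rV[R]_n -> R) (f0 g0 f g1 : 'rV[R]_n -> 'rV[R]_n).
Hypotheses (sol0 : omega_solution a w K rho0 f0 g0) (sol : omega_solution a w K rho f g1).
Let g := f \o g0.

Let cube_g0 u : (f0 @` cube R n) u -> cube R n (g0 u).
Proof. by have [fK _ _ _] := sol0; move=> [x cx <-]; rewrite fK ?inE. Qed.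

Let f0K u : (f0 @` cube R n) u -> f0 (g0 u) = u.
Proof. by have [fK _ _ _] := sol0; move=> [x cx <-]; rewrite fK ?inE. Qed.

(** The moduli of [g0] and [f] are applied in turn, at the distances [r] and [r']. By the Hoelder
    bound for [f0], [r'] is at least [r ^ 2 / (4 K ^ 2)], so the same [ln l] bounds both logarithms
    and the square costs only a constant factor. *)
Lemma transfer_enorm_le u v l : (f0 @` cube R n) u -> (f0 @` cube R n) v ->
  0 < enorm (u - v) -> 4 * K ^+ 2 * enorm (u - v) < a1 ^+ 2 ->
  4 * K ^+ 2 / enorm (u - v) ^+ 2 <= l ->
  enorm (g u - g v) <= K ^+ 2 * (ln l `^ al) ^+ 2 * enorm (u - v).
Proof.
move=> cu cv; set r := enorm (u - v) => r0 ra rl.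
have [_ Hf0 Hg0 _] := sol0; have [_ Hf _ _] := sol.
have K2 : 0 < K ^+ 2 by rewrite exprn_gt0.
have K21 : 1 <= K ^+ 2 by rewrite exprn_ege1.
have a10 : 0 < a1 by rewrite lt_min a_gt0 ltr01.
have a11 : a1 <= 1 by rewrite ge_min lexx orbT.
have r_lt : r < a1.
  have h1 : a1 ^+ 2 <= a1 by rewrite expr2 ler_piMr // ltW.
  have h2 : r <= 4 * K ^+ 2 * r.
    by rewrite ler_peMl ?(ltW r0) // mulr_ege1 // ler1n.
  exact: le_lt_trans h2 (lt_le_trans ra h1).
have ra' : r < a by move: r_lt; rewrite lt_min => /andP[].
have r1 : r < 1 by exact: lt_le_trans r_lt a11.
have ril : r^-1 <= l.
  apply: le_trans rl; have -> : 4 * K ^+ 2 / r ^+ 2 = r^-1 * (4 * K ^+ 2 * r^-1).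
    by field; rewrite gt_eqF.
  by rewrite ler_peMr ?invr_ge0 ?(ltW r0) // mulr_ege1 ?invf_ge1 ?(ltW r1) // mulr_ege1 // ler1n.
set P := ln l `^ al; have P0 : 0 <= P by exact: powR_ge0.
set r' := enorm (g0 u - g0 v).
have r'w : r' <= K * w r by apply: Hg0 => //; rewrite -/r r0 ra'.
have r'_lt : r' < a1.
  have := omega_le_sqrt al_range wE r0 r_lt; rewrite -(ler_pM2l K_gt0) => H3.
  apply: le_lt_trans r'w (le_lt_trans H3 _).
  rewrite -(ltr_pXn2r (_ : 0 < 2)%N) ?nnegrE ?(ltW a10) ?mulr_ge0 ?sqrtr_ge0 ?(ltW K_gt0) //.
  have -> : (K * (2 * Num.sqrt r)) ^+ 2 = 4 * K ^+ 2 * r by rewrite !exprMn sqr_sqrtr ?(ltW r0) //; ring.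
  exact: ra.
have r'_ge : r ^+ 2 / (4 * K ^+ 2) <= r'.
  have := omega_inverse_bound Hf0 (cube_g0 cv) (cube_g0 cu); rewrite !f0K // -/r -/r'.
  by rewrite ge_min leNgt r'_lt.
have r'0 : 0 < r'.
  by apply: lt_le_trans r'_ge; rewrite divr_gt0 ?mulr_gt0 ?exprn_gt0.
have r'a : r' < a by move: r'_lt; rewrite lt_min => /andP[].
have r'l : r'^-1 <= l.
  apply: le_trans rl; rewrite -[leRHS]invrK invf_div lef_pV2 ?posrE //.
  by rewrite divr_gt0 ?mulr_gt0 ?exprn_gt0.
have h1 : r' <= K * (r * P).
  by apply: le_trans r'w _; rewrite ler_pM2l //; exact: omega_le_log.
have h2 : enorm (g u - g v) <= K * (r' * P).
  have := Hf _ _ (cube_g0 cv) (cube_g0 cu); rewrite -/r' r'0 r'a => /(_ isT) H.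
  by apply: le_trans H _; rewrite ler_pM2l //; exact: omega_le_log.
apply: le_trans h2 _; have -> : K ^+ 2 * P ^+ 2 * r = K * (K * (r * P) * P) by ring.
by rewrite ler_pM2l //; exact: ler_wpM2r.
Qed.

(** The Hoelder bounds for [f0] and for the inverse of [f] are combined. The result depends on [f]
    only through [K], as it must for a constant fixed before [f]. *)
Lemma transfer_enorm_ge u v : (f0 @` cube R n) u -> (f0 @` cube R n) v ->
  enorm (u - v) < a1 ->
  Num.min a1 ((enorm (u - v) ^+ 2 / (4 * K ^+ 2)) ^+ 2 / (4 * K ^+ 2)) <= enorm (g u - g v).
Proof.
move=> cu cv; set r := enorm (u - v) => ra.
have [_ Hf0 _ _] := sol0; have [fK _ Hg1 _] := sol.
have r0 : 0 <= r by exact: enorm_ge0.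
have K4 : 1 <= 4 * K ^+ 2 by rewrite mulr_ege1 ?ler1n // exprn_ege1.
have K40 : 0 < 4 * K ^+ 2 by exact: lt_le_trans ltr01 K4.
have r1 : r <= 1 by move: ra; rewrite lt_min => /andP[_ /ltW].
have h1 : r ^+ 2 / (4 * K ^+ 2) <= r.
  rewrite ler_pdivrMr //; apply: le_trans (_ : r * 1 <= _).
    by rewrite expr2; exact: ler_wpM2l.
  exact: ler_wpM2l.
have r'_ge : r ^+ 2 / (4 * K ^+ 2) <= enorm (g0 u - g0 v).
  have := omega_inverse_bound Hf0 (cube_g0 cv) (cube_g0 cu); rewrite !f0K // -/r.
  by rewrite ge_min => /orP[|//]; apply: le_trans; exact: le_trans h1 (ltW ra).
have img x : cube R n x -> (f @` cube R n) (f x) by move=> cx; exists x.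
have := omega_inverse_bound Hg1 (img _ (cube_g0 cv)) (img _ (cube_g0 cu)).
rewrite !fK ?inE; [|exact: cube_g0|exact: cube_g0].
apply: le_trans.
have mono (b X Y : R) : X <= Y -> Num.min b X <= Num.min b Y.
  by move=> XY; rewrite le_min !ge_min lexx XY orbT.
apply: mono.
rewrite ler_pM2r ?invr_gt0 // ler_pXn2r // nnegrE ?enorm_ge0 //.
by rewrite divr_ge0 ?exprn_ge0 // ltW.
Qed.

End omega_estimates.

(* A modulus of continuity only controls pairs whose distance is bounded below;
   arbitrary pairs are treated by passing through [z]. *)
Lemma far_point (R : realType) d (o x y : 'rV[R]_d.+2) t0 s :
  cubeQ o t0 x -> cubeQ o t0 y -> 0 < s -> s <= t0 -> `|x - y| <= s ->
  let z := x + (2 * s) *: axis R d in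
  [/\ `|z - o| <= 3 * t0, s <= enorm (z - x), enorm (z - x) <= 2 * d.+2%:R * s,
    s <= enorm (z - y) & enorm (z - y) <= 3 * d.+2%:R * s].
Proof.
move=> Qx Qy s0 st xy z.
have zx : z - x = (2 * s) *: axis R d by rewrite /z addrAC subrr add0r.
have ax : `|z - x| <= 2 * s.
  by rewrite zx; apply: le_trans (norm_axis _ _) _; rewrite ger0_norm // mulr_ge0 // ltW.
have zx0 : (z - x) ord0 ord0 = 2 * s by rewrite zx !mxE !eqxx mulr1.
have D1 : (1 : R) <= d.+2%:R by rewrite ler1n.
split.
- rewrite -(subrK x z) -addrA; apply: le_trans (ler_normD _ _) _.
  have xo : `|x - o| <= t0.
    apply: norm_leP => [|i]; first by rewrite (le_trans _ st) // ltW.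
    by rewrite !mxE; have /andP[h1 h2] := Qx i; rewrite ger0_norm.
  lra.
- apply: le_trans (norm_le_enorm _); apply: le_trans (norm_coord _ ord0); rewrite zx0.
  rewrite ger0_norm; lra.
- apply: le_trans (enorm_le_norm _) _; have -> : 2 * d.+2%:R * s = d.+2%:R * (2 * s) by ring.
  by apply: ler_wpM2l.
- apply: le_trans (norm_le_enorm _); apply: le_trans (norm_coord _ ord0).
  have -> : z - y = (z - x) + (x - y) by rewrite addrA subrK.
  rewrite mxE zx0; have := norm_coord (x - y) ord0 => h; have := le_trans h xy.
  rewrite ler_norml => /andP[h1 _]; apply: le_trans (ler_norm _); lra.
- apply: le_trans (enorm_le_norm _) _.
  have zy : `|z - y| <= 3 * s.
    by apply: le_trans (ler_distD x _ _) _; lra.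
  have -> : 3 * d.+2%:R * s = d.+2%:R * (3 * s) by ring.
  by apply: ler_wpM2l.
Qed.

Lemma small_scale (R : realType) (r a1 K : R) D : 0 < r -> 0 < a1 -> 1 <= K -> (0 < D)%N ->
  exists2 t0, 0 < t0 & 3 * t0 <= r /\ 4 * K ^+ 2 * (3 * D%:R * t0) < a1 ^+ 2.
Proof.
move=> r0 a10 K1 D0; have K0 : 0 < K := lt_le_trans ltr01 K1.
have DR : (0 : R) < D%:R by rewrite ltr0n.
have C0 : 0 < 24 * (D%:R * K ^+ 2) by rewrite !mulr_gt0 // exprn_gt0.
have a20 : 0 < a1 ^+ 2 by rewrite exprn_gt0.
exists (Num.min (r / 3) (a1 ^+ 2 / (24 * (D%:R * K ^+ 2)))).
  by rewrite lt_min !divr_gt0.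
set t0 := Num.min _ _; split.
  by rewrite mulrC -ler_pdivlMr // /t0 ge_min lexx.
have : t0 <= a1 ^+ 2 / (24 * (D%:R * K ^+ 2)) by rewrite /t0 ge_min lexx orbT.
rewrite ler_pdivlMr //.
have -> : 4 * K ^+ 2 * (3 * D%:R * t0) = t0 * (24 * (D%:R * K ^+ 2)) / 2 by field.
by move=> H; rewrite ltr_pdivrMr //; lra.
Qed.

Lemma ln_scale_bound (R : realType) (t0 K : R) N' q J : 0 < t0 -> 1 <= K -> (0 < N')%N -> (0 < q)%N ->
  ln (4 * K ^+ 2 / (scale N' q t0 J) ^+ 2) <=
  Num.max 0 (Num.max 0 (ln (4 * K ^+ 2 / t0 ^+ 2)) + 2 * (J%:R * ln (N'.*2 * (4 * q))%:R)).
Proof.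
move=> t00 K1 N0 q0; rewrite le_max; apply/orP; right; rewrite /scale.
have B0 : (0 < N'.*2 * (4 * q))%N by rewrite !muln_gt0 double_gt0 N0 q0.
move: (N'.*2 * (4 * q))%N B0 => B B0.
have BR : (0 : R) < B%:R by rewrite ltr0n.
have K0 : 0 < K := lt_le_trans ltr01 K1.
have C0 : 0 < 4 * K ^+ 2 / t0 ^+ 2 by rewrite divr_gt0 ?mulr_gt0 ?exprn_gt0.
have -> : 4 * K ^+ 2 / (t0 / (B ^ J)%:R) ^+ 2 = 4 * K ^+ 2 / t0 ^+ 2 * B%:R ^+ (J * 2).
  rewrite natrX exprM; field; rewrite gt_eqF //.
  by rewrite gt_eqF // exprn_gt0.
rewrite lnM ?posrE ?exprn_gt0 //; apply: lerD; first by rewrite le_max lexx orbT.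
rewrite (lnXn _ BR); have -> // : ln B%:R *+ (J * 2) = 2 * (J%:R * ln B%:R) :> R.
by rewrite -(mulr_natl (ln B%:R) (J * 2)) natrM; ring.
Qed.

Section rough.
Variables (R : realType) (d : nat) (a : R) (w : R -> R) (K : R).
Local Notation D := d.+2.
Local Notation L := (lebesgue_rV R D).
Local Notation cube := (cube R D).
Variables (rho0 : 'rV[R]_D -> R) (f0 g0 : 'rV[R]_D -> 'rV[R]_D) (tau : R).
Hypotheses (a_gt0 : 0 < a) (K_ge1 : 1 <= K).
Hypothesis wE : forall t, 0 < t < a -> w t = t * ln (1 / t) `^ critical_exponent R D.
Hypotheses (mrho0 : measurable_fun setT rho0) (sol0 : omega_solution a w K rho0 f0 g0).
Hypothesis tau_range : 0 < tau <= 1 / 4.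

Let a1 := Num.min a 1.
Let K_gt0 : 0 < K. Proof. exact: lt_le_trans ltr01 K_ge1. Qed.
Let a1_gt0 : 0 < a1. Proof. by rewrite lt_min a_gt0 ltr01. Qed.
Let al_range : 0 < critical_exponent R D <= 1.
Proof. by rewrite critical_exponent_gt0 critical_exponent_le1. Qed.

Section scales.
Variables (o : 'rV[R]_D) (t0 : R).
Hypotheses (t0_gt0 : 0 < t0) (box_image : box o (3 * t0) `<=` f0 @` cube).
Hypothesis t0_small : 4 * K ^+ 2 * (3 * D%:R * t0) < a1 ^+ 2.
Variables (rho : 'rV[R]_D -> R) (f g1 : 'rV[R]_D -> 'rV[R]_D).
Hypothesis sol : omega_solution a w K rho f g1.
Let g := f \o g0.

Lemma cubeQ_box : cubeQ o t0 `<=` box o (3 * t0).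
Proof.
move=> x Qx; apply: norm_leP => [|i]; first by rewrite mulr_ge0 // ltW.
rewrite !mxE; have /andP[h1 h2] := Qx i; rewrite ger0_norm //; apply: le_trans h2 _.
by rewrite ler_peMl // ?ler1n // ltW.
Qed.

Lemma transfer_upper (N' q J : nat) s x y : (0 < N')%N -> (0 < q)%N ->
  scale N' q t0 J <= s -> cubeQ o t0 x -> cubeQ o t0 y -> `|x - y| <= s ->
  enorm (g x - g y) <= 5 * D%:R * K ^+ 2 *
    (Num.max 0 (Num.max 0 (ln (4 * K ^+ 2 / t0 ^+ 2)) + 2 * (J%:R * ln (N'.*2 * (4 * q))%:R))
      `^ critical_exponent R D) ^+ 2 * s.
Proof.
move=> N0 q0; set P := (X in _ -> _ -> _ -> _ -> _ <= _ * X ^+ 2 * s).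
move=> ts Qx Qy xy.
have tJ0 : 0 < scale N' q t0 J by exact: scale_gt0.
have P0 : 0 <= P by exact: powR_ge0.
(* Points of the cube are at distance at most [t0], so [s] may be lowered to [t0]; the auxiliary
   point then stays in the image of [f0]. *)
pose s' := Num.min s t0.
have s0 : 0 < s by exact: lt_le_trans tJ0 ts.
have s'0 : 0 < s' by rewrite lt_min s0.
have s't : s' <= t0 by rewrite ge_min lexx orbT.
have ts' : scale N' q t0 J <= s'.
  rewrite le_min ts /= /scale ler_pdivrMr; last by rewrite ltr0n expn_gt0 !muln_gt0 double_gt0 N0 q0.
  by rewrite ler_peMr ?(ltW t0_gt0) // ler1n expn_gt0 !muln_gt0 double_gt0 N0 q0.
have xys : `|x - y| <= s'.
  rewrite le_min xy; apply: norm_leP => [|i]; first exact: ltW.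
  rewrite !mxE; have /andP[h1 h2] := Qx i; have /andP[h3 h4] := Qy i.
  by rewrite ler_norml; apply/andP; split; lra.
have [zo zx1 zx2 zy1 zy2] := far_point Qx Qy s'0 s't xys.
set z := x + _ in zo zx1 zx2 zy1 zy2.
have cz : (f0 @` cube) z by exact: box_image.
have cx := box_image (cubeQ_box Qx); have cy := box_image (cubeQ_box Qy).
have K2 : 0 < K ^+ 2 by rewrite exprn_gt0.
have pair v : (f0 @` cube) v -> s' <= enorm (z - v) -> enorm (z - v) <= 3 * D%:R * s' ->
    enorm (g z - g v) <= K ^+ 2 * P ^+ 2 * enorm (z - v).
  move=> cv h1 h2.
  have r0 : 0 < enorm (z - v) := lt_le_trans s'0 h1.
  have h3 : 4 * K ^+ 2 * enorm (z - v) < a1 ^+ 2.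
    apply: le_lt_trans t0_small; apply: ler_wpM2l; first by rewrite mulr_ge0 // ltW.
    by apply: le_trans h2 _; apply: ler_wpM2l.
  have h4 : 4 * K ^+ 2 / enorm (z - v) ^+ 2 <= 4 * K ^+ 2 / (scale N' q t0 J) ^+ 2.
    apply: ler_wpM2l; first by rewrite mulr_ge0 // ltW.
    rewrite lef_pV2 ?posrE ?exprn_gt0 // ler_pXn2r ?nnegrE ?(ltW r0) ?(ltW tJ0) //.
    exact: le_trans ts' h1.
  apply: le_trans (transfer_enorm_le a_gt0 al_range K_ge1 wE sol0 sol cz cv r0 h3 h4) _.
  apply: ler_wpM2r; first exact: ltW.
  apply: ler_wpM2l; first exact: ltW.
  have h5 : 1 <= 4 * K ^+ 2 / (scale N' q t0 J) ^+ 2.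
    apply: le_trans h4; rewrite ler_pdivlMr ?exprn_gt0 // mul1r.
    have r1 : enorm (z - v) <= 1.
      have h6 : enorm (z - v) <= 4 * K ^+ 2 * enorm (z - v).
        by rewrite ler_peMl ?(ltW r0) // mulr_ege1 ?ler1n // exprn_ege1.
      apply: le_trans h6 (le_trans (ltW h3) _).
      by rewrite exprn_ile1 ?(ltW a1_gt0) // ge_min lexx orbT.
    apply: le_trans (exprn_ile1 _ (ltW r0) r1) _.
    by rewrite mulr_ege1 ?ler1n // exprn_ege1.
  have h6 := ln_ge0 h5; have h7 := ln_scale_bound J t0_gt0 K_ge1 N0 q0.
  rewrite ler_pXn2r ?nnegrE ?powR_ge0 //.
  have [al0 _] := andP al_range.
  by apply: ge0_ler_powR; rewrite ?nnegrE ?(ltW al0) // (le_trans h6 h7).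
have D1 : 2 * D%:R * s' <= 3 * D%:R * s' by rewrite !ler_wpM2r ?ler_nat // ltW.
have h1 := pair _ cx zx1 (le_trans zx2 D1); have h2 := pair _ cy zy1 zy2.
apply: le_trans (ler_enorm_dist (g z) _ _) _; rewrite [enorm (g x - _)]enormC.
apply: le_trans (lerD h1 h2) _; rewrite -mulrDr.
have -> : 5 * D%:R * K ^+ 2 * P ^+ 2 * s = K ^+ 2 * P ^+ 2 * (2 * D%:R * s + 3 * D%:R * s) by ring.
have ss : s' <= s by rewrite ge_min lexx.
apply: ler_wpM2l; first by rewrite mulr_ge0 ?exprn_ge0 // ltW.
apply: lerD.
- by apply: le_trans zx2 _; exact: ler_wpM2l.
- by apply: le_trans zy2 _; exact: ler_wpM2l.
Qed.

Lemma transfer_lower :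
  Num.min a1 ((t0 ^+ 2 / (4 * K ^+ 2)) ^+ 2 / (4 * K ^+ 2)) <=
  enorm (g (o + t0 *: axis R d) - g o).
Proof.
have eE : enorm (o + t0 *: axis R d - o) = t0.
  have -> : o + t0 *: axis R d - o = t0 *: axis R d by rewrite addrAC subrr add0r.
  rewrite /enorm (bigD1 ord0) //= !mxE !eqxx mulr1 big1 ?addr0 ?sqrtr_sqr ?gtr0_norm //.
  by move=> i i0; rewrite !mxE (negPf i0) andbF mulr0 expr0n.
have ta : t0 < a1.
  have h1 : t0 <= 4 * K ^+ 2 * (3 * D%:R * t0).
    rewrite mulrA ler_peMl ?(ltW t0_gt0) //.
    by rewrite !mulr_ege1 ?ler1n // exprn_ege1.
  apply: le_lt_trans h1 (lt_le_trans t0_small _).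
  by rewrite expr2 ler_piMr ?(ltW a1_gt0) // ge_min lexx orbT.
have := @transfer_enorm_ge R a _ w K al_range K_ge1 wE D rho0 rho f0 g0 f g1 sol0 sol
  (o + t0 *: axis R d) o.
rewrite eE; apply => //.
- apply: box_image; rewrite /box /= addrAC subrr add0r.
  apply: le_trans (norm_axis _ _) _; rewrite gtr0_norm // ler_peMl ?ler1n //; exact: ltW.
- by apply: box_image; rewrite /box /= subrr normr0 mulr_ge0 // ltW.
Qed.

End scales.

(** All parameters come from [f0], [K] and [tau], so a single [sigma] rules out every solution with
    constant [K] for every nearby density. *)
Theorem rough_checker : exists sigma : 'rV[R]_D -> R, [/\ continuous sigma,
  forall x, `|sigma x| <= 1 &
  forall rho f g, measurable_fun setT rho -> omega_solution a w K rho f g ->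
    {ae L, forall x, cube x ->
      `|rho x - rho0 x * (1 + tau * sigma (f0 x))| <= tau / 8 * rho0 x} -> False].
Proof.
have top0 := omega_topological a_gt0 al_range K_gt0 wE sol0.
have [p [r r0 pr]] := image_has_interior top0.
have [t0 t00 [t0r t0_small]] := small_scale r0 a1_gt0 K_ge1 (ltn0Sn d.+1).
have box_image : box p (3 * t0) `<=` f0 @` cube.
  by move=> x bx; apply: pr; exact: le_trans bx t0r.
have Q_image : cubeQ p t0 `<=` f0 @` cube.
  by move=> x Qx; apply: box_image; exact: cubeQ_box.
pose m := Num.min a1 ((t0 ^+ 2 / (4 * K ^+ 2)) ^+ 2 / (4 * K ^+ 2)).
have K4 : 0 < 4 * K ^+ 2 by rewrite mulr_gt0 // exprn_gt0.
have m0 : 0 < m.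
  by rewrite lt_min a1_gt0 divr_gt0 // exprn_gt0 // divr_gt0 // exprn_gt0.
have c00 : 0 < m / t0 by rewrite divr_gt0.
have [tau0 _] := andP tau_range.
have U0 : 0 <= Num.max 0 (ln (4 * K ^+ 2 / t0 ^+ 2)) by rewrite le_max lexx.
have [lam [q [J [N' [k [[lam0 q0 N0 k0] [growth flat thin sharp lam_big]]]]]]] :=
  @parameters R D tau (m / t0) (5 * D%:R * K ^+ 2) _ (ltn0Sn d.+1) tau0 c00 U0.
exists (checker p t0 N' q J); split.
- exact: checker_continuous.
- exact: checker_bound.
move=> rho f g mrho sol near.
have top := omega_topological a_gt0 al_range K_gt0 wE sol.
have lamR : (0 : R) < lam%:R by rewrite ltr0n.
apply: (no_checker_solution mrho0 mrho top0 top t00 N0 q0 lamR c00 k0 Q_image _ _ growth flat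
  thin sharp tau_range near).
- move=> s x y ts Qx Qy xy.
  apply: le_trans (transfer_upper t00 box_image t0_small sol N0 q0 ts Qx Qy xy) _.
  apply: ler_wpM2r lam_big; exact: le_trans (normr_ge0 _) xy.
- rewrite divfK ?gt_eqF //; exact: (transfer_lower t00 box_image t0_small sol).
Qed.

End rough.

(** * Porosity *)

Section solvable.
Variables (R : realType) (d : nat) (a al : R) (w : R -> R).
Hypothesis wE : forall t, 0 < t < a -> w t = t * ln (1 / t) `^ al.
Local Notation cube := (cube R d).

Let w_ge0 t : 0 < t < a -> 0 <= w t.
Proof. by move=> ta; have /andP[t0 _] := ta; rewrite wE // mulr_ge0 ?powR_ge0 // ltW. Qed.

Lemma omega_solution_le K K' (rho : 'rV[R]_d -> R) f g : K <= K' ->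
  omega_solution a w K rho f g -> omega_solution a w K' rho f g.
Proof.
move=> KK [fK Hf Hg eqn]; split => // x y Sx Sy xy.
- by apply: le_trans (Hf _ _ Sx Sy xy) _; apply: ler_wpM2r => //; exact: w_ge0.
- by apply: le_trans (Hg _ _ Sx Sy xy) _; apply: ler_wpM2r => //; exact: w_ge0.
Qed.

Lemma bi_omega_solvableP (rho : 'rV[R]_d -> R) :
  bi_omega_solvable a w rho <-> exists n f g, omega_solution a w n.+1%:R rho f g.
Proof.
split=> [[f [inj [K1 K10 Hf] [g fK [K2 K20 Hg]]] eqn]|[n [f [g [fK Hf Hg eqn]]]]].
  have [n _ Hn] := nat_above (Num.max K1 K2).
  move: Hn; rewrite gt_max => /andP[h1 h2].
  have [h1' h2'] : K1 <= n.+1%:R /\ K2 <= n.+1%:R.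
    by split; [apply: le_trans (ltW h1) _|apply: le_trans (ltW h2) _]; rewrite ler_nat.
  exists n, f, g; split => // x y Sx Sy xy.
    by apply: le_trans (Hf _ _ Sx Sy xy) _; apply: ler_wpM2r => //; exact: w_ge0.
  by apply: le_trans (Hg _ _ Sx Sy xy) _; apply: ler_wpM2r => //; exact: w_ge0.
exists f => //; split.
- by move=> x y cx cy xy; rewrite -(fK x) // -(fK y) // xy.
- by exists n.+1%:R.
- by exists g => //; exists n.+1%:R.
Qed.

End solvable.

Section porous_solvable.
Variables (R : realType) (d : nat) (a : R) (w : R -> R).
Local Notation D := d.+2.
Local Notation L := (lebesgue_rV R D).
Local Notation cube := (cube R D).
Hypotheses (a_gt0 : 0 < a).
Hypothesis wE : forall t, 0 < t < a -> w t = t * ln (1 / t) `^ critical_exponent R D.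

(* [Ae P] reads "P holds everywhere on the cube" for C and "almost everywhere on the cube" for
   L^oo, so that both spaces are handled at once. *)
Variables (X : metricType R) (ev : X -> 'rV[R]_D -> R) (Ae : ('rV[R]_D -> Prop) -> Prop).
Hypothesis mev : forall x, measurable_fun setT (ev x).
Hypothesis Ae_ae : forall P : 'rV[R]_D -> Prop, Ae P -> {ae L, forall x, cube x -> P x}.
Hypothesis AeS : forall P Q : 'rV[R]_D -> Prop, (forall x, cube x -> P x -> Q x) -> Ae P -> Ae Q.
Hypothesis AeA : forall P : nat -> 'rV[R]_D -> Prop, (forall n, Ae (P n)) -> Ae (fun x => forall n, P n x).
Hypothesis dist_Ae : forall x y e, mdist x y <= e -> Ae (fun z => `|ev x z - ev y z| <= e).
Hypothesis Ae_dist : forall x y e, 0 <= e -> Ae (fun z => `|ev x z - ev y z| <= e) -> mdist x y <= e.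
Hypothesis bounded : forall x, exists M, Ae (fun z => `|ev x z| <= M).
Hypothesis modify : forall x (u : 'rV[R]_D -> R) v, {within cube, continuous u} ->
  exists y, Ae (fun z => ev y z = u z * ev x z + v).
Hypothesis Ae_of_ae : forall x, {ae L, forall z, cube z -> 0 <= ev x z} -> Ae (fun z => 0 <= ev x z).

Let S := [set x | bi_omega_solvable a w (ev x)].
Let Z := [set x | S x /\ forall n : nat, ~ Ae (fun z => n.+1%:R^-1 <= ev x z)].
Let F n := [set x | (exists f g, omega_solution a w n.+1%:R (ev x) f g) /\
  Ae (fun z => n.+1%:R^-1 <= ev x z)].

Let AeI (P Q : 'rV[R]_D -> Prop) : Ae P -> Ae Q -> Ae (fun x => P x /\ Q x).
Proof.
move=> HP HQ; pose H (n : nat) := if n is 0 then P else Q.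
have : Ae (fun x => forall n, H n x) by apply: AeA => -[|n].
by apply: AeS => x _ HH; split; [exact: (HH 0%N) | exact: (HH 1%N)].
Qed.

Let al_range : 0 < critical_exponent R D <= 1.
Proof. by rewrite critical_exponent_gt0 critical_exponent_le1. Qed.

Lemma solvable_Ae_ge0 x : S x -> Ae (fun z => 0 <= ev x z).
Proof.
move=> /(bi_omega_solvableP wE)[n [f [g sol]]]; apply: Ae_of_ae.
have n0 : (0 : R) < n.+1%:R by rewrite ltr0n.
exact: (solution_ge0 (mev x) (omega_topological a_gt0 al_range n0 wE sol)).
Qed.

Lemma solvable_cover : S = Z `|` \bigcup_n F n.
Proof.
apply/seteqP; split => x.
  move=> Sx; case: (pselect (forall n : nat, ~ Ae (fun z => n.+1%:R^-1 <= ev x z))) => H.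
    by left.
  right; move/existsNP: H => [m /contrapT Hm].
  have [n [f [g sol]]] := (bi_omega_solvableP wE (ev x)).1 Sx.
  exists (maxn m n) => //; split.
    exists f, g; apply: (omega_solution_le wE _ sol).
    by rewrite ler_nat ltnS leq_maxr.
  apply: AeS Hm => z _; apply: le_trans.
  by rewrite lef_pV2 ?posrE ?ltr0n // ler_nat ltnS leq_maxl.
by case=> [[]//|[n _ [[f [g sol]] _]]]; apply/(bi_omega_solvableP wE); exists n, f, g.
Qed.

(** If [x] is nonnegative, all functions within [e / 4] of [x + e / 2] are bounded below by [e / 4],
    hence outside [Z]. Otherwise [x] lies below some [- 1 / (m + 1)] on a set that counts, and
    functions close to [x] are not nonnegative, hence not solvable. *)
Lemma porous_degenerate : porous Z.
Proof.
move=> x; case: (pselect (Ae (fun z => 0 <= ev x z))) => Hx.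
  exists 1, (1 / 4); split; [exact: ltr01 | by lra|].
  move=> e /andP[e0 e1].
  have [y Hy] : exists y, Ae (fun z => ev y z = 1 * ev x z + e / 2).
    by apply: modify; apply: continuous_subspaceT; exact: cst_continuous.
  exists y.
    apply: Ae_dist (ltW e0) _; apply: AeS Hy => z _ ->.
    by rewrite mul1r addrAC subrr add0r ger0_norm; lra.
  apply/seteqP; split => // z []; rewrite ballEmdist /= => yz [_ Hz].
  have [n _ Hn] := nat_above (4 / e).
  apply: (Hz n); have := AeI Hx (AeI Hy (dist_Ae (ltW yz))).
  apply: AeS => t _ [h1 [-> h2]]; move: h2; rewrite ler_distl => /andP[_ h2].
  have n0 : (0 : R) < n.+1%:R by rewrite ltr0n.
  apply: le_trans (_ : e / 4 <= _); last by lra.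
  rewrite -[leRHS]invrK lef_pV2 ?posrE ?invr_gt0 ?divr_gt0 // invf_div.
  by apply: le_trans (ltW Hn) _; rewrite ler_nat.
have [m Hm] : exists m : nat, ~ Ae (fun z => - m.+1%:R^-1 <= ev x z).
  apply: contrapT => /forallNP H; apply: Hx.
  have : Ae (fun z => forall n : nat, - n.+1%:R^-1 <= ev x z) by apply: AeA => n; exact: contrapT (H n).
  apply: AeS => z _ Hz; rewrite leNgt; apply/negP => z0.
  have nz : 0 < - ev x z by rewrite oppr_gt0.
  have [n _ Hn] := nat_above (- ev x z)^-1.
  have := Hz n; rewrite lerNl leNgt => /negP; apply.
  have n0 : (0 : R) < n.+1%:R by rewrite ltr0n.
  rewrite -[ltRHS]invrK ltf_pV2 ?posrE ?invr_gt0 //.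
  by apply: lt_le_trans Hn _; rewrite ler_nat.
have m0 : (0 : R) < m.+1%:R^-1 by rewrite invr_gt0 ltr0n.
exists m.+1%:R^-1, (1 / 2); split; [exact: m0 | by lra|].
move=> e /andP[e0 em]; exists x; first by rewrite mdistxx ltW.
apply/seteqP; split => // z []; rewrite ballEmdist /= => yz [Sz _].
apply: Hm; have := AeI (solvable_Ae_ge0 Sz) (dist_Ae (ltW yz)).
apply: AeS => t _ [h1]; rewrite ler_distl => /andP[h2 _].
by move: em h1 h2; move: m.+1%:R^-1 (ev x t) (ev z t) => u v p; lra.
Qed.

(** Either [x] itself is far from [F n], or some [x0] in [F n] is close to it. Then the ball is
    centred at [x0] times [1 + tau * sigma (f0 z)] with [tau = e / (4 M)], which moves [x0] by at
    most [e / 4]. Its radius is [tau / 8 * c], at most [tau / 8] times [x0], as [rough_checker]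
    demands. *)
Lemma porous_solvable_bounded_below n : porous (F n).
Proof.
move=> x; have [M0 HM0] := bounded x.
(* The added 1 leaves room for passing from [x] to a nearby [x0], which is then bounded by [M]
   too. *)
pose M := Num.max 0 M0 + 1.
have M1 : 1 <= M by rewrite lerDr le_max lexx.
have HM : Ae (fun z => `|ev x z| <= M - 1).
  by apply: AeS HM0 => z _ h; rewrite /M addrK le_max h orbT.
move: M M1 HM => M M1 HM {M0 HM0}.
have n0 : (0 : R) < n.+1%:R by rewrite ltr0n.
pose c : R := n.+1%:R^-1; have c0 : 0 < c by rewrite invr_gt0.
have c1 : c <= 1 by rewrite invf_le1 // ler1n.
have MM : 0 < 32 * M by rewrite mulr_gt0 //; exact: lt_le_trans ltr01 M1.
have al_small : c / (32 * M) <= 1 / 4 by rewrite ler_pdivrMr //; lra.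
have al0 : 0 < c / (32 * M) by rewrite divr_gt0.
exists 1, (c / (32 * M)); split; [exact: ltr01 | by rewrite al0 (le_lt_trans al_small) //; lra|].
move=> e /andP[e0 e1].
case: (pselect (exists2 x0, F n x0 & mdist x x0 < c / (32 * M) * e)); last first.
  move=> none; exists x; first by rewrite mdistxx ltW.
  apply/seteqP; split => // z []; rewrite ballEmdist /= => yz Fz.
  by apply: none; exists z.
move=> [x0 [[f0 [g0 sol0]] x0c] xx0].
have ale : c / (32 * M) * e <= e / 4.
  have -> : e / 4 = 1 / 4 * e by field.
  by apply: ler_wpM2r al_small; exact: ltW.
have [tau tauE] : exists u, u = e / (4 * M) by eexists.
have M0 : 0 < M := lt_le_trans ltr01 M1.
have tau0 : 0 < tau by rewrite tauE divr_gt0 // mulr_gt0.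
have tau_range : 0 < tau <= 1 / 4.
  by rewrite tau0 tauE ler_pdivrMr ?mulr_gt0 //; lra.
have [uf0 _ _ _] := omega_topological a_gt0 al_range n0 wE sol0.
have n1 : (1 : R) <= n.+1%:R by rewrite ler1n.
have [sigma [csigma sigma1 Hsigma]] := rough_checker a_gt0 n1 wE (mev x0) sol0 tau_range.
have cu : {within cube, continuous (fun z => 1 + tau * sigma (f0 z))}.
  have cf := ucont_within uf0 => z; apply: cvgD; first exact: cvg_cst.
  apply: cvgM; first exact: cvg_cst.
  exact: (continuous_comp (cf z) (csigma _)).
have [y Hy] := modify x0 0 cu.
have x0M : Ae (fun z => `|ev x0 z| <= M).
  have := AeI HM (dist_Ae (ltW xx0)); apply: AeS => t _ [h1 h2].
  have : `|ev x0 t| <= `|ev x t| + `|ev x t - ev x0 t|.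
    by rewrite -[X in `|X| <= _](subKr (ev x t)); exact: ler_normB.
  move: ale e1 h1 h2; lra.
have tauM : tau * M = e / 4 by rewrite tauE; field; rewrite gt_eqF.
exists y.
  apply: Ae_dist (ltW e0) _; have := AeI Hy (AeI x0M (dist_Ae (ltW xx0))).
  apply: AeS => t _ [-> [h1 h2]]; rewrite distrC.
  have -> : ev x t - ((1 + tau * sigma (f0 t)) * ev x0 t + 0) =
    (ev x t - ev x0 t) - tau * (sigma (f0 t) * ev x0 t) by ring.
  apply: le_trans (ler_normB _ _) _; rewrite !normrM (gtr0_norm tau0).
  have h3 : tau * (`|sigma (f0 t)| * `|ev x0 t|) <= e / 4.
    rewrite -tauM; apply: ler_wpM2l; first exact: ltW.
    by rewrite -[leRHS]mul1r; apply: ler_pM.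
  move: ale h2 h3; lra.
apply/seteqP; split => // z []; rewrite ballEmdist /= => yz [[f [g sol]] _].
apply: (Hsigma _ _ _ (mev z) sol); apply: Ae_ae.
have := AeI Hy (AeI x0c (dist_Ae (ltW yz))).
apply: AeS => t _ [-> [h1 h2]]; rewrite distrC.
have -> : ev x0 t * (1 + tau * sigma (f0 t)) = (1 + tau * sigma (f0 t)) * ev x0 t + 0.
  by rewrite addr0 mulrC.
apply: le_trans h2 _.
have -> : c / (32 * M) * e = tau / 8 * c by rewrite tauE; field; rewrite gt_eqF.
by apply: ler_wpM2l => //; rewrite divr_ge0 // ltW.
Qed.

Theorem sigma_porous_solvable : sigma_porous S.
Proof.
exists (fun n => if n is m.+1 then F m else Z) => [[|n]|].
- exact: porous_degenerate.
- exact: porous_solvable_bounded_below.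
rewrite solvable_cover; apply/seteqP; split => x.
  by case=> [Zx|[n _ Fx]]; [exists 0%N | exists n.+1].
by case=> -[_ Zx|n _ Fx]; [left | right; exists n].
Qed.

End porous_solvable.

(** * The two function spaces *)

Lemma cube_near_box (R : realType) d (x : 'rV[R]_d) s : 0 < s <= 1 -> cube R d x ->
  exists c, forall y, box c (s / 2) y -> cube R d y /\ `|x - y| <= s.
Proof.
move=> /andP[s0 s1] cx; have s20 : 0 <= s / 2 by rewrite divr_ge0 // ltW.
(* The box is the image of the cube under the homothety of ratio [s] with centre [x], hence lies in
   the cube even if [x] is on its boundary. *)
exists (\row_i (x ord0 i + s * (1 / 2 - x ord0 i))) => y yc.
have H i : 0 <= y ord0 i <= 1 /\ `|x ord0 i - y ord0 i| <= s.
  have := le_trans (norm_coord _ i) yc; rewrite !mxE ler_norml => /andP[h1 h2].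
  have /andP[x0 x1] := cx i.
  have p1 : 0 <= s * x ord0 i by rewrite mulr_ge0 // ltW.
  have p2 : 0 <= s * (1 - x ord0 i) by rewrite mulr_ge0 ?subr_ge0 // ltW.
  have p3 : 0 <= (1 - s) * x ord0 i by rewrite mulr_ge0 ?subr_ge0.
  have p4 : 0 <= (1 - s) * (1 - x ord0 i) by rewrite mulr_ge0 ?subr_ge0.
  move: (x ord0 i) (y ord0 i) h1 h2 p1 p2 p3 p4 {x0 x1} => u v h1 h2 p1 p2 p3 p4.
  by split; [apply/andP; split; lra | rewrite ler_norml; apply/andP; split; lra].
split; first by move=> i; have [] := H i.
by apply: norm_leP => [|i]; [exact: ltW | rewrite !mxE; have [] := H i].
Qed.

(** A continuous function that is negative at a point of the cube, possibly on its boundary, is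
    negative on a small box of positive measure inside the cube. *)
Lemma ae_ge0_within (R : realType) d (h : 'rV[R]_d -> R) : {within cube R d, continuous h} ->
  {ae lebesgue_rV R d, forall x, cube R d x -> 0 <= h x} -> forall x, cube R d x -> 0 <= h x.
Proof.
move=> /subspace_continuousP ch [N [mN N0 HN]] x cx; rewrite leNgt; apply/negP => hx.
have e0 : 0 < - h x by rewrite oppr_gt0.
have /cvgrPdist_lt/(_ _ e0)/nbhs_ballP[dl /= dl0 H] := ch _ cx.
pose s := Num.min 1 (dl / 2).
have s0 : 0 < s by rewrite lt_min ltr01 divr_gt0.
have s1 : s <= 1 by rewrite ge_min lexx.
have sdl : s < dl by apply: (@le_lt_trans _ _ (dl / 2)); [rewrite ge_min lexx orbT | rewrite ltr_pdivrMr // ltr_pMr // ltr1n].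
have ss : 0 < s <= 1 by rewrite s0.
have [c Hc] := cube_near_box ss cx.
have sub : box c (s / 2) `<=` N.
  move=> y /Hc[cy xy]; apply: HN => /= /(_ cy); apply/negP; rewrite -ltNge.
  have yb : ball x dl y by rewrite -ball_normE /=; exact: le_lt_trans xy sdl.
  have := H y yb cy; rewrite ltr_norml /from_subspace => /andP[h1 _]; lra.
have : (lebesgue_rV R d (box c (s / 2)) <= lebesgue_rV R d N)%E.
  exact: (le_measure (lebesgue_rV R d) (mem_set (measurable_box c (s / 2))) (mem_set mN) sub).
rewrite [X in (_ <= X)%E]N0 lebesgue_box ?divr_ge0 ?(ltW s0) // lee_fin leNgt => /negP; apply.
by rewrite exprn_gt0 // mulr_gt0 // divr_gt0.
Qed.

Section continuous_functions.
Variables (R : realType) (d : nat).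
Local Notation C := (Ccube R d).
Local Notation cube := (cube R d).
Local Notation L := (lebesgue_rV R d).
Implicit Types x y : C.

Definition extend x : 'rV[R]_d -> R := 'valL_(0 : R) (fun_of_Ccube x).

Lemma extend_within x : {within cube, continuous (extend x)}.
Proof. by apply/subspace_valL_continuousP'; exact: cts_fun. Qed.

Lemma extendE x (z : cube) : extend x (val z) = fun_of_Ccube x z.
Proof. by have /(congr1 (fun u => u z)) := @valLK _ _ (0 : R) _ (fun_of_Ccube x). Qed.

Lemma extend_notin x z : ~ cube z -> extend x z = 0.
Proof. by move=> nz; rewrite /extend /= oinv_set_val insubN //; apply/negP => /set_mem. Qed.

Lemma measurable_extend x : measurable_fun setT (extend x).
Proof.
rewrite (_ : extend x = (fun z => if z \in cube then extend x z else 0)); last first.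
  by apply/funext => z; case: ifPn => // /negP nz; apply: extend_notin => cz; apply: nz; exact: mem_set.
have cE : [set z | (z \in cube) = true] = cube.
  by apply/seteqP; split => z /=; [exact: set_mem | exact: mem_set].
apply: measurable_fun_if => //.
- apply: (measurable_fun_bool true); rewrite setTI (_ : _ @^-1` _ = cube) //; exact: measurable_cube.
- rewrite setTI (_ : _ @^-1` _ = cube) //.
  by apply: measurable_within_continuous; [exact: cube_compact | exact: extend_within].
Qed.

Lemma extend_bounded x : exists M, forall z, cube z -> `|extend x z| <= M.
Proof.
have [M [_ bM]] := compact_bounded (continuous_compact (@extend_within x) (@cube_compact R d)).
by exists (M + 1) => z cz; apply: (bM (M + 1)); [rewrite ltrDl | exists z].
Qed.

Lemma Ccube_distP x y e : 0 <= e ->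
  mdist x y <= e <-> forall z, cube z -> `|extend x z - extend y z| <= e.
Proof.
move=> e0; split => H.
  move=> z cz; rewrite -[z]/(val (SigSub (mem_set cz) : cube)) !extendE.
  apply: le_trans H; apply: ub_le_sup; last by exists (SigSub (mem_set cz)).
  have [M HM] := extend_bounded x; have [M' HM'] := extend_bounded y.
  exists (M + M') => _ [t _ <-]; rewrite -!extendE.
  by apply: le_trans (ler_normB _ _) (lerD _ _); [apply: HM | apply: HM']; exact: set_valP.
apply: ge_sup; last by move=> _ [t _ <-]; rewrite -!extendE; apply: H; exact: set_valP.
by eexists; exists (SigSub (mem_set (@cube0 R d))).
Qed.

Lemma Ccube_of_within (h : 'rV[R]_d -> R) : {within cube, continuous h} ->
  exists y, forall z, cube z -> extend y z = h z.
Proof.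
move=> /subspace_sigL_continuousP ch.
pose y : continuousType cube R := HB.pack (sigL cube h) (isContinuous.Build _ _ (sigL cube h) ch).
by exists (y : C) => z cz; rewrite -[z in LHS]/(val (SigSub (mem_set cz) : cube)) extendE.
Qed.

End continuous_functions.

Lemma sigma_porous_Ccube (R : realType) d (a : R) (w : R -> R) : 0 < a ->
  (forall t, 0 < t < a -> w t = t * ln (1 / t) `^ critical_exponent R d.+2) ->
  sigma_porous [set rho : Ccube R d.+2 | bi_omega_solvable a w (extend rho)].
Proof.
move=> a0 wE.
apply: (@sigma_porous_solvable R d a w a0 wE _ (@extend R d.+2) (fun P => forall z, cube R d.+2 z -> P z)).
- exact: measurable_extend.
- by move=> P HP; exact: aeW.
- by move=> P Q PQ HP z cz; apply: PQ => //; exact: HP.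
- by move=> P HP z cz n; exact: HP.
- by move=> x y e xy; apply/Ccube_distP => //; exact: le_trans (mdist_ge0 x y) xy.
- by move=> x y e e0 H; apply/Ccube_distP.
- exact: extend_bounded.
- move=> x u v cu; apply: Ccube_of_within => z; apply: cvgD; last exact: cvg_cst.
  by apply: cvgM; [exact: cu | exact: extend_within].
- by move=> x; apply: ae_ge0_within; exact: extend_within.
Qed.

Section essentially_bounded_functions.
Variables (R : realType) (d : nat).
Local Notation X := (Linfty_cube R d).
Local Notation cube := (cube R d).
Local Notation L := (lebesgue_rV R d).
Local Notation Lc := (@lebesgue_cube R d).
Implicit Types x y : X.

Lemma ae_lebesgue_cube (P : 'rV[R]_d -> Prop) :
  {ae Lc, forall z, P z} <-> {ae L, forall z, cube z -> P z}.
Proof.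
split=> -[N [mN N0 HN]].
  exists (N `&` cube); split => //; first exact: measurableI mN (@measurable_cube R d).
  by move=> z /= /not_implyP[cz nP]; split => //; exact: HN.
have mC := measurableC (@measurable_cube R d).
exists (N `|` ~` cube); split; first exact: measurableU.
  apply/eqP; rewrite eq_le measure_ge0 andbT -[leRHS]N0.
  have mU : measurable ((N `|` ~` cube) `&` cube) := measurableI _ _ (measurableU _ _ mN mC) (@measurable_cube R d).
  by apply: (le_measure L (mem_set mU) (mem_set mN)) => z [[//|nz] cz].
move=> z /= nP; case: (pselect (cube z)) => cz; [left | by right].
by apply: HN => /= H; apply: nP; exact: H.
Qed.

Lemma lebesgue_cubeT : (0 < Lc setT)%E.
Proof.
by rewrite /lebesgue_cube /mrestr setTI cube_box lebesgue_box ?divr_ge0 //.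
Qed.

Lemma Lnorm_leP (h : 'rV[R]_d -> R) e :
  (Lnorm Lc +oo%E (EFin \o h) <= e%:E)%E <-> {ae L, forall z, cube z -> `|h z| <= e}.
Proof.
rewrite -ae_lebesgue_cube unlock lebesgue_cubeT; split.
  by move=> /ess_supP; apply: filterS => z /=; rewrite lee_fin.
by move=> H; apply/ess_supP; apply: filterS H => z /=; rewrite lee_fin.
Qed.

Lemma measurable_Linfty x : measurable_fun setT (fun_of_Linfty x).
Proof. exact: (measurable_funPT (generic_quotient.repr (LebesgueSpace.sort x))). Qed.

Lemma Linfty_bounded x : exists M, {ae L, forall z, cube z -> `|fun_of_Linfty x z| <= M}.
Proof.
have fin : (Lnorm Lc +oo%E (EFin \o fun_of_Linfty x) < +oo)%E by exact: Lebesgue_finite.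
exists (fine (Lnorm Lc +oo%E (EFin \o fun_of_Linfty x))); apply/Lnorm_leP.
by rewrite fineK // ge0_fin_numE // Lnorm_ge0.
Qed.

Lemma Linfty_distP x y e :
  mdist x y <= e <-> {ae L, forall z, cube z -> `|fun_of_Linfty x z - fun_of_Linfty y z| <= e}.
Proof.
have -> : mdist x y = fine (Lnorm Lc +oo%E (EFin \o (fun_of_Linfty x \- fun_of_Linfty y))) by [].
rewrite -(Lnorm_leP (fun_of_Linfty x \- fun_of_Linfty y)) -lee_fin fineK //.
have [M HM] := Linfty_bounded x; have [M' HM'] := Linfty_bounded y.
rewrite ge0_fin_numE ?Lnorm_ge0 //; apply: (@le_lt_trans _ _ (M + M')%:E); last exact: ltry.
apply/Lnorm_leP; apply: filterS2 HM HM' => z h1 h2 cz /=.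
exact: le_trans (ler_normB _ _) (lerD (h1 cz) (h2 cz)).
Qed.

(** The representative of the class of [h] agrees with [h] almost everywhere on the cube, and the
    essential bound makes its norm finite. *)
Lemma Linfty_of_bounded (h : 'rV[R]_d -> R) M : measurable_fun setT (h : _ -> measurableTypeR R) ->
  {ae L, forall z, cube z -> `|h z| <= M} ->
  exists y, {ae L, forall z, cube z -> fun_of_Linfty y z = h z}.
Proof.
move=> mh HM.
pose hm : {mfun 'rV[R]_d >-> measurableTypeR R} :=
  HB.pack h (@isMeasurableFun.Build _ _ _ (measurableTypeR R) h mh).
pose hq : {mfun_ Lc, 'rV[R]_d >-> measurableTypeR R} := (\pi_({mfun_ Lc, 'rV[R]_d >-> measurableTypeR R}) hm)%qT.
have hE : {ae L, forall z, cube z -> generic_quotient.repr hq z = h z}.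
  apply/ae_lebesgue_cube.
  have : ae_eq_op Lc (generic_quotient.repr hq) hm by rewrite -eqmodE reprK.
  by move=> /asboolP; apply: filterS => z; exact.
have fin : finite_norm Lc +oo%E (hq : _ -> _).
  apply: (@le_lt_trans _ _ M%:E); last exact: ltry.
  apply/Lnorm_leP; apply: filterS2 hE HM => z h1 h2 cz; rewrite -[X in `|X|]/(generic_quotient.repr hq z) h1 //.
  exact: h2.
pose y : LspaceType Lc (leey 1) := HB.pack hq (isFinLebesgue.Build _ _ _ _ _ (leey 1) hq fin).
by exists (y : X).
Qed.

End essentially_bounded_functions.

Lemma sigma_porous_Linfty (R : realType) d (a : R) (w : R -> R) : 0 < a ->
  (forall t, 0 < t < a -> w t = t * ln (1 / t) `^ critical_exponent R d.+2) ->
  sigma_porous [set rho : Linfty_cube R d.+2 | bi_omega_solvable a w (fun_of_Linfty rho)].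
Proof.
move=> a0 wE.
apply: (@sigma_porous_solvable R d a w a0 wE _ (@fun_of_Linfty R d.+2)
  (fun P => {ae lebesgue_rV R d.+2, forall z, cube R d.+2 z -> P z})).
- exact: measurable_Linfty.
- by [].
- by move=> P Q PQ; apply: filterS => z H cz; apply: PQ => //; exact: H.
- move=> P HP; apply: filterS (ae_foralln HP) => z H cz n; exact: H.
- by move=> x y e /Linfty_distP.
- by move=> x y e _ H; apply/Linfty_distP.
- exact: Linfty_bounded.
- move=> x u v cu.
  (* [u] is continuous only on the cube; setting it to zero elsewhere makes the product measurable
     on the whole space. *)
  pose h z := (if z \in cube R d.+2 then u z else 0) * fun_of_Linfty x z + v.
  have mh : measurable_fun setT (h : _ -> measurableTypeR R).
    apply: measurable_funD => //; apply: measurable_funM; last exact: measurable_Linfty.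
    apply: measurable_fun_if => //.
    + apply: (measurable_fun_bool true); rewrite setTI (_ : _ @^-1` _ = cube R d.+2); first exact: measurable_cube.
      by apply/seteqP; split => z /=; [exact: set_mem | exact: mem_set].
    + rewrite setTI (_ : _ @^-1` _ = cube R d.+2).
        by apply: measurable_within_continuous => //; exact: cube_compact.
      by apply/seteqP; split => z /=; [exact: set_mem | exact: mem_set].
  have [M HM] := Linfty_bounded x.
  have [U [_ bU]] := compact_bounded (continuous_compact cu (@cube_compact R d.+2)).
  have HU z : cube R d.+2 z -> `|u z| <= U + 1.
    by move=> cz; apply: (bU (U + 1)); [rewrite ltrDl | exists z].
  have hM : {ae lebesgue_rV R d.+2, forall z, cube R d.+2 z -> `|h z| <= (U + 1) * M + `|v|}.
    apply: filterS HM => z Hz cz; rewrite /h mem_set //.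
    apply: le_trans (ler_normD _ _) _; rewrite lerD2r normrM.
    by apply: ler_pM => //; [exact: HU | exact: Hz].
  have [y Hy] := Linfty_of_bounded mh hM.
  exists y; apply: filterS Hy => z Hz cz; rewrite Hz // /h mem_set //.
- by [].
Qed.

Theorem theorem1p7 (R : realType) (d : nat) (d_ge2 : (2 <= d)%N) :
  exists2 alpha0 : R, 0 < alpha0 &
  forall (a : R) (w : R -> R), 0 < a ->
    (forall t, 0 < t < a -> 0 < w t) ->
    set_inj `]0, a[ w ->
    (forall t, 0 < t < a -> w t = t * ln (1 / t) `^ alpha0) ->
  sigma_porous [set rho : Ccube R d |
    bi_omega_solvable a w ('valL_(0 : R) (fun_of_Ccube rho))] /\
  sigma_porous [set rho : Linfty_cube R d |
    bi_omega_solvable a w (fun_of_Linfty rho)].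
Proof.
case: d d_ge2 => [|[|d]] // _; exists (critical_exponent R d.+2).
  exact: critical_exponent_gt0.
move=> a w a0 _ _ wE; split; first exact: sigma_porous_Ccube.
exact: sigma_porous_Linfty.
Qed.
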